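(* Let $G$ be a subgroup of the direct or inverse limit of a directed system of groups $(G_i)_{i\in I}$. Assume that for every $i\in I$: $G_i\in\mathcal{G}$, $G_i$ is torsion-free, and $G_i$ satisfies the strong Atiyah conjecture over $\overline{\mathbb{Q}}G_i$. Then $G$ also satisfies the strong Atiyah conjecture over $\overline{\mathbb{Q}}G$.
   Context: $\overline{\mathbb{Q}}$ is the field of algebraic numbers in $\mathbb{C}$. For a discrete group $G$, $l^2(G)=\{f\colon G\to\mathbb{C}\mid \sum_{g\in G}|f(g)|^2<\infty\}$. A matrix $A\in M(d\times d,\mathbb{C}G)$ acts by left convolution as a bounded operator $A\colon l^2(G)^d\to l^2(G)^d$, which commutes with the right $G$-action. For a bounded operator $T$ on $l^2(G)^d$ commuting with the right $G$-action put $\mathrm{tr}_G(T)=\sum_{i=1}^d\langle Te_i,e_i\rangle$, where $e_i\in l^2(G)^d$ has the trivial element $1\in G\subset l^2(G)$ in the $i$-th position and zeros elsewhere. Put $\dim_G(\ker A)=\mathrm{tr}_G(\mathrm{pr}_{\ker A})$, where $\mathrm{pr}_{\ker A}$ is the orthogonal projection onto $\ker A$. For a subring $K\subset\mathbb{C}$, a torsion-free group $G$ satisfies the strong Atiyah conjecture over $KG$ if $\dim_G(\ker A)\in\mathbb{Z}$ for all $d$ and all $A\in M(d\times d,KG)$. Directed system: the index set $I$ is partially ordered, any two $i,j\in I$ admit $k\in I$ with $i<k$, $j<k$, and there are compatible homomorphisms $G_i\to G_j$ for $i<j$ (for direct limits) or $G_j\to G_i$ for $i<j$ (for inverse limits).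 Generalized amenable extension: let $G$ be a finitely generated discrete group with a finite symmetric set of generators $S$, and let $H$ be a normal subgroup of $G$. $G$ is a generalized amenable extension of $H$ if there is a set $X$ with a free left $G$-action and a commuting free right $H$-action, and a sequence of $H$-invariant subsets $X_1\subset X_2\subset\cdots\subset X$ with $\bigcup_k X_k=X$, $|X_k/H|<\infty$ for every $k$, and $\frac{|(S\cdot X_k-X_k)/H|}{|X_k/H|}\to 0$ as $k\to\infty$ (here $S\cdot X_k-X_k$ is the set difference). $\mathcal{G}$ is the smallest class of groups which contains the trivial group and is closed under: (i) if $H\in\mathcal{G}$ and $G$ is a generalized amenable extension of $H$, then $G\in\mathcal{G}$; (ii) if $H\in\mathcal{G}$ and $U$ is a subgroup of $H$, then $U\in\mathcal{G}$; (iii) if $G$ is the direct or inverse limit of a directed system of groups $G_i\in\mathcal{G}$, then $G\in\mathcal{G}$. *)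

(* Defs.v *)
From HB Require Import structures.
From mathcomp Require Import all_boot all_order all_algebra.
From mathcomp Require Import finmap.
From mathcomp Require Import all_classical all_reals all_analysis.
From mathcomp Require Import complex.

Set Implicit Arguments.
Unset Strict Implicit.
Unset Printing Implicit Defensive.

Import Order.TTheory GRing.Theory Num.Theory.
Import numFieldNormedType.Exports.

Local Open Scope classical_set_scope.
Local Open Scope ring_scope.

Section GroupNotions.
Implicit Types G H U : groupType.

Definition torsion_free G : Prop :=
  forall (g : G) (n : nat), (0 < n)%N -> (g ^+ n = 1)%g -> (g = 1)%g.

Definition trivial_group G : Prop := forall g : G, (g = 1)%g.

Definition is_subgroup U H : Prop :=
  exists f : {multiplicative U -> H}, injective f.

End GroupNotions.

Section Limits.
Context (disp : Order.disp_t) (I : porderType disp).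

Definition directed : Prop :=
  forall i j : I, exists k : I, (i < k)%O /\ (j < k)%O.

Definition is_direct_limit (G_ : I -> groupType)
    (f : forall i j : I, (i < j)%O -> {multiplicative G_ i -> G_ j})
    (L : groupType) (phi : forall i : I, {multiplicative G_ i -> L}) : Prop :=
  let cocone (H : groupType) (psi : forall i, {multiplicative G_ i -> H}) :=
    forall i j (ij : (i < j)%O) x, psi j (f i j ij x) = psi i x in
  cocone L phi /\
  forall (H : groupType) (psi : forall i, {multiplicative G_ i -> H}),
    cocone H psi ->
    exists u : {multiplicative L -> H},
      (forall i x, u (phi i x) = psi i x) /\
      forall v : {multiplicative L -> H},
        (forall i x, v (phi i x) = psi i x) -> v =1 u.

Definition is_inverse_limit (G_ : I -> groupType)
    (f : forall i j : I, (i < j)%O -> {multiplicative G_ j -> G_ i})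
    (L : groupType) (p : forall i : I, {multiplicative L -> G_ i}) : Prop :=
  let cone (H : groupType) (q : forall i, {multiplicative H -> G_ i}) :=
    forall i j (ij : (i < j)%O) x, f i j ij (q j x) = q i x in
  cone L p /\
  forall (H : groupType) (q : forall i, {multiplicative H -> G_ i}),
    cone H q ->
    exists u : {multiplicative H -> L},
      (forall i x, p i (u x) = q i x) /\
      forall v : {multiplicative H -> L},
        (forall i x, p i (v x) = q i x) -> v =1 u.

Definition direct_limit_of (G_ : I -> groupType) (L : groupType) : Prop :=
  exists f : forall i j : I, (i < j)%O -> {multiplicative G_ i -> G_ j},
    (forall i j k (ij : (i < j)%O) (jk : (j < k)%O) (ik : (i < k)%O) x,
       f j k jk (f i j ij x) = f i k ik x) /\
    exists phi : forall i : I, {multiplicative G_ i -> L},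
      is_direct_limit f phi.

Definition inverse_limit_of (G_ : I -> groupType) (L : groupType) : Prop :=
  exists f : forall i j : I, (i < j)%O -> {multiplicative G_ j -> G_ i},
    (forall i j k (ij : (i < j)%O) (jk : (j < k)%O) (ik : (i < k)%O) x,
       f i j ij (f j k jk x) = f i k ik x) /\
    exists p : forall i : I, {multiplicative L -> G_ i},
      is_inverse_limit f p.

Definition directed_limit (G_ : I -> groupType) (L : groupType) : Prop :=
  directed /\ (direct_limit_of G_ L \/ inverse_limit_of G_ L).

End Limits.

Section AmenableExtension.
Context (R : realType).
Implicit Types G H : groupType.

Definition generates G (S : set G) : Prop :=
  forall P : set G, P 1%g ->
    (forall x y, P x -> P y -> P (x * y)%g) -> (forall x, P x -> P (x^-1)%g) ->
    S `<=` P -> P = setT.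

(* [orbits ra Y] is Y/H, as a set of subsets of X *)
Definition orbits H (X : Type) (ra : X -> H -> X) (Y : set X) : set (set X) :=
  [set range (ra x) | x in Y].

(* [fset_set A] is empty when A is infinite; here A is always finite. *)
Definition ncard (T : choiceType) (A : set T) : nat := #|` fset_set A |%fset.

(* H is a normal subgroup of G through the embedding [iota]. The sets X_k are
   required to be nonempty so that the quotients |(S X_k - X_k)/H| / |X_k/H|
   make sense; with X empty and 0 / 0 = 0 the condition would be void. *)
Definition gen_amenable_ext_wrt G (S : set G) H
    (iota : {multiplicative H -> G}) : Prop :=
  [/\ finite_set S, (forall s, S s -> S (s^-1)%g), generates S,
      injective iota
    & forall g h, exists h', (g * iota h * g^-1)%g = iota h'] /\
  exists (X : Type) (la : G -> X -> X) (ra : X -> H -> X) (X_ : nat -> set X),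
    [/\ (forall x, la 1%g x = x),
        (forall g g' x, la (g * g')%g x = la g (la g' x)),
        (forall g x, la g x = x -> g = 1%g)
      & [/\ (forall x, ra x 1%g = x),
            (forall x h h', ra x (h * h')%g = ra (ra x h) h'),
            (forall x h, ra x h = x -> h = 1%g)
          & forall g x h, la g (ra x h) = ra (la g x) h]] /\
    [/\ (forall k, X_ k !=set0),
        (forall k, X_ k `<=` X_ k.+1),
        \bigcup_k X_ k = setT,
        (forall k x h, X_ k x -> X_ k (ra x h))
      & (forall k, finite_set (orbits ra (X_ k))) /\
        (fun k => (ncard (orbits ra
                     ([set la s x | s in S & x in X_ k] `\` X_ k)))%:R
                  / (ncard (orbits ra (X_ k)))%:R : R) @ \oo --> (0 : R)].

Definition gen_amenable_ext G H : Prop :=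
  exists (S : set G) (iota : {multiplicative H -> G}),
    gen_amenable_ext_wrt S iota.

Inductive classG : groupType -> Prop :=
| classG_trivial G : trivial_group G -> classG G
| classG_ext H G : classG H -> gen_amenable_ext G H -> classG G
| classG_sub H U : classG H -> is_subgroup U H -> classG U
| classG_lim (disp : Order.disp_t) (I : porderType disp)
    (G_ : I -> groupType) (G : groupType) :
    (forall i, classG (G_ i)) -> directed_limit G_ G -> classG G.

End AmenableExtension.

Section L2.
Context (R : realType).
Local Notation C := R[i].

(* Sums over an arbitrary index set; only meaningful for absolutely summable
   families, the only ones they are applied to. *)
Definition rsum (T : choiceType) (f : T -> R) : R :=
  fine (\esum_(t in setT) ((EFin \o f)^\+)%E t)
  - fine (\esum_(t in setT) ((EFin \o f)^\-)%E t).

Definition csum (T : choiceType) (f : T -> C) : C :=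
  (rsum (fun t => complex.Re (f t)) +i* rsum (fun t => complex.Im (f t)))%C.

Context (G : groupType) (d : nat).

Definition vec : Type := 'I_d -> G -> C.
Definition l2 : set vec :=
  [set x | forall i, summable setT (fun g => ((Normc.normc (x i g)) ^+ 2)%:E)].
Definition inner (x y : vec) : C :=
  \sum_(i < d) csum (fun g => x i g * (y i g)^*%C).

Definition std_basis (i : 'I_d) : vec :=
  fun j g => ((j == i) && (g == 1%g))%:R.

Definition trG (T : vec -> vec) : C :=
  \sum_(i < d) inner (T (std_basis i)) (std_basis i).

(* the group ring C[G]: finitely supported functions *)
Definition convol (a : {fsfun G -> C with 0}) (x : G -> C) : G -> C :=
  fun g => \sum_(h <- finsupp a) a h * x (h^-1 * g)%g.
Definition mxact (A : 'M[{fsfun G -> C with 0}]_d) (x : vec) : vec :=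
  fun i g => \sum_(j < d) convol (A i j) (x j) g.

Definition ker_mx (A : 'M[{fsfun G -> C with 0}]_d) : set vec :=
  [set x | l2 x /\ forall i g, mxact A x i g = 0].

(* For a closed subspace V of l^2(G)^d this is the orthogonal projection onto
   V: the vector y exists and is unique for every x in l^2(G)^d. *)
Definition orth_proj (V : set vec) (x : vec) : vec :=
  xget 0 [set y | V y /\ forall v, V v -> inner (x - y) v = 0].

Definition dim_ker (A : 'M[{fsfun G -> C with 0}]_d) : C :=
  trG (orth_proj (ker_mx A)).

End L2.

Definition algebraic_numbers (R : realType) : set R[i] :=
  [set z | algebraicOver ratr z].

Definition strong_Atiyah (R : realType) (K : set R[i]) (G : groupType) : Prop :=
  torsion_free G /\
  forall (d : nat) (A : 'M[{fsfun G -> R[i] with 0}]_d),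
    (forall i j g, K (A i j g)) -> exists m : int, dim_ker A = m%:~R.

(* Main.v *)
Require Import Defs.
From HB Require Import structures.
From mathcomp Require Import all_boot all_order all_algebra.
From mathcomp Require Import finmap.
From mathcomp Require Import all_classical all_reals all_analysis.
From mathcomp Require Import complex mxtens.
From mathcomp Require Import lra.

Set Implicit Arguments.
Unset Strict Implicit.
Unset Printing Implicit Defensive.
Import Order.TTheory GRing.Theory Num.Theory.
Import numFieldNormedType.Exports.
Local Open Scope classical_set_scope.
Local Open Scope ring_scope.

(** The dimension of the kernel of [A] is a limit of traces that only see
    finitely many group elements.  Let [k] bound the square of the operator norm
    of [A] and put [T := 1 - A^* A / k].  The powers of the self-adjoint
    contraction [T] converge strongly to the projection onto the kernel, and the
    traces of [T^(2m)], the moments of [A], decrease to dim_G(ker A)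
    ([kernel_dim_moments]).  A moment is a polynomial expression in the group
    ring: it depends on which of finitely many products of group elements are
    trivial, and on nothing else.  A subgroup of a direct or inverse limit of
    the [G_i] embeds locally into the [G_i]: on every finite set some map to some
    [G_i] is multiplicative and detects the identity
    ([directed_limit_locally_embeds]).  So finitely many moments of [A] agree with
    those of a matrix [A_i] over [G_i] ([moment_relabel]), whose kernel dimension
    is an integer.

    To conclude that the dimension for [A] is a limit of integers, hence an
    integer, the convergence of the moments must be uniform in [i].  The uniform
    rate is [has_decay]: the [M]-th moment exceeds no other moment by more than
    the size of the matrix times [decay dl q M], where [dl] depends only on the
    coefficients and on the number of terms in a row or a column.  It is a
    logarithmic bound on the spectrum near 0, of the kind that a lower bound on
    Fuglede-Kadison determinants provides, stated in terms of traces alone so that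
    it can be transported without spectral theory on l2(G).

    For the trivial group the bound comes from integrality.  After multiplication by
    a common denominator the coefficients act as integer matrices on a common
    eigenvector; hence the eigenvalues of [A^* A] are eigenvalues of an integer
    matrix, whose lowest non-zero characteristic coefficient has absolute value at
    least 1.  The non-zero eigenvalues of [A^* A] therefore have a product at least
    [dl ^ n] after rescaling ([prod_nonzero_eigen_ge]), so at most [n / (q + 1)] of
    them lie below [dl ^ (q + 1)] ([power_sum_le_decay]).

    The bound is inherited along the closure operations that generate the class.
    Subgroups and limits are local embeddings ([has_decay_local]).  For a generalized
    amenable extension the matrix acts on functions on [X]; its compression to a
    Folner set is a matrix over the smaller group with the same coefficients and no
    more terms in a row or a column, and its moments per orbit converge to those of
    [A], because most orbits stay inside the Folner set under the finitely many
    translations that occur ([has_decay_extension]). *)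

(** * Group ring matrices as lists of terms *)

Section Terms.
Context (R : rcfType) (J : finType).
Local Notation C := R[i].
(** Row, column, label and coefficient. A list of terms represents a matrix
    over the group ring without collecting equal labels, so that relabelling
    along a map of groups changes neither the coefficients nor the number of
    terms in a row. *)
Definition term (G : Type) : Type := (J * J * G * C)%type.
Definition trow G (t : term G) : J := t.1.1.1.
Definition tcol G (t : term G) : J := t.1.1.2.
Definition tlab G (t : term G) : G := t.1.2.
Definition tcf G (t : term G) : C := t.2.
Definition relabel G G' (th : G -> G') (W : seq (term G)) : seq (term G') :=
  [seq (trow t, tcol t, th (tlab t), tcf t) | t <- W].
Definition delta (X : eqType) (i : J) (x : X) : J -> X -> C :=
  fun j y => ((j == i) && (y == x))%:R.

Section Group.
Context (G : groupType).
Implicit Types (t u : term G) (A W V : seq (term G)) (k : R).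

Definition fadj W : seq (term G) :=
  [seq (tcol t, trow t, ((tlab t)^-1)%g, ((tcf t)^*)%C) | t <- W].
Definition fscale (c : C) W : seq (term G) :=
  [seq (trow t, tcol t, tlab t, c * tcf t) | t <- W].
Definition fone : seq (term G) := [seq (i, i, 1%g, 1) | i <- enum J].
Definition fmul W V : seq (term G) :=
  [seq (trow t, tcol u, (tlab t * tlab u)%g,
        (tcol t == trow u)%:R * (tcf t * tcf u)) | t <- W, u <- V].
(** The prefix f marks formal operations on lists of terms; this is the list
    for [1 - A^* A / k], whose action on functions is [gap]. *)
Definition fgap k A : seq (term G) :=
  fone ++ fscale (- (k^-1)%:C)%C (fmul (fadj A) A).
Definition fexp W n : seq (term G) := iter n (fmul W) fone.
Definition ftr W : C :=
  \sum_(t <- W | (trow t == tcol t) && (tlab t == 1%g)) tcf t.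
(** The exponent is even so that a moment is a sum of squared norms. *)
Definition moment k A m : R := complex.Re (ftr (fexp (fgap k A) m.*2)).

(** The case [X := G] with left translation is the action on [l2(G)^d];
    general [X] is needed for the set carrying a generalized amenable
    extension. *)
Definition act (X : Type) (la : G -> X -> X) W (f : J -> X -> C) :
    J -> X -> C :=
  fun i x => \sum_(t <- W | trow t == i)
    tcf t * f (tcol t) (la ((tlab t)^-1)%g x).

Section Action.
Context (X : Type) (la : G -> X -> X).
Hypothesis la1 : forall x, la 1%g x = x.
Hypothesis laM : forall g h x, la (g * h)%g x = la g (la h x).
Implicit Types (f : J -> X -> C).

Lemma act_cat W V f i x : act la (W ++ V) f i x = act la W f i x + act la V f i x.
Proof. by rewrite /act big_cat. Qed.

Lemma act_fscale c W f i x : act la (fscale c W) f i x = c * act la W f i x.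
Proof. by rewrite /act big_map mulr_sumr; apply: eq_bigr => t _; rewrite mulrA. Qed.

Lemma act_fone f : act la fone f = f.
Proof.
apply/funext => i; apply/funext => x; rewrite /act big_map big_enum_cond /=.
under eq_bigl do rewrite /trow /=.
by rewrite (big_pred1 i) // /tcf /tcol /tlab /= mul1r invg1 la1.
Qed.

Lemma act_fmul W V f : act la (fmul W V) f = act la W (act la V f).
Proof.
apply/funext => i; apply/funext => x; rewrite /act /fmul.
rewrite big_mkcond big_allpairs_dep [RHS]big_mkcond /=; apply: eq_bigr => t _.
rewrite {1}/trow /= -/(trow t); case: eqP => _; last by rewrite big1.
rewrite mulr_sumr [RHS]big_mkcond /=; apply: eq_bigr => u _.
rewrite /tcf /tcol /tlab /trow /= eq_sym; case: eqP => _; last by rewrite !mul0r.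
by rewrite mul1r mulrA invgM laM.
Qed.

Lemma act_fexp W n f : act la (fexp W n) f = iter n (act la W) f.
Proof. by elim: n => [|n IH] /=; rewrite ?act_fone // act_fmul IH. Qed.

Definition gap k A f : J -> X -> C :=
  fun i x => f i x - (k^-1)%:C%C * act la (fadj A) (act la A f) i x.

Lemma act_fgap k A f : act la (fgap k A) f = gap k A f.
Proof.
apply/funext => i; apply/funext => x.
by rewrite act_cat act_fone act_fscale act_fmul mulNr.
Qed.

Lemma act_fgap_exp k A n f : act la (fexp (fgap k A) n) f = iter n (gap k A) f.
Proof. by rewrite act_fexp; apply: eq_iter => g; rewrite act_fgap. Qed.

Lemma act_adj W f i x : act la (fadj W) f i x =
  \sum_(t <- W | tcol t == i) ((tcf t)^*)%C * f (trow t) (la (tlab t) x).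
Proof.
by rewrite /act big_map; apply: eq_bigr => t _; rewrite /tlab /= invgK.
Qed.

End Action.

Lemma act_delta (X : eqType) (la : G -> X -> X) W i x j y :
  (forall x, la 1%g x = x) -> (forall g h x, la (g * h)%g x = la g (la h x)) ->
  act la W (delta i x) j y =
  \sum_(t <- W | [&& trow t == j, tcol t == i & y == la (tlab t) x]) tcf t.
Proof.
move=> la1 laM; rewrite /act [LHS]big_mkcond [RHS]big_mkcond /=.
apply: eq_bigr => t _; case: eqP => //= _; rewrite /delta.
case: (tcol t == i) => /=; last by rewrite mulr0.
suff -> : (la (tlab t)^-1%g y == x) = (y == la (tlab t) x).
  by case: eqP; rewrite (mulr1, mulr0).
by apply/eqP/eqP => [<-|->]; rewrite -laM (mulgV, mulVg) la1.
Qed.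

(** For a free action, [g] fixes the point [x i] only if [g] is trivial, so
    diagonal entries at any choice of points compute the trace. *)
Lemma ftr_free (X : eqType) (la : G -> X -> X) W (x : J -> X) :
  (forall x, la 1%g x = x) -> (forall g h x, la (g * h)%g x = la g (la h x)) ->
  (forall g x, la g x = x -> g = 1%g) ->
  ftr W = \sum_i act la W (delta i (x i)) i (x i).
Proof.
move=> la1 laM lafree; under eq_bigr do rewrite act_delta //.
rewrite /ftr (exchange_big_dep xpredT) //= big_mkcond /=; apply: eq_bigr => t _.
case: eqP => [e|ne] /=; last first.
  by rewrite big_pred0 // => i; apply/negP => /and3P[/eqP <- /eqP]; move/esym/ne.
have E i : (x i == la (tlab t) (x i)) = (tlab t == 1%g).
  apply/eqP/eqP => [/esym/lafree //|->]; by rewrite la1.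
under eq_bigl do rewrite E -e andbA andbb.
case: eqP => _; last by rewrite big_pred0 // => i; rewrite andbF.
by rewrite (big_pred1 (trow t)) // => i; rewrite andbT eq_sym.
Qed.

Lemma moment_free (X : eqType) (la : G -> X -> X) k A m (x : J -> X) :
  (forall x, la 1%g x = x) -> (forall g h x, la (g * h)%g x = la g (la h x)) ->
  (forall g x, la g x = x -> g = 1%g) ->
  moment k A m =
  complex.Re (\sum_i iter m.*2 (gap la k A) (delta i (x i)) i (x i)).
Proof.
move=> la1 laM lafree; rewrite /moment (ftr_free _ x la1 laM lafree).
by congr complex.Re; apply: eq_bigr => i _; rewrite act_fgap_exp.
Qed.

End Group.

Section Relabel.
Context (G H : groupType) (th : G -> H).
Implicit Types (A W V : seq (term G)) (k : R).
Definition labs W := [seq tlab t | t <- W].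

Lemma relabel_fmul W V :
  {in labs W & labs V, forall g h, th (g * h)%g = (th g * th h)%g} ->
  fmul (relabel th W) (relabel th V) = relabel th (fmul W V).
Proof.
move=> E; rewrite /fmul /relabel allpairs_mapl allpairs_mapr map_allpairs /=.
congr flatten; apply/eq_in_map => t tW; apply/eq_in_map => u uV.
by rewrite {1 2}/tlab /= E //; apply/mapP; [exists t | exists u].
Qed.

Lemma relabel_fadj W :
  {in labs W, forall g, th (g^-1)%g = ((th g)^-1)%g} ->
  fadj (relabel th W) = relabel th (fadj W).
Proof.
move=> E; rewrite /fadj /relabel -!map_comp; apply/eq_in_map => t tW /=.
by rewrite {1}/tlab /= E //; apply/mapP; exists t.
Qed.

Lemma relabel_fone : th 1%g = 1%g -> fone H = relabel th (fone G).
Proof.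
move=> E; rewrite /fone /relabel; elim: (enum J) => //= i s ->.
by rewrite {3}/tlab /= E.
Qed.

Lemma relabel_fscale c W : fscale c (relabel th W) = relabel th (fscale c W).
Proof. by rewrite /fscale /relabel -!map_comp. Qed.

Lemma relabel_ftr W : {in labs W, forall g, (th g == 1%g) = (g == 1%g)} ->
  ftr (relabel th W) = ftr W.
Proof.
move=> E; rewrite /ftr big_map [LHS]big_seq_cond [RHS]big_seq_cond.
apply: eq_bigl => t; case: (boolP (t \in W)) => //= tW.
by congr andb; rewrite /tlab /=; apply: E; apply/mapP; exists t.
Qed.

End Relabel.

(** The formal power of [1 - A^* A / k] is computed from finitely many
    products of labels, and its trace only asks which of them are trivial: a
    map that is multiplicative and detects the identity on these elements
    preserves the moments. *)
Lemma moment_relabel (G : groupType) (k : R) (A : seq (term G)) (M : nat) :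
  exists F : seq G, forall (H : groupType) (th : G -> H),
    {in F &, forall g h, th (g * h)%g = (th g * th h)%g} ->
    {in F, forall g, th g = 1%g -> g = 1%g} ->
    forall m, (m <= M)%N -> moment k (relabel th A) m = moment k A m.
Proof.
pose W := fgap k A.
pose E n := labs (fexp W n).
pose F := 1%g :: labs A ++ labs (fadj A) ++ labs W
            ++ flatten [seq E n | n <- iota 0 (M.*2).+1].
have F1 : 1%g \in F by rewrite mem_head.
have FA : {subset labs A <= F} by move=> g gA; rewrite inE mem_cat gA orbT.
have FA' : {subset labs (fadj A) <= F}.
  by move=> g gA; rewrite inE !mem_cat gA !orbT.
have FW : {subset labs W <= F} by move=> g gA; rewrite inE !mem_cat gA !orbT.
have FE n : (n <= M.*2)%N -> {subset labs (fexp W n) <= F}.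
  move=> nM g gE; rewrite inE 3!mem_cat.
  suff -> : g \in flatten [seq E n | n <- iota 0 (M.*2).+1] by rewrite !orbT.
  apply/flattenP; exists (E n) => //; apply/mapP; exists n => //.
  by rewrite mem_iota add0n ltnS.
exists F => H th thM th1 m mM.
have t1 : th 1%g = 1%g.
  by apply: (mulgI (th 1%g)); rewrite -thM // !mulg1.
have tV : {in labs A, forall g, th (g^-1)%g = ((th g)^-1)%g}.
  move=> g gA; have gF := FA _ gA.
  have gVF : (g^-1)%g \in F.
    apply: FA'; move/mapP: gA => [t tA ->].
    by rewrite /labs /fadj -map_comp; apply/mapP; exists t.
  by apply: (mulgI (th g)); rewrite -thM // !mulgV.
have tW : fgap k (relabel th A) = relabel th W.
  rewrite /W /fgap (relabel_fadj tV) relabel_fmul; last first.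
    by move=> g h /FA' gF /FA hF; rewrite thM.
  by rewrite relabel_fscale (relabel_fone t1) /relabel map_cat.
have tE n : (n <= M.*2)%N -> fexp (relabel th W) n = relabel th (fexp W n).
  elim: n => [|n IH] nM; first exact: relabel_fone.
  rewrite /fexp !iterS -!/(fexp _ _) IH ?(ltnW nM) // relabel_fmul //.
  by move=> g h /FW gF /(FE _ (ltnW nM)) hF; rewrite thM.
rewrite /moment tW tE ?leq_double // relabel_ftr // => g gE.
apply/eqP/eqP => [|->//]; apply: th1.
by move: gE; apply: FE; rewrite leq_double.
Qed.

End Terms.

(** * Characteristic polynomials and integrality *)

Lemma char_poly_conj (F : fieldType) n (P A : 'M[F]_n) :
  P \in unitmx -> char_poly (invmx P *m A *m P) = char_poly A.
Proof.
move=> Pu; rewrite /char_poly.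
pose Pp := map_mx (@polyC F) P; pose Ip := map_mx (@polyC F) (invmx P).
have IP : Ip *m Pp = 1%:M by rewrite -map_mxM mulVmx // map_mx1.
suff -> : char_poly_mx (invmx P *m A *m P) = Ip *m char_poly_mx A *m Pp.
  by rewrite !det_mulmx mulrAC -det_mulmx IP det1 mul1r.
rewrite /char_poly_mx mulmxBr mulmxBl scalar_mxC -[_ *m Ip *m Pp]mulmxA IP mulmx1.
by rewrite !map_mxM.
Qed.

(** [V] embeds the space of [B] as an [M]-invariant subspace; in a basis that
    extends it, [M] is block triangular with [B] in a diagonal block. *)
Lemma char_poly_intertwine (F : fieldType) m n (M : 'M[F]_m) (B : 'M[F]_n)
    (V : 'M[F]_(m, n)) (W : 'M[F]_(n, m)) :
  W *m V = 1%:M -> M *m V = V *m B ->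
  exists2 s : {poly F}, s \is monic & char_poly M = char_poly B * s.
Proof.
move=> WV MV.
have rV : \rank V = n.
  apply/eqP; rewrite eqn_leq rank_leq_col /=.
  by rewrite -{1}(mxrank1 F n) -WV mxrankS // submxMl.
have nm : (n <= m)%N by rewrite -rV rank_leq_row.
have [k mE] : exists k, m = (n + k)%N by exists (m - n)%N; rewrite subnKC.
subst m; pose E := col_ebase V; pose U := row_ebase V.
have EU : E \in unitmx := col_ebase_unit V.
have UU : U \in unitmx := row_ebase_unit V.
have VE : V = E *m pid_mx n *m U by rewrite -[LHS]mulmx_ebase rV.
pose M' := invmx E *m M *m E; pose B' := U *m B *m invmx U.
have MB : M' *m pid_mx n = pid_mx n *m B'.
  have : invmx E *m (M *m V) *m invmx U = invmx E *m (V *m B) *m invmx U.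
    by rewrite MV.
  by rewrite VE /M' /B' -!mulmxA mulmxV // mulmx1 !mulmxA mulVmx // mul1mx.
have <- : char_poly B' = char_poly B.
  by rewrite -(@char_poly_conj _ _ U B') // /B' -!mulmxA mulVmx // mulmx1 mulmxA
             mulVmx // mul1mx.
rewrite -(@char_poly_conj _ _ E M) // -/M'.
have pE : pid_mx n = col_mx 1%:M 0 :> 'M[F]_(n + k, n).
  apply/matrixP => i j; rewrite !mxE; case: split_ordP => l ->.
    by rewrite !mxE /= andbT.
  by rewrite !mxE /= andbF.
move: MB; rewrite pE -[M']submxK mul_block_col mul_col_mx !mulmx1 !mulmx0 !addr0.
rewrite mul1mx mul0mx => /eq_col_mx [-> ->].
exists (char_poly (drsubmx M')); first exact: char_poly_monic.
rewrite /char_poly /char_poly_mx map_block_mx (scalar_mx_block n k).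
by rewrite opp_block_mx add_block_mx map_mx0 oppr0 addr0 det_ublock.
Qed.

(** Up to sign the product of the non-zero roots is the lowest non-zero
    coefficient, an integer. *)
Lemma norm_prod_nonzero_roots_ge1 (F : numClosedFieldType) (p : {poly int})
    (s : seq F) :
  map_poly intr p = \prod_(x <- s) ('X - x%:P) ->
  1 <= `|\prod_(x <- s | x != 0) x|.
Proof.
move=> pE; pose z := count (pred1 0) s.
pose s' := [seq x <- s | x != 0].
have pE' : map_poly intr p = \prod_(x <- s') ('X - x%:P) * 'X^z.
  rewrite pE (bigID (fun x => x == 0)) /= mulrC big_filter; congr (_ * _).
  rewrite /z; elim: s {pE z s'} => [|x s IH]; first by rewrite big_nil expr0.
  rewrite big_cons /=; case: eqP => [->|_]; last by rewrite IH add0n.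
  by rewrite IH subr0 add1n exprS.
have cE : (p`_z)%:~R = (-1) ^+ size s' * \prod_(x <- s') x :> F.
  by rewrite -coef_map /= pE' coefMXn ltnn subnn coef0_prod_XsubC.
have : p`_z != 0.
  rewrite -(intr_eq0 F) cE mulf_neq0 ?signr_eq0 // prodf_seq_neq0.
  by apply/allP => x; rewrite mem_filter => /andP[].
move=> pz; rewrite -big_filter -/s'.
have -> : `|\prod_(x <- s') x| = `|(p`_z)%:~R|.
  by rewrite cE normrM normrX normrN1 expr1n mul1r.
by rewrite -intr_norm -[1]/(1%:~R) ler_int -gtz0_ge1 normr_gt0.
Qed.

(** Summing the absolute values of an eigenvector equation over all
    coordinates. *)
Lemma eigenvalue_bound (F : numFieldType) n (M : 'M[F]_n) (b : F) (x : F) :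
  (forall i, \sum_j `|M i j| <= b) -> eigenvalue M x -> `|x| <= b.
Proof.
move=> Mb /eigenvalueP[u uM u0].
have u_gt0 : 0 < \sum_j `|u 0 j|.
  rewrite lt_neqAle sumr_ge0 // andbT eq_sym psumr_neq0 //.
  apply/hasP; apply: contrapT => H; move/eqP: u0; apply.
  apply/rowP => j; rewrite mxE; apply/eqP; apply: contrapT => /negP uj.
  by apply: H; exists j; rewrite ?mem_index_enum // normr_gt0.
rewrite -(ler_pM2r u_gt0) mulr_sumr.
rewrite (le_trans (y := \sum_j \sum_i `|u 0 i| * `|M i j|)) //.
  apply: ler_sum => j _; rewrite -normrM.
  have -> : x * u 0 j = (u *m M) 0 j by rewrite uM mxE.
  rewrite mxE (le_trans (ler_norm_sum _ _ _)) //.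
  by apply: ler_sum => i _; rewrite normrM.
rewrite exchange_big mulr_sumr; apply: ler_sum => i _ /=.
by rewrite -mulr_sumr mulrC ler_wpM2r.
Qed.

Section FunctionMatrices.
Context (F : comPzRingType).
(** Matrices indexed by finite types, which avoids enumerating products. *)
Definition fmx (K L : finType) (f : K -> L -> F) : 'M[F]_(#|K|, #|L|) :=
  \matrix_(i, j) f (enum_val i) (enum_val j).

Lemma fmxM (K L P : finType) (f : K -> L -> F) (g : L -> P -> F) :
  fmx f *m fmx g = fmx (fun i j => \sum_k f i k * g k j).
Proof.
apply/matrixP => i j; rewrite !mxE (big_enum_val (A := L)) /=.
by apply: eq_bigr => k _; rewrite !mxE.
Qed.

Lemma eq_fmx (K L : finType) (f g : K -> L -> F) :
  f =2 g -> fmx f = fmx g.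
Proof. by move=> fg; apply/matrixP => i j; rewrite !mxE fg. Qed.
End FunctionMatrices.

(** * Eigenvalue counting and the trivial group *)

(** The first summand bounds the proportion of non-zero eigenvalues below
    [delta ^ k.+1], the second the contribution of all larger ones. It becomes
    small by choosing first [k], then [M]. *)
Definition decay (R : realFieldType) (delta : R) (k M : nat) : R :=
  k.+1%:R^-1 + (1 - delta ^+ k.+1) ^+ M.*2.

(** With [S] the set of small non-zero values, [dl ^ (k.+1 * #|S|)] bounds the
    product of the small ones from above, while the product of all non-zero
    ones is at least [dl ^ #|I|]; hence [k.+1 * #|S| <= #|I|]. *)
Lemma power_sum_le_decay (R : realFieldType) (I : finType) (x : I -> R)
    (dl : R) (k M : nat) :
  0 < dl -> dl < 1 -> (forall i, 0 <= x i <= 1) ->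
  dl ^+ #|I| <= \prod_(i | x i != 0) x i ->
  \sum_i (1 - x i) ^+ M.*2 <=
    #|[pred i | x i == 0]|%:R + #|I|%:R * decay dl k M.
Proof.
move=> dl0 dl1 x01 prodx; pose eta := dl ^+ k.+1.
have eta01 : 0 < eta < 1 by rewrite exprn_gt0 //= exprn_ilt1 // ltW.
have [eta0 eta1] := andP eta01.
pose S := [pred i | (x i != 0) && (x i < eta)].
have S_small : (k.+1 * #|S| <= #|I|)%N.
  rewrite -(ler_iXn2l dl0 dl1) exprM (le_trans prodx) //.
  rewrite (bigID (fun i => x i < eta)) /= -[leRHS]mulr1 ler_pM //.
  - by rewrite prodr_ge0 // => i _; case/andP: (x01 i).
  - by rewrite prodr_ge0 // => i _; case/andP: (x01 i).
  - rewrite -prodr_const; apply: ler_prod => i /andP[_ /ltW ->].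
    by rewrite andbT; case/andP: (x01 i).
  - by apply: prodr_ile1 => i _; exact: x01.
have pw01 i : 0 <= (1 - x i) ^+ M.*2 <= 1.
  have /andP[x0 x1] := x01 i.
  by rewrite exprn_ge0 ?subr_ge0 //= exprn_ile1 ?subr_ge0 // lerBlDr lerDl.
have bnd i : (1 - x i) ^+ M.*2 <=
   (x i == 0)%:R + (i \in S)%:R + (1 - eta) ^+ M.*2.
  have e0 : 0 <= (1 - eta) ^+ M.*2 by rewrite exprn_ge0 // subr_ge0 ltW.
  have /andP[_ p1] := pw01 i.
  case: (eqVneq (x i) 0) => x0.
    by rewrite (le_trans p1) // -addrA lerDl addr_ge0 // ler0n.
  rewrite add0r inE x0 /=; case: (ltP (x i) eta) => xe.
    by rewrite (le_trans p1) // lerDl.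
  have /andP[_ x1] := x01 i.
  rewrite add0r; apply: lerXn2r; first by rewrite nnegrE subr_ge0.
    by rewrite nnegrE subr_ge0 ltW.
  exact: lerB.
rewrite (le_trans (ler_sum _ (fun i _ => bnd i))) // !big_split /=.
rewrite /decay mulrDr addrA !lerD //.
- by rewrite -natr_sum ler_nat -sum1_card [leqRHS]big_mkcond leq_sum.
- have -> : \sum_i ((i \in S)%:R : R) = #|S|%:R.
    rewrite -natr_sum -sum1_card [in RHS]big_mkcond; congr _%:R.
  by rewrite ler_pdivlMr ?ltr0n // -natrM ler_nat mulnC.
- by rewrite sumr_const mulr_natl.
Qed.

Section Admissible.
Context (R : rcfType).
Local Notation C := R[i].

(** The coefficients range over a fixed list and the number of terms in a row
    or column is bounded: these data are unchanged by relabelling and by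
    compression, and determine the decay rate. *)
Record admissible (G : eqType) (J : finType) (AA : seq C) (N : nat)
    (A : seq (term R J G)) : Prop := Admissible {
  adm_cf : forall t, t \in A -> tcf t \in AA;
  adm_row : forall i, (count (fun t => trow t == i) A <= N)%N;
  adm_col : forall i, (count (fun t => tcol t == i) A <= N)%N }.
End Admissible.

Section RowSums.
Context (F : numFieldType).
Lemma row_sum_fmxM (K L P : finType) (f : K -> L -> F) (g : L -> P -> F) a b i :
  0 <= b ->
  (forall i, \sum_k `|f i k| <= a) -> (forall k, \sum_j `|g k j| <= b) ->
  \sum_j `|\sum_k f i k * g k j| <= a * b.
Proof.
move=> b0 fa gb.
rewrite (le_trans (y := \sum_j \sum_k `|f i k| * `|g k j|)) //.
  apply: ler_sum => j _; rewrite (le_trans (ler_norm_sum _ _ _)) //.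
  by apply: ler_sum => k _; rewrite normrM.
rewrite exchange_big /=.
rewrite (le_trans (y := \sum_k `|f i k| * b)) //.
  by apply: ler_sum => k _; rewrite -mulr_sumr ler_wpM2l.
by rewrite -mulr_suml ler_wpM2r.
Qed.

Lemma row_sum_fmx (K : finType) (f : K -> K -> F) b :
  (forall i, \sum_j `|f i j| <= b) -> forall i, \sum_j `|fmx f i j| <= b.
Proof.
move=> fb i; rewrite (le_trans _ (fb (enum_val i))) //.
rewrite [leRHS](big_enum_val (A := K)) /=.
by apply: ler_sum => j _; rewrite mxE.
Qed.
End RowSums.

Section Kernel.
Context (R : rcfType) (G : eqType) (J : finType).
Local Notation C := R[i].
Implicit Types (A : seq (term R J G)).

Definition kernel A : J -> J -> C :=
  fun i j => \sum_(t <- A | (trow t == i) && (tcol t == j)) tcf t.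

Lemma row_sum_terms (F : numDomainType) A (w : term R J G -> F) (b : F) N i :
  {in A, forall t, `|w t| <= b} ->
  (count (fun t => trow t == i) A <= N)%N -> 0 <= b ->
  \sum_j `|\sum_(t <- A | (trow t == i) && (tcol t == j)) w t| <= N%:R * b.
Proof.
move=> wb cN b0.
rewrite (le_trans (y := \sum_(t <- A | trow t == i) `|w t|)) //.
  rewrite (partition_big (@tcol _ _ _) xpredT) //=.
  by apply: ler_sum => j _; exact: ler_norm_sum.
rewrite (le_trans (y := \sum_(t <- A | trow t == i) b)) //.
  rewrite big_seq_cond [leRHS]big_seq_cond.
  by apply: ler_sum => t /andP[/wb].
rewrite big_const_seq iter_addr_0 -[b *+ _]mulr_natl ler_wpM2r // ler_nat.
exact: cN.
Qed.
End Kernel.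

Section Lift.
Context (R : rcfType) (G : eqType) (J : finType) (r : nat).
Local Notation C := R[i].
Context (v : 'cV[C]_r) (Nf : C -> 'M[int]_r).
Implicit Types (A : seq (term R J G)).

(** Each coefficient [a] is replaced by an integer block [Nf a] that has [v]
    as an eigenvector for [a]. *)
Definition lift_kernel A : J * 'I_r -> J * 'I_r -> int := fun x y =>
  \sum_(t <- A | (trow t == x.1) && (tcol t == y.1)) Nf (tcf t) x.2 y.2.

Definition lift_vec : J * 'I_r -> J -> C :=
  fun x j => (x.1 == j)%:R * v x.2 0.

(** Tensoring with [v] intertwines the matrix with its integer lift. *)
Lemma lift_kernelP A :
  {in A, forall t, map_mx intr (Nf (tcf t)) *m v = tcf t *: v} ->
  map_mx intr (fmx (lift_kernel A)) *m fmx lift_vec =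
  fmx lift_vec *m fmx (kernel A).
Proof.
move=> NP.
have -> : map_mx intr (fmx (lift_kernel A)) =
          fmx (fun x y => (lift_kernel A x y)%:~R : C).
  by apply/matrixP => i j; rewrite !mxE.
rewrite !fmxM; apply: eq_fmx => -[i p] j /=; rewrite /lift_vec /=.
rewrite [RHS](bigD1 i) //= eqxx mul1r [X in _ = _ + X]big1 ?addr0; last first.
  by move=> k /negbTE; rewrite eq_sym => ->; rewrite !mul0r.
rewrite -(pair_bigA _ (fun k q => (lift_kernel A (i, p) (k, q))%:~R *
  ((k == j)%:R * v q 0))) /= (bigD1 j) //= [X in _ + X]big1 ?addr0; last first.
  by move=> k /negbTE kj; apply: big1 => q _; rewrite kj mul0r mulr0.
rewrite /kernel mulr_sumr /lift_kernel /=.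
under eq_bigr do rewrite eqxx mul1r rmorph_sum /= mulr_suml.
rewrite exchange_big /= big_seq_cond [RHS]big_seq_cond.
apply: eq_bigr => t /andP[tA _]; have /matrixP/(_ p 0) := NP _ tA.
by rewrite !mxE mulrC => <-; apply: eq_bigr => q _; rewrite mxE.
Qed.

Lemma lift_vec_inv : v != 0 -> exists W, W *m fmx lift_vec = 1%:M.
Proof.
move=> v0; have [q vq] : exists q, v q 0 != 0.
  apply: contrapT => H; move/eqP: v0; apply; apply/colP => q; rewrite mxE.
  by apply/eqP; apply: contrapT => /negP vq; apply: H; exists q.
exists (fmx (fun j x => ((x.1 == j) && (x.2 == q))%:R / v q 0)).
rewrite fmxM; apply/matrixP => i j; rewrite !mxE -(inj_eq enum_val_inj).
move: (enum_val i) (enum_val j) => {}i {}j.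
rewrite (bigD1 (i, q)) //= !eqxx /= big1 ?addr0; last first.
  by move=> [k p] /= /negbTE; rewrite -pair_eqE /= => ->; rewrite !mul0r.
by rewrite /lift_vec /= mulrCA mul1r mulVf // mulr1.
Qed.
End Lift.

Section Gap.
Context (R : rcfType).
Local Notation C := R[i].

(** The conjugate coefficients occur in the adjoint, so they are lifted on the
    same vector [v]. *)
Definition conj_closed_lift (AA : seq C) r (v : 'cV[C]_r) (Nf : C -> 'M[int]_r) :=
  {in AA, forall a, map_mx intr (Nf a) *m v = a *: v /\
    map_mx intr (Nf (a^*)%C) *m v = (a^*)%C *: v}.

Context (G : groupType) (J : finType).
Implicit Types (A : seq (term R J G)).

Lemma fadj_cf A (P : C -> Prop) :
  (forall t, t \in A -> P ((tcf t)^*)%C) -> forall t, t \in fadj A -> P (tcf t).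
Proof. by move=> H t /mapP[u uA ->]; exact: H. Qed.

Lemma count_fadj_row A i :
  count (fun t => trow t == i) (fadj A) = count (fun t => tcol t == i) A.
Proof. by rewrite count_map. Qed.

Lemma kernel_fadj A i j : kernel (fadj A) i j = ((kernel A j i)^*)%C.
Proof.
rewrite /kernel big_map rmorph_sum /=; apply: eq_bigl => t.
by rewrite /trow /tcol /= andbC.
Qed.

Lemma row_sum_lift A r (Nf : C -> 'M[int]_r) (e N : nat) :
  (forall t, t \in A -> forall p q, `|Nf (tcf t) p q| <= e%:R) ->
  (forall i, (count (fun t => trow t == i) A <= N)%N) ->
  forall x, \sum_y `|(lift_kernel Nf A x y)%:~R : C| <= (r * (N * e))%:R.
Proof.
move=> He HN [i p]; rewrite natrM mulr_natl.
rewrite -(pair_bigA _ (fun j q => `|(lift_kernel Nf A (i, p) (j, q))%:~R : C|)).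
rewrite exchange_big /= -[X in _ *+ X]card_ord -sumr_const.
apply: ler_sum => q _; rewrite /lift_kernel /= natrM.
under eq_bigr do rewrite rmorph_sum /=.
apply: row_sum_terms (HN i) _ => [t tA|]; last exact: ler0n.
by rewrite -intr_norm pmulrn ler_int (le_trans (He t tA p q)) // natz.
Qed.

(** The eigenvalues of [A^* A] are among those of its integer lift, whose
    non-zero eigenvalues have a product of absolute value at least 1. The
    remaining eigenvalues of the lift are bounded by the row sums of the lift,
    which gives a lower bound on the product of the eigenvalues of [A^* A]. *)
Lemma prod_nonzero_eigen_ge A (AA : seq C) N r (v : 'cV[C]_r) Nf (e : nat)
    (l : 'I_#|J| -> C) :
  admissible AA N A -> v != 0 -> conj_closed_lift AA v Nf ->
  {in AA, forall a p q, `|Nf a p q| <= e%:R /\ `|Nf (a^*)%C p q| <= e%:R} ->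
  char_poly (fmx (kernel (fadj A)) *m fmx (kernel A)) =
    \prod_i ('X - (l i)%:P) ->
  1 <= `|\prod_(i | l i != 0) l i| *
       ((r * (N * e)) ^ 2).+1%:R ^+ (#|J| * r).
Proof.
move=> [Acf Arow Acol] v0 Nv Ne charB; set r0 := (_ ^ 2).+1.
have NA : {in A, forall t, map_mx intr (Nf (tcf t)) *m v = tcf t *: v}.
  by move=> t /Acf /Nv[].
have NA' : {in fadj A, forall t, map_mx intr (Nf (tcf t)) *m v = tcf t *: v}.
  apply: (@fadj_cf _ (fun a => map_mx intr (Nf a) *m v = a *: v)).
  by move=> t /Acf /Nv[].
pose L := fmx (lift_kernel Nf A); pose L' := fmx (lift_kernel Nf (fadj A)).
pose V := fmx (lift_vec v : _ -> J -> C).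
set B := _ *m _ in charB.
have LV : map_mx intr (L' *m L) *m V = V *m B.
  by rewrite map_mxM -mulmxA lift_kernelP // mulmxA lift_kernelP // -mulmxA.
have [W WV] := lift_vec_inv J v0.
have [s smon charL] := char_poly_intertwine WV LV.
have [nu nuE] := closed_field_poly_normal s.
rewrite (eqP smon) scale1r in nuE.
have charLE : map_poly intr (char_poly (L' *m L)) =
    \prod_(x <- [seq l i | i <- enum 'I_#|J|] ++ nu) ('X - x%:P).
  by rewrite map_char_poly charL charB nuE big_cat big_map big_enum.
have := norm_prod_nonzero_roots_ge1 charLE.
rewrite big_cat big_map big_enum_cond /= normrM => /le_trans; apply.
rewrite ler_wpM2l //.
have nur x : x \in nu -> `|x| <= r0%:R.
  move=> xnu; have : eigenvalue (map_mx intr (L' *m L)) x.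
    rewrite eigenvalue_root_char charL rootM nuE root_prod_XsubC xnu.
    by rewrite orbT.
  apply: eigenvalue_bound => i.
  rewrite (le_trans (y := (r * (N * e))%:R * (r * (N * e))%:R)) //; last first.
    by rewrite -natrM ler_nat /r0 expnS expn1.
  have -> : map_mx intr (L' *m L) = fmx (fun x y => \sum_z
     (lift_kernel Nf (fadj A) x z)%:~R * (lift_kernel Nf A z y)%:~R : C).
    rewrite map_mxM -fmxM; congr (_ *m _);
    by apply/matrixP => ? ?; rewrite !mxE.
  apply: row_sum_fmx => {}i; apply: (row_sum_fmxM
      (f := fun x z => (lift_kernel Nf (fadj A) x z)%:~R : C)
      (g := fun z y => (lift_kernel Nf A z y)%:~R : C)) => //.
  - apply: row_sum_lift; last by move=> j; rewrite count_fadj_row; apply: Acol.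
    apply: (@fadj_cf _ (fun a => forall p q, `|Nf a p q| <= e%:R)).
    by move=> t /Acf tA p q; have [] := Ne _ tA p q.
  - apply: row_sum_lift; last exact: Arow.
    by move=> t /Acf tA p q; have [] := Ne _ tA p q.
have size_nu : (size nu <= #|J| * r)%N.
  have := congr1 (fun p : {poly C} => size p) charL.
  rewrite size_Mmonic ?monic_neq0 ?char_poly_monic // !size_char_poly.
  rewrite nuE size_prod_XsubC card_prod card_ord addnS /= => /eq_add_S ->.
  exact: leq_addl.
have r01 : 1 <= r0%:R :> C by rewrite ler1n.
rewrite (le_trans (y := (r0%:R : C) ^+ size nu)) //; last exact: ler_weXn2l.
have : all (fun x => `|x| <= r0%:R) nu by apply/allP.
elim: nu {nuE charLE nur size_nu} => [|x nu IH] /=.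
  by rewrite big_nil normr1 expr0.
case/andP => xr /IH {}IH; rewrite big_cons exprS; case: eqP => _ /=.
  by rewrite (le_trans IH) // ler_peMl // exprn_ge0.
by rewrite normrM ler_pM.
Qed.
End Gap.

(** The matrix [K^* K] is normal, hence unitarily diagonalizable, and its
    diagonal entries in a unitary basis are squared norms. *)
Lemma gram_spectral (F : numClosedFieldType) n (K : 'M[F]_n) :
  exists (P : 'M[F]_n) (l : 'I_n -> F), [/\ P \in unitmx,
    (map_mx Num.conj K)^T *m K = invmx P *m diag_mx (\row_i l i) *m P,
    char_poly ((map_mx Num.conj K)^T *m K) = \prod_i ('X - (l i)%:P)
    & forall i, 0 <= l i].
Proof.
set Ks := (map_mx Num.conj K)^T; set B := Ks *m K.
have BE : (B ^t*)%sesqui = B.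
  rewrite /B trmx_mul map_mxM /Ks trmxK; congr (_ *m _).
    by rewrite map_trmx.
  apply/matrixP => i j; rewrite !mxE. exact: conjCK.
have Bn : B \is normalmx by apply/normalmxP; rewrite BE.
have := orthomx_spectralP Bn; set P := spectralmx B; set sp := spectral_diag B.
move=> BP; have Pun : P \is unitarymx := spectral_unitarymx B.
have Pu : P \in unitmx := spectral_unit B.
exists P, (fun i => sp 0 i).
have spE : \row_i sp 0 i = sp by apply/rowP => i; rewrite mxE.
split=> //; first by rewrite spE.
  rewrite BP char_poly_conj // char_poly_trig ?diag_mx_is_trig //.
  by apply: eq_bigr => i _; rewrite mxE eqxx mulr1n.
move=> i.
have -> : sp 0 i = (P *m B *m (P ^t*)%sesqui) i i.
  rewrite -invmx_unitary // BP !mulmxA mulmxV // mul1mx -mulmxA mulmxV // mulmx1.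
  by rewrite mxE eqxx mulr1n.
have -> : P *m B *m (P ^t*)%sesqui = (P *m Ks) *m ((P *m Ks) ^t*)%sesqui.
  rewrite trmx_mul map_mxM /B -!mulmxA; congr (_ *m (_ *m (_ *m _))).
  apply/matrixP => j k; rewrite !mxE; exact/esym/conjCK.
rewrite mxE sumr_ge0 // => j _; rewrite !mxE -normCK exprn_ge0 //.
Qed.

(** Over the trivial group a list of terms is a complex matrix, realized here
    by the action on a one-point set. *)
Section Moment.
Context (R : rcfType).
Local Notation C := R[i].
Context (G : groupType) (Gtriv : forall g : G, g = 1%g) (J : finType).
Implicit Types (A : seq (term R J G)) (k : R).

Let la (g : G) (x : unit) : unit := tt.
Let vf (f : J -> unit -> C) : 'cV[C]_#|J| := \col_p f (enum_val p) tt.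

Lemma act_kernel A f : vf (act la A f) = fmx (kernel A) *m vf f.
Proof.
apply/colP => i; rewrite !mxE /act (partition_big (@tcol _ _ _) xpredT) //=.
rewrite (big_enum_val (A := J)) /=; apply: eq_bigr => j _.
rewrite !mxE /kernel mulr_suml; apply: eq_bigr => t /andP[_ /eqP ->].
by [].
Qed.

Definition gap_mx k A : 'M[C]_#|J| :=
  1%:M - (k^-1)%:C%C *: (fmx (kernel (fadj A)) *m fmx (kernel A)).

Lemma vf_gap k A f : vf (gap la k A f) = gap_mx k A *m vf f.
Proof.
rewrite mulmxBl mul1mx -scalemxAl -mulmxA -!act_kernel.
by apply/colP => i; rewrite !mxE.
Qed.

Lemma moment_trivial k A m :
  moment k A m = complex.Re (\tr (iter m.*2 (mulmx (gap_mx k A)) 1%:M)).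
Proof.
have la1 x : la 1%g x = x by case: x.
rewrite (moment_free (la := la) k A m (fun=> tt)) //.
congr complex.Re; rewrite (big_enum_val (A := J)) /=; apply: eq_bigr => i _.
have vfi n f : vf (iter n (gap la k A) f) = iter n (mulmx (gap_mx k A)) 1%:M *m vf f.
  elim: n => [|n IH]; first by rewrite mul1mx.
  by rewrite /= vf_gap IH mulmxA.
have := congr1 (fun v : 'cV_#|J| => v i 0) (vfi m.*2 (delta R (enum_val i) tt)).
rewrite mxE => ->.
have -> : vf (delta R (enum_val i) tt) = delta_mx i 0.
  by apply/colP => j; rewrite !mxE /delta !eqxx !andbT (inj_eq enum_val_inj).
by rewrite -colE mxE.
Qed.

Lemma moment_trivial_spectral k A (AA : seq C) N (al : R) :
  admissible AA N A -> 0 <= al -> {in AA, forall a, `|a| <= al%:C%C} ->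
  0 < k -> (N%:R * al) ^+ 2 <= k ->
  exists l : 'I_#|J| -> R, [/\ forall i, 0 <= l i <= k,
    char_poly (fmx (kernel (fadj A)) *m fmx (kernel A)) =
      \prod_i ('X - (l i)%:C%C%:P)
    & forall m, moment k A m = \sum_i (1 - l i / k) ^+ m.*2].
Proof.
move=> [Acf Arow Acol] al0 AAal k0 kN.
have [P [l []]] := gram_spectral (fmx (kernel A)).
have -> : (map_mx Num.conj (fmx (kernel A)))^T = fmx (kernel (fadj A)).
  by apply/matrixP => i j; rewrite !mxE kernel_fadj.
set B := _ *m _ => Pu BP charB l0.
have lR i : (complex.Re (l i))%:C%C = l i by rewrite RRe_real // ger0_real.
have lk i : l i <= k%:C%C.
  rewrite -[l i]ger0_norm //; apply: (@eigenvalue_bound _ _ B).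
    move=> {}i; rewrite /B fmxM.
    rewrite (le_trans _ (_ : (N%:R * al%:C%C) * (N%:R * al%:C%C) <= _)) //; last first.
      by rewrite -[N%:R](rmorph_nat (real_complex R)) -!rmorphM lecR /= -expr2.
    apply: row_sum_fmx => {}i; apply: (row_sum_fmxM (f := kernel (fadj A)) (g := kernel A)).
    - by rewrite mulr_ge0 // ?ler0n // ler0c.
    - move=> {}i; apply: row_sum_terms; last by rewrite ler0c.
      + apply: (@fadj_cf _ _ _ _ (fun a => `|a| <= al%:C%C)) => t /Acf tA.
        by rewrite normcJ AAal.
      + by rewrite count_fadj_row.
    - move=> {}i; apply: row_sum_terms; rewrite ?ler0c //.
      by move=> t /Acf; apply: AAal.
  rewrite eigenvalue_root_char charB rootE horner_prod (bigD1 i) //=.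
  by rewrite hornerXsubC subrr mul0r.
exists (fun i => complex.Re (l i)); split=> [i||m].
- by apply/andP; split; rewrite -lecR lR; [exact: l0 | exact: lk].
- by rewrite charB; apply: eq_bigr => i _; rewrite lR.
pose mu i := 1 - complex.Re (l i) / k.
have gapE : gap_mx k A = invmx P *m diag_mx (\row_i (mu i)%:C%C) *m P.
  rewrite /gap_mx -/B BP; have {1}<- := mulVmx Pu.
  rewrite -[in X in X - _](mulmx1 (invmx P)) scalemxAl scalemxAr -mulmxBl -mulmxBr.
  congr (_ *m _ *m _); apply/matrixP => i j; rewrite !mxE; case: eqP => [_|]; last first.
    by rewrite !mulr0n mulr0 subr0.
  by rewrite !mulr1n rmorphB rmorph1 rmorphM /= lR mulrC.
have iterE n : iter n (mulmx (gap_mx k A)) 1%:M =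
    invmx P *m diag_mx (\row_i ((mu i) ^+ n)%:C%C) *m P.
  elim: n => [|n IH].
    rewrite /= (_ : diag_mx _ = 1%:M) ?mulmx1 ?mulVmx //.
    by apply/matrixP => i j; rewrite !mxE expr0.
  have PP D D' : (invmx P *m D *m P) *m (invmx P *m D' *m P) =
      invmx P *m (D *m D') *m P by rewrite !mulmxA mulmxK.
  rewrite iterS IH gapE PP mulmx_diag.
  by congr (_ *m diag_mx _ *m _); apply/rowP => i; rewrite !mxE exprS rmorphM.
rewrite moment_trivial iterE mxtrace_mulC mulmxA mulmxV // mul1mx mxtrace_diag.
under eq_bigr do rewrite mxE; rewrite -rmorph_sum /=; exact: erefl.
Qed.
End Moment.

Section Trivial.
Context (R : rcfType).
Local Notation C := R[i].

(** A finite-dimensional substitute for a ring of algebraic integers: the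
    coefficients and their conjugates are eigenvalues of integer matrices with
    a common eigenvector. *)
Definition liftable (AA : seq C) := exists r (v : 'cV[C]_r) (Nf : C -> 'M[int]_r),
  v != 0 /\ conj_closed_lift AA v Nf.

(** The integer [z] is the multiplicity of the eigenvalue 0, that is, the
    dimension of the kernel. *)
Lemma trivial_group_decay (AA : seq C) (N : nat) (al k : R) :
  liftable AA -> 0 <= al -> {in AA, forall a, `|a| <= al%:C%C} ->
  1 <= k -> (N%:R * al) ^+ 2 <= k ->
  exists dl : R, [/\ 0 < dl, dl < 1 &
    forall (G : groupType) (J : finType) (A : seq (term R J G)),
      (forall g : G, g = 1%g) -> admissible AA N A ->
      exists z : nat, forall M, z%:R <= moment k A M /\
        forall q, moment k A M <= z%:R + #|J|%:R * decay dl q M].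
Proof.
move=> [r [v [Nf [v0 vN]]]] al0 AAal k1 kN.
have k0 : 0 < k by apply: lt_le_trans k1.
have [e Ne] : exists e : nat, {in AA, forall a p q,
    `|Nf a p q| <= e%:R /\ `|Nf (a^*)%C p q| <= e%:R}.
  exists (\sum_(a <- AA) \sum_p \sum_q (`|Nf a p q| + `|Nf (a^*)%C p q|))%N.
  move=> a aA p q; rewrite natz -!abszE !lez_nat.
  rewrite (big_rem a) //= (bigD1 p) //= (bigD1 q) //=.
  by split; rewrite -!addnA ?leq_addr // addnCA leq_addr.
pose r0 := ((r * (N * e)) ^ 2).+1.
pose c : R := r0%:R ^+ r * k.
have r0_gt0 : 0 < r0%:R :> R by rewrite ltr0n.
have c1 : 1 <= c.
  by rewrite -[1]mulr1 ler_pM // exprn_ege1 // ler1n.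
have c0 : 0 < c by apply: lt_le_trans c1.
(* The product of the eigenvalues divided by [k] is at least [c^-1 ^ n] for
   matrices of size [n]; the factor 2 makes the base less than 1. *)
have c2 : 1 < 2 * c by rewrite (lt_le_trans (y := 2)) ?ltr1n // ler_peMr.
have dl_gt0 : 0 < (2 * c)^-1 by rewrite invr_gt0 mulr_gt0.
have dl_lt1 : (2 * c)^-1 < 1 by rewrite invf_lt1 // mulr_gt0.
exists ((2 * c)^-1); split=> //.
move=> G J A G1 adm.
have [l [lk charB momE]] := moment_trivial_spectral G1 adm al0 AAal k0 kN.
have l_ge0 i : 0 <= l i by case/andP: (lk i).
exists #|[pred i | l i / k == 0]| => M; rewrite momE; split.
  rewrite -sum1_card natr_sum big_mkcond /=; apply: ler_sum => i _.
  rewrite inE; case: eqP => [->|_]; first by rewrite subr0 expr1n.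
  by rewrite exprn_even_ge0 // odd_double.
move=> q; rewrite -[X in _ + X%:R * _](card_ord #|J|).
apply: power_sum_le_decay.
- exact: dl_gt0.
- exact: dl_lt1.
- by move=> i; have /andP[? ?] := lk i; rewrite divr_ge0 ?(ltW k0) //= ler_pdivrMr // mul1r.
rewrite card_ord.
have := prod_nonzero_eigen_ge adm v0 vN Ne charB.
rewrite -/r0.
have -> : `|\prod_(i | (l i)%:C%C != 0) (l i)%:C%C| * r0%:R ^+ (#|J| * r) =
   ((\prod_(i | l i != 0) l i) * r0%:R ^+ (#|J| * r))%:C%C.
  rewrite rmorphM rmorphXn rmorph_nat rmorph_prod /=; congr (_ * _).
  rewrite ger0_norm; last by apply: prodr_ge0 => i _; rewrite ler0c.
  by apply: eq_bigl => i; rewrite (inj_eq (@complexI R) _ 0).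
rewrite -[1]/(1%:C%C) lecR => prod1.
rewrite (eq_bigl (fun i => l i != 0)); last first.
  by move=> i; rewrite mulf_eq0 invr_eq0 (gt_eqF k0) orbF.
rewrite big_split /= (le_trans (y := c^-1 ^+ #|J|)) //.
  apply: lerXn2r; rewrite ?nnegrE ?(ltW dl_gt0) ?invr_ge0 ?(ltW c0) //.
  have c_le : c <= 2 * c by rewrite ler_peMl ?ler1n ?(ltW c0).
  by rewrite lef_pV2 // posrE // mulr_gt0.
rewrite /c invfM exprMn; apply: ler_pM.
- by rewrite exprn_ge0 // invr_ge0 exprn_ge0 // ltW.
- by rewrite exprn_ge0 // invr_ge0 ltW.
- by rewrite exprVn -exprM mulnC -[leLHS]mul1r ler_pdivrMr ?exprn_gt0.
rewrite prodr_const exprVn exprVn lef_pV2 ?posrE ?exprn_gt0 //.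
by rewrite ler_weXn2l // (leq_trans (max_card _)) // card_ord.
Qed.
End Trivial.

(** * Uniform decay and local embeddings *)

Section Decay.
Context (R : rcfType).
Local Notation C := R[i].

(** The kernel dimension is eliminated by comparing two moments: the
    inequality for all [M'] says that the moments come within the decay of
    their infimum, and only involves finitely many products of group elements. *)
Definition has_decay (AA : seq C) (N : nat) (k dl : R) (G : groupType) :=
  forall (J : finType) (A : seq (term R J G)), admissible AA N A ->
  forall q M M', moment k A M <= moment k A M' + #|J|%:R * decay dl q M.

Lemma admissible_relabel (G H : eqType) (th : G -> H) (J : finType) AA N
    (A : seq (term R J G)) :
  admissible AA N A -> admissible AA N (relabel th A).
Proof.
move=> [cfA rowA colA]; split.
- by move=> t /mapP[u uA ->]; exact: (cfA u).
- by move=> i; rewrite count_map; exact: (rowA i).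
- by move=> i; rewrite count_map; exact: (colA i).
Qed.

(** The inequality concerns two moments, which a local embedding preserves. *)
Lemma has_decay_local AA N k dl (G : groupType) :
  (forall F : seq G, exists (H : groupType) (th : G -> H),
    [/\ has_decay AA N k dl H,
        {in F &, forall g h, th (g * h)%g = (th g * th h)%g}
      & {in F, forall g, th g = 1%g -> g = 1%g}]) ->
  has_decay AA N k dl G.
Proof.
move=> loc J A adm q M M'.
have [F HF] := moment_relabel k A (maxn M M').
have [H [th [decH thM th1]]] := loc F.
have E := HF H th thM th1.
rewrite -(E M) ?leq_maxl // -(E M') ?leq_maxr //.
exact: decH (admissible_relabel th adm) _ _ _.
Qed.

Section SupBound.
Context (AA : seq C) (N : nat) (al k : R).
Hypotheses (al0 : 0 <= al) (AAal : {in AA, forall a, `|a| <= al%:C%C}).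
Hypotheses (k0 : 0 < k) (kN : (N%:R * al) ^+ 2 <= k).
Context (G : groupType) (J : finType) (A : seq (term R J G)).
Hypothesis adm : admissible AA N A.
Context (X : Type) (la : G -> X -> X).

Lemma weighted_sum_le (P : pred (term R J G)) (f : term R J G -> C) (b : R) :
  (count P A <= N)%N -> 0 <= b -> (forall t, `|f t| <= b%:C%C) ->
  \sum_(t <- A | P t) al%:C%C * `|f t| <= (N%:R * al * b)%:C%C.
Proof.
move=> cP b0 fb; have b0' : 0 <= b%:C%C :> C by rewrite ler0c.
have al0' : 0 <= al%:C%C :> C by rewrite ler0c.
rewrite (le_trans (y := \sum_(t <- A | P t) al%:C%C * b%:C%C)) //.
  by apply: ler_sum => t _; rewrite ler_wpM2l.
rewrite big_const_seq iter_addr_0 -[_ *+ _]mulr_natl -mulrA !rmorphM /=.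
rewrite rmorph_nat; apply: ler_wpM2r; first exact: mulr_ge0.
by rewrite ler_nat.
Qed.

(** The operator norm for the supremum norm is at most [1 + (N * al) ^ 2 / k]. *)
Lemma gap_sup_le (f : J -> X -> C) (b : R) : 0 <= b ->
  (forall i x, `|f i x| <= b%:C%C) ->
  forall i x, `|gap la k A f i x| <= (2 * b)%:C%C.
Proof.
move=> b0 fb i x; have [cfA rowA colA] := adm.
pose c := N%:R * al; have c0 : 0 <= c by rewrite mulr_ge0 // ler0n.
have Af j y : `|act la A f j y| <= (c * b)%:C%C.
  rewrite /act (le_trans (ler_norm_sum _ _ _)) //.
  apply: le_trans (weighted_sum_le (rowA j) b0
     (f := fun t => f (tcol t) (la ((tlab t)^-1)%g y)) _) => //.
  rewrite big_seq_cond [leRHS]big_seq_cond; apply: ler_sum => t /andP[/cfA tA _].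
  by rewrite normrM ler_wpM2r // AAal.
have AAf : `|act la (fadj A) (act la A f) i x| <= (c * (c * b))%:C%C.
  rewrite act_adj (le_trans (ler_norm_sum _ _ _)) //.
  apply: le_trans (weighted_sum_le (colA i) (mulr_ge0 c0 b0)
     (f := fun t => act la A f (trow t) (la (tlab t) x)) _) => //.
  rewrite big_seq_cond [leRHS]big_seq_cond; apply: ler_sum => t /andP[/cfA tA _].
  by rewrite normrM ler_wpM2r // normcJ AAal.
rewrite /gap (le_trans (ler_normB _ _)) // [in leRHS]mulr_natl mulr2n rmorphD /=.
rewrite lerD // normrM ger0_norm ?ler0c ?invr_ge0 ?(ltW k0) //.
rewrite (le_trans (ler_wpM2l _ AAf)) ?ler0c ?invr_ge0 ?(ltW k0) //.
rewrite -rmorphM lecR mulrC ler_pdivrMr // mulrA -expr2 mulrC.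
by rewrite ler_wpM2l.
Qed.

Lemma iter_gap_sup_le (f : J -> X -> C) n :
  (forall i x, `|f i x| <= 1) ->
  forall i x, `|iter n (gap la k A) f i x| <= (2 ^+ n)%:C%C.
Proof.
move=> f1; elim: n => [|n IH]; first by rewrite expr0.
by move=> i x; rewrite iterS exprS; apply: gap_sup_le => //; rewrite exprn_ge0.
Qed.
End SupBound.
End Decay.

(** * Compression to a set with finitely many orbits *)

(** A subset [P] of [X], invariant under the free right action of [H], with
    finitely many orbits represented by the points [x p]; [co] returns the
    coordinates of a point of [P] in the bijection of [P] with the product of
    ['I_n] and [H]. Since the left action of [G] commutes with [H],
    compressing a matrix over [G] to [P] gives a matrix over [H]. *)
Section Compression.
Context (R : rcfType).
Local Notation C := R[i].
Context (G H : groupType) (X : eqType) (la : G -> X -> X) (ra : X -> H -> X).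
Hypothesis la1 : forall y, la 1%g y = y.
Hypothesis laM : forall g h y, la (g * h)%g y = la g (la h y).
Hypothesis ra1 : forall y, ra y 1%g = y.
Hypothesis raM : forall y h h', ra y (h * h')%g = ra (ra y h) h'.
Hypothesis raC : forall g y h, la g (ra y h) = ra (la g y) h.
Context (P : pred X) (n : nat) (x : 'I_n -> X) (co : X -> 'I_n * H).
Hypothesis Pra : forall y h, P (ra y h) = P y.
Hypothesis Px : forall p, P (x p).
Hypothesis coK : forall y, P y -> ra (x (co y).1) (co y).2 = y.
Hypothesis xK : forall p h, co (ra (x p) h) = (p, h).

Context (J : finType).
Implicit Types (A : seq (term R J G)).

Definition compress A : seq (term R (J * 'I_n)%type H) :=
  [seq (let y := la (tlab t) (x p) in
        ((trow t, (co y).1), (tcol t, p), (co y).2, tcf t))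
  | t <- A, p <- [seq p <- enum 'I_n | P (la (tlab t) (x p))]].

Definition pull (F : J -> X -> C) : J * 'I_n -> H -> C :=
  fun ip h => F ip.1 (ra (x ip.2) h).

Definition supported (F : J -> X -> C) := forall j y, ~~ P y -> F j y = 0.

Lemma big_compress (T : Type) (idx : T) (op : Monoid.com_law idx)
    (Q : pred (term R (J * 'I_n)%type H)) (f : term R (J * 'I_n)%type H -> T) A :
  \big[op/idx]_(t <- compress A | Q t) f t =
  \big[op/idx]_(t <- A) \big[op/idx]_(p | P (la (tlab t) (x p)) &&
      Q (let y := la (tlab t) (x p) in
         ((trow t, (co y).1), (tcol t, p), (co y).2, tcf t)))
    f (let y := la (tlab t) (x p) in
         ((trow t, (co y).1), (tcol t, p), (co y).2, tcf t)).
Proof.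
rewrite big_mkcond big_allpairs_dep /=; apply: eq_bigr => t _.
by rewrite big_filter -big_mkcondr /= big_enum_cond.
Qed.

Lemma la_moved g p q h :
  (la g (x p) == ra (x q) h) = (la (g^-1)%g (x q) == ra (x p) (h^-1)%g).
Proof.
apply/eqP/eqP => E.
  have : ra (la (g^-1)%g (la g (x p))) (h^-1)%g = ra (la (g^-1)%g (ra (x q) h)) (h^-1)%g.
    by rewrite E.
  by rewrite -laM mulVg la1 => ->; rewrite raC -raM mulgV ra1.
have : ra (la g (la (g^-1)%g (x q))) h = ra (la g (ra (x p) (h^-1)%g)) h.
  by rewrite E.
by rewrite -laM mulgV la1 => ->; rewrite raC -raM mulVg ra1.
Qed.

Lemma la_coE g p : P (la g (x p)) ->
  la g (x p) = ra (x (co (la g (x p))).1) (co (la g (x p))).2.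
Proof. by move=> Pg; rewrite coK. Qed.

(** For each term there is at most one orbit that it moves into the orbit of
    [x q], which is why the compressed sum collapses to the original one. *)
Lemma act_compress A F : supported F ->
  act (fun g h : H => (g * h)%g) (compress A) (pull F) = pull (act la A F).
Proof.
move=> sF; apply/funext => -[i q]; apply/funext => h.
rewrite /act big_compress /pull /= [RHS]big_mkcond /=; apply: eq_bigr => t _.
rewrite /trow /tcol /tlab /tcf /= -/(trow t) -/(tcol t) -/(tlab t) -/(tcf t).
set g := tlab t.
under eq_bigl do rewrite xpair_eqE.
case: eqP => [_|_] /=; last by rewrite big_pred0 // => p; rewrite andbF.
set y0 := la (g^-1)%g (x q).
rewrite raC -/y0; have [Py0|nPy0] := boolP (P y0); last first.
  rewrite sF ?Pra // mulr0 big1 // => p /andP[Pp /eqP cq].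
  have /eqP := la_coE Pp; rewrite cq la_moved => /eqP yE.
  by case/negP: nPy0; rewrite /y0 yE Pra.
have y0E := coK Py0; set p0 := (co y0).1 in y0E; set h0 := (co y0).2 in y0E.
have gE : la g (x p0) = ra (x q) (h0^-1)%g.
  by apply/eqP; rewrite la_moved invgK y0E.
rewrite (big_pred1 p0) /= => [|p].
  by rewrite gE xK /= invgK raM y0E.
apply/andP/eqP => [[Pp /eqP cq]|->]; last by rewrite gE Pra xK.
have /eqP := la_coE Pp; rewrite cq la_moved -/y0 => /eqP yE.
by rewrite /p0 yE xK.
Qed.

Lemma act_adj_compress A F : supported F ->
  act (fun g h : H => (g * h)%g) (fadj (compress A)) (pull F) = pull (act la (fadj A) F).
Proof.
move=> sF; apply/funext => -[j p0]; apply/funext => h.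
rewrite act_adj big_compress /pull act_adj /= [RHS]big_mkcond /=.
apply: eq_bigr => t _.
rewrite /trow /tcol /tlab /tcf /= -/(trow t) -/(tcol t) -/(tlab t) -/(tcf t).
set g := tlab t.
under eq_bigl do rewrite xpair_eqE.
case: eqP => [_|_] /=; last by rewrite big_pred0 // => p; rewrite andbF.
rewrite raC; have [Pg|nPg] := boolP (P (la g (x p0))); last first.
  rewrite sF ?Pra // mulr0 big1 // => p /andP[Pp /eqP pE].
  by case/negP: nPg; rewrite -pE.
rewrite (big_pred1 p0) /= => [|p]; first by rewrite raM -la_coE.
by apply/andP/eqP => [[_ /eqP]|->] //; rewrite Pg.
Qed.

(** The adjoint of a compression is the compression of the adjoint, but the
    product of two compressions loses the values that leave [P] in between;
    hence the assumption on the intermediate function. *)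
Lemma gap_compress k A F : supported F -> supported (act la A F) ->
  gap (fun g h : H => (g * h)%g) k (compress A) (pull F) = pull (gap la k A F).
Proof.
move=> sF sAF; rewrite /gap act_compress // act_adj_compress //.
Qed.

Lemma pull_delta i q : pull (delta R i (x q)) = delta R (i, q) 1%g.
Proof.
apply/funext => -[j p]; apply/funext => h; rewrite /pull /delta /=.
rewrite xpair_eqE -andbA; congr (_ && _)%:R.
apply/eqP/andP => [E|[/eqP-> /eqP->]]; last by rewrite ra1.
by have := xK p h; rewrite E -[x q]ra1 xK => -[-> ->].
Qed.

Definition stays_in (F : seq G) (q : 'I_n) := all (fun g => P (la g (x q))) F.

(** The group elements by which a delta function is moved when the first [M]
    powers are computed, including the intermediate step between [A] and its
    adjoint. *)
Definition range_labels k A M : seq G :=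
  flatten [seq labs (fexp (fgap k A) m) ++ labs (fmul A (fexp (fgap k A) m))
          | m <- iota 0 M.+1].

(** As long as the translates stay in [P], compression does not change the
    computation started at [x q]. *)
Lemma iter_gap_compress k A M q : stays_in (range_labels k A M) q ->
  forall i m, (m <= M)%N ->
  iter m (gap (fun g h : H => (g * h)%g) k (compress A)) (delta R (i, q) 1%g) =
  pull (iter m (gap la k A) (delta R i (x q))).
Proof.
pose W m := fexp (fgap k A) m.
pose E m := labs (W m) ++ labs (fmul A (W m)).
move=> /allP inF i.
have inF' m g : (m <= M)%N -> g \in E m -> P (la g (x q)).
  move=> mM gE; apply: inF; apply/flattenP; exists (E m) => //.
  by apply/mapP; exists m => //; rewrite mem_iota add0n ltnS.
have sW V : (forall g, g \in labs V -> P (la g (x q))) ->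
    supported (act la V (delta R i (x q))).
  move=> VP j y nPy; rewrite act_delta // big_seq_cond big_pred0 // => t.
  apply/negP => /and4P[tV _ _ /eqP yE]; case/negP: nPy.
  by rewrite yE; apply: VP; apply/mapP; exists t.
elim=> [|m IH] mM; first by rewrite pull_delta.
rewrite !iterS IH ?(ltnW mM) // -!(act_fgap_exp la1 laM) gap_compress //.
  by apply: sW => g gV; apply: (inF' m); rewrite ?(ltnW mM) // mem_cat gV.
rewrite -(act_fmul laM); apply: sW => g gV; apply: (inF' m); rewrite ?(ltnW mM) //.
by rewrite mem_cat gV orbT.
Qed.

(** The left action permutes the orbits, so a term gives at most one entry in
    each row and in each column of blocks. *)
Lemma admissible_compress AA N A :
  admissible AA N A -> admissible AA N (compress A).
Proof.
move=> [cfA rowA colA]; split.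
- by move=> t /allpairsPdep[u [p [uA _ ->]]]; exact: cfA.
- move=> [i q]; rewrite -sum1_count big_compress /=.
  rewrite (leq_trans _ (rowA i)) // -sum1_count [leqRHS]big_mkcond /=.
  apply: leq_sum => t _; rewrite {1}/trow /=; case: eqP => [_|ne]; last first.
    by rewrite big_pred0 // => p; rewrite xpair_eqE; case: eqP => //; rewrite andbF.
  rewrite sum1_card; apply/card_le1_eqP => p p'; rewrite !unfold_in.
  rewrite /trow /= => /andP[Pp /andP[_ /eqP /= cp]] /andP[Pp' /andP[_ /eqP /= cp']].
  have /eqP := la_coE Pp; rewrite cp la_moved => /eqP E1.
  have /eqP := la_coE Pp'; rewrite cp' la_moved E1 => /eqP E2.
  by have := congr1 co E2; rewrite !xK => -[].
- move=> [j q]; rewrite -sum1_count big_compress /=.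
  rewrite (leq_trans _ (colA j)) // -sum1_count [leqRHS]big_mkcond /=.
  apply: leq_sum => t _; rewrite {1}/tcol /=; case: eqP => [_|ne]; last first.
    by rewrite big_pred0 // => p; rewrite xpair_eqE; case: eqP => //; rewrite andbF.
  rewrite sum1_card; apply/card_le1_eqP => p p'; rewrite !unfold_in.
  by move=> /andP[_ /andP[_ /eqP /= ->]] /andP[_ /andP[_ /eqP /= ->]].
Qed.
End Compression.

Section Extension.
Context (R : rcfType).
Local Notation C := R[i].

Definition folner_piece (G H : groupType) (X : eqType) (la : G -> X -> X)
    (ra : X -> H -> X) (F : seq G) (eps : R) : Prop :=
  exists (P : pred X) (n : nat) (x : 'I_n -> X) (co : X -> 'I_n * H),
   [/\ (0 < n)%N, (forall y h, P (ra y h) = P y) /\ (forall p, P (x p)),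
       (forall y, P y -> ra (x (co y).1) (co y).2 = y),
       (forall p h, co (ra (x p) h) = (p, h)) &
       #|[pred q | ~~ stays_in la P x F q]|%:R <= eps * n%:R].

(** The consequence of the definition of a generalized amenable extension that
    the trace estimate uses: arbitrarily good finite pieces for every finite
    set of translations. *)
Definition folner_extension (G H : groupType) :=
  exists (X : eqType) (la : G -> X -> X) (ra : X -> H -> X),
  [/\ (forall y, la 1%g y = y) /\
      (forall g h y, la (g * h)%g y = la g (la h y)),
      (forall g y, la g y = y -> g = 1%g),
      (forall y, ra y 1%g = y) /\
      (forall y h h', ra y (h * h')%g = ra (ra y h) h'),
      (forall g y h, la g (ra y h) = ra (la g y) h)
    & forall F eps, 0 < eps -> folner_piece la ra F eps].

Lemma norm_Re_le (z : C) (b : R) : `|z| <= b%:C%C -> `|complex.Re z| <= b.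
Proof. by move=> zb; rewrite -lecR (le_trans (normc_ge_Re z)). Qed.

Lemma Re_sum (I : Type) (r : seq I) (f : I -> C) :
  complex.Re (\sum_(i <- r) f i) = \sum_(i <- r) complex.Re (f i).
Proof. by elim/big_rec2: _ => // i _ y _ <-; case: (f i) => ? ?; case: y. Qed.

Context (AA : seq C) (N : nat) (al k dl : R).
Hypotheses (al0 : 0 <= al) (AAal : {in AA, forall a, `|a| <= al%:C%C}).
Hypotheses (k0 : 0 < k) (kN : (N%:R * al) ^+ 2 <= k).

Lemma diag_moment_bound (G : groupType) (J : finType) (A : seq (term R J G))
    (X : eqType) (la : G -> X -> X) (I : finType) (z : I -> J * X) m :
  admissible AA N A ->
  `|complex.Re (\sum_i iter m (gap la k A) (delta R (z i).1 (z i).2) (z i).1 (z i).2)|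
     <= #|I|%:R * 2 ^+ m.
Proof.
move=> adm; apply: norm_Re_le; rewrite (le_trans (ler_norm_sum _ _ _)) //.
rewrite rmorphM rmorph_nat mulr_natl -sumr_const; apply: ler_sum => i _.
apply: (iter_gap_sup_le al0 AAal k0 kN adm) => j y.
by rewrite /delta normr_nat lern1 leq_b1.
Qed.

(** The moment of the compressed matrix is a sum over orbits. An orbit that
    stays in the piece contributes exactly the moment of [A] and every other
    orbit differs by a bounded amount; after division by the number of orbits
    the inequality over [H] becomes the inequality over [G] up to an
    arbitrarily small error. *)
Lemma has_decay_extension (G H : groupType) :
  folner_extension G H -> has_decay AA N k dl H -> has_decay AA N k dl G.
Proof.
move=> [X [la [ra [[la1 laM] lafree [ra1 raM] raC folner]]]] decH J A adm q M M'.
pose L := ((maxn M M').*2)%N; pose c : R := #|J|%:R * 2 ^+ L.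
have c0 : 0 <= c by rewrite mulr_ge0 ?ler0n ?exprn_ge0.
apply/ler_addgt0Pr => e e0.
(* Each of the two moments is off by at most [2 * c] per orbit that leaves. *)
pose eps := e / (4 * c + 1).
have d0 : 0 < 4 * c + 1 by rewrite ltr_wpDl // mulr_ge0.
have eps0 : 0 < eps by rewrite divr_gt0.
have [P [n [x [co [n0 [Pra Px] coK xK leaving]]]]] :=
  folner (range_labels k A L) eps eps0.
set F := range_labels k A L in leaving.
have n0' : 0 < n%:R :> R by rewrite ltr0n.
pose Ak := compress la P x co A.
have admk : admissible AA N Ak by exact: (admissible_compress la1 laM).
pose mulH := fun g h : H => (g * h)%g.
pose s m p := complex.Re (\sum_i iter m.*2 (gap mulH k Ak)
   (delta R (i, p) 1%g) (i, p) 1%g).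
have momk m : moment k Ak m = \sum_p s m p.
  rewrite (moment_free (la := mulH) k Ak m (fun=> 1%g)).
  - pose f i p := iter m.*2 (gap mulH k Ak) (delta R (i, p) 1%g) (i, p) 1%g.
    rewrite (eq_bigr (fun ip => f ip.1 ip.2)); last by case.
    by rewrite -(pair_bigA _ f) exchange_big Re_sum.
  - exact: mul1g.
  - by move=> g h y; rewrite /mulH mulgA.
  - by move=> g y E; apply: (mulIg y); rewrite mul1g.
have sin m p : (m <= maxn M M')%N -> stays_in la P x F p -> s m p = moment k A m.
  move=> mM inp; rewrite (moment_free k A m (fun=> x p) la1 laM lafree).
  congr complex.Re; apply: eq_bigr => i _.
  by rewrite (iter_gap_compress la1 laM ra1 raM raC Pra Px coK xK inp) ?leq_double // /pull ra1.
have pow2 m : (m <= maxn M M')%N -> #|J|%:R * 2 ^+ m.*2 <= c :> R.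
  by move=> mM; rewrite ler_wpM2l // ler_weXn2l ?ler1n // leq_double.
have sb m p : (m <= maxn M M')%N -> `|s m p| <= c.
  move=> mM; apply: le_trans (pow2 m mM).
  exact: (diag_moment_bound mulH (fun i => ((i, p), 1%g)) m.*2 admk).
have Ab m : (m <= maxn M M')%N -> `|moment k A m| <= c.
  move=> mM; apply: le_trans (pow2 m mM).
  rewrite (moment_free k A m (fun=> x (Ordinal n0)) la1 laM lafree).
  exact: (diag_moment_bound la (fun i => (i, x (Ordinal n0))) m.*2 adm).
have diff m : (m <= maxn M M')%N ->
    `|moment k Ak m - n%:R * moment k A m| <= 2 * c * eps * n%:R.
  move=> mM; have -> : n%:R * moment k A m = \sum_(p < n) moment k A m.
    by rewrite sumr_const card_ord mulr_natl.
  rewrite momk -sumrB (le_trans (ler_norm_sum _ _ _)) //.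
  rewrite -[2 * c * eps * _]mulrA.
  have cc0 : 0 <= 2 * c by rewrite mulr_ge0.
  apply: le_trans (ler_wpM2l cc0 leaving).
  rewrite -sum1_card natr_sum mulr_sumr big_mkcond [leRHS]big_mkcond /=.
  apply: ler_sum => p _; rewrite inE; case: ifPn => [inp|]; last first.
    by move/negPn => inp; rewrite sin // subrr normr0.
  by rewrite mulr1 mulr_natl mulr2n (le_trans (ler_normB _ _)) // lerD ?sb ?Ab.
have := decH _ _ admk q M M'.
rewrite card_prod card_ord natrM.
have := diff M (leq_maxl _ _); have := diff M' (leq_maxr _ _).
rewrite !ler_norml => /andP[d1 d2] /andP[d3 d4] dk.
have E : eps * (4 * c) <= e.
  rewrite /eps mulrAC ler_pdivrMr // ler_wpM2l ?(ltW e0) // lerDl //.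
set D := decay _ _ _ in dk *; set a := moment k A M in d3 d4 *.
set b := moment k A M' in d1 d2 *.
rewrite -(ler_pM2l n0').
have : 4 * c * eps * n%:R <= e * n%:R by rewrite ler_wpM2r ?ler0n // mulrC.
lra.
Qed.
End Extension.

(** * Folner sets of generalized amenable extensions *)

Section Transversal.
Context (H : groupType) (X : Type) (ra : X -> H -> X).
Hypothesis ra1 : forall y, ra y 1%g = y.
Hypothesis raM : forall y h h', ra y (h * h')%g = ra (ra y h) h'.
Hypothesis rafree : forall y h, ra y h = y -> h = 1%g.

Lemma orbit_eq y y' : range (ra y) = range (ra y') <-> exists h, y' = ra y h.
Proof.
split=> [E|[h ->]].
  have : range (ra y') y' by exists 1%g.
  by rewrite -E => -[h _ <-]; exists h.
apply/seteqP; split=> z [h' _ <-].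
  by exists (h^-1 * h')%g => //; rewrite -raM mulgA mulgV mul1g.
by exists (h * h')%g => //; rewrite raM.
Qed.

Lemma ra_inj y h h' : ra y h = ra y h' -> h = h'.
Proof.
move=> E; suff : (h * h'^-1)%g = 1%g by move/(canRL (mulgK _)); rewrite mul1g invgK.
by apply: (rafree (y := y)); rewrite raM E -raM mulgV ra1.
Qed.

(** Freeness of the right action makes [Y] the product of its set of orbits
    with [H]. *)
Definition transversal_of (Y : set X) n (x : 'I_n -> X) (co : X -> 'I_n * H) :=
  [/\ forall p, Y (x p), forall y, Y y -> ra (x (co y).1) (co y).2 = y
    & forall p h, co (ra (x p) h) = (p, h)].

Lemma transversal_exists (Y : set X) :
  Y !=set0 -> (forall y h, Y y -> Y (ra y h)) -> finite_set (orbits ra Y) ->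
  (0 < ncard (orbits ra Y))%N /\
  exists (x : 'I_(ncard (orbits ra Y)) -> X) co, transversal_of Y x co.
Proof.
move=> [y0 Yy0] Yra fin; rewrite /ncard; set s := fset_set _.
have sP O : (O \in s) <-> exists2 y, Y y & O = range (ra y).
  rewrite /s in_fset_set // inE /orbits; split=> [[y Yy <-]|[y Yy ->]]; by exists y.
have n0 : (0 < #|` s|)%N.
  by rewrite cardfs_gt0; apply/fset0Pn; exists (range (ra y0)); apply/sP; exists y0.
split=> //.
pose O (p : 'I_#|` s|) := nth set0 s p.
have Os p : O p \in s by rewrite mem_nth.
have /choice[x xP] : forall p, exists y, Y y /\ O p = range (ra y).
  by move=> p; have /sP[y Yy E] := Os p; exists y.
have /choice[co coP] : forall y, exists ph : 'I_#|` s| * H,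
    Y y -> ra (x ph.1) ph.2 = y.
  move=> y; have [Yy|nY] := pselect (Y y); last by exists (Ordinal n0, 1%g).
  have ys : range (ra y) \in s by apply/sP; exists y.
  have ip : (index (range (ra y)) s < #|` s|)%N by rewrite index_mem.
  have : range (ra (x (Ordinal ip))) = range (ra y).
    by rewrite -(xP _).2 /O /= nth_index.
  by move=> /orbit_eq[h E]; exists (Ordinal ip, h).
exists x, co; split=> [p|//|p h]; first exact: (xP p).1.
have := coP _ (Yra _ h (xP p).1); case: (co _) => p' h' /= E.
have pp' : p' = p.
  apply/val_inj/eqP; rewrite -(nth_uniq set0 _ _ (fset_uniq s)) ?ltn_ord //.
  apply/eqP; rewrite -!/(O _) !(xP _).2; apply/orbit_eq.
  by exists (h' * h^-1)%g; rewrite raM E -raM mulgV ra1.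
by rewrite pp' in E *; rewrite (ra_inj E).
Qed.
End Transversal.

Section Folner.
Context (R : realType) (G H : groupType) (X : Type).
Context (la : G -> X -> X) (ra : X -> H -> X).
Hypothesis la1 : forall y, la 1%g y = y.
Hypothesis laM : forall g h y, la (g * h)%g y = la g (la h y).
Hypothesis ra1 : forall y, ra y 1%g = y.
Hypothesis raM : forall y h h', ra y (h * h')%g = ra (ra y h) h'.
Hypothesis raC : forall g y h, la g (ra y h) = ra (la g y) h.

Definition boundary (S : set G) (Y : set X) : set X :=
  [set la s y | s in S & y in Y] `\` Y.

Section Leaving.
Context (S : set G) (Y : set X) (n : nat) (x : 'I_n -> X) (co : X -> 'I_n * H).
Hypothesis Sfin : finite_set S.
Hypothesis Yra : forall y h, Y y -> Y (ra y h).
Hypothesis Yfin : finite_set (orbits ra Y).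
Hypothesis tr : transversal_of ra Y x co.

(** The number of these orbits is subadditive in [g], which reduces all group
    elements to the generators. *)
Definition leaving (g : G) : {set 'I_n} := [set q | ~~ `[< Y (la g (x q)) >]].

Lemma YraE y h : Y (ra y h) <-> Y y.
Proof.
by split=> [/(Yra (h^-1)%g)|/Yra//]; rewrite -raM mulgV ra1.
Qed.

Lemma orbits_boundary_finite : finite_set (orbits ra (boundary S Y)).
Proof.
apply: (sub_finite_set (B := [set la s @` O | s in S & O in orbits ra Y])).
  move=> _ [z [[s Ss [y Yy <-]] _] <-]; exists s => //; exists (range (ra y)).
    by exists y.
  apply/seteqP; split=> w.
    by case=> _ [h _ <-] <-; exists h => //; rewrite raC.
  by case=> h _ <-; exists (ra y h); [exists h|rewrite raC].
exact: finite_image2.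
Qed.

Lemma leaving1 : leaving 1%g = finset.set0.
Proof.
have [Yx _ _] := tr; apply/setP => q; rewrite !inE la1.
by apply/negbTE; rewrite negbK; apply/asboolP.
Qed.

Lemma transversal_inj q q' h : x q' = ra (x q) h -> q = q'.
Proof.
have [_ _ xK] := tr.
by move=> E; have := xK q' 1%g; rewrite ra1 E xK => -[].
Qed.

(** Distinct representatives are moved into distinct orbits of the boundary. *)
Lemma leaving_gen s : S s -> (#|leaving s| <= ncard (orbits ra (boundary S Y)))%N.
Proof.
move=> Ss; have [Yx coK xK] := tr; rewrite /ncard.
set Z := fset_set _.
pose f q := range (ra (la s (x q))).
have finj : injective f.
  move=> q q' /(orbit_eq ra1 raM)[h]; rewrite -raC => /(congr1 (la (s^-1)%g)).
  by rewrite -!laM mulVg !la1; exact: transversal_inj.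
rewrite cardE -(size_map f); apply: uniq_leq_size.
  by rewrite map_inj_uniq ?enum_uniq.
move=> O /mapP[q qb ->]; move: qb; rewrite mem_enum inE => /asboolP nY.
rewrite /Z in_fset_set; last exact: orbits_boundary_finite.
rewrite inE; exists (la s (x q)) => //; split=> //.
by exists s => //; exists (x q).
Qed.

(** If [g * h] moves [x q] out but [h] does not, then [g] moves out the
    representative of the orbit that contains [h . x q], and distinct [q] give
    distinct representatives. *)
Lemma leavingM g h : (#|leaving (g * h)%g| <= #|leaving g| + #|leaving h|)%N.
Proof.
have [Yx coK xK] := tr.
pose f q := (co (la h (x q))).1.
pose B := [set q in leaving (g * h)%g | q \notin leaving h].
have Bin q : q \in B -> Y (la h (x q)) /\ ~ Y (la g (la h (x q))).
  rewrite !inE laM negbK => /andP[/negP nY /asboolP Yh]; split=> //.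
  by move=> YY; apply: nY; apply/asboolP.
have fB : f @: B \subset leaving g.
  apply/fintype.subsetP => _ /imsetP[q /Bin[Yh nY] ->]; rewrite inE.
  apply/negP => /asboolP Yg; apply: nY.
  by rewrite -(coK _ Yh) raC; apply/YraE.
have fi : {in B &, injective f}.
  move=> q q' /Bin[Yh _] /Bin[Yh' _] ff.
  have E := coK _ Yh; have E' := coK _ Yh'; rewrite -/(f q') -ff /f in E'.
  have LI : injective (la h).
    by apply: (can_inj (g := la (h^-1)%g)) => y; rewrite -laM mulVg la1.
  move: (co (la h (x q))) (co (la h (x q'))) E E' => [p h1] [p' h2] /= E E'.
  apply: (transversal_inj (h := (h1^-1 * h2)%g)); apply: LI.
  by rewrite raC -E -E' -raM mulgA mulgV mul1g.
have -> : leaving (g * h)%g = leaving (g * h)%g :&: leaving h :|: B.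
  by apply/setP => q; rewrite !inE; case: `[< _ >]; case: `[< _ >].
rewrite (leq_trans (leq_card_setU _ _)) // addnC leq_add //.
  by rewrite -(card_in_imset fi) subset_leq_card.
by rewrite subset_leq_card // subsetIr.
Qed.
End Leaving.

(** The elements [g] such that the bound holds for [g] and its inverse form a
    subgroup that contains the generators. The factor [l] is independent of
    [Y]. *)
Lemma leaving_linear (S : set G) : finite_set S -> (forall s, S s -> S (s^-1)%g) ->
  generates S -> forall g, exists l : nat,
  forall (Y : set X) n (x : 'I_n -> X) co,
    (forall y h, Y y -> Y (ra y h)) -> finite_set (orbits ra Y) ->
    transversal_of ra Y x co ->
    (#|leaving Y x g| <= l * ncard (orbits ra (boundary S Y)))%N.
Proof.
move=> Sfin Sinv Sgen.
pose Q : set G := fun g => exists l : nat, forall (Y : set X) n (x : 'I_n -> X) co,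
    (forall y h, Y y -> Y (ra y h)) -> finite_set (orbits ra Y) ->
    transversal_of ra Y x co ->
    (#|leaving Y x g| <= l * ncard (orbits ra (boundary S Y)))%N.
have Q1 : Q 1%g.
  by exists 0%N => Y n x co Yra Yfin tr; rewrite (leaving1 tr) cards0.
have QM g h : Q g -> Q h -> Q (g * h)%g.
  move=> [l lP] [l' lP']; exists (l + l')%N => Y n x co Yra Yfin tr.
  rewrite mulnDl (leq_trans (leavingM Yra tr g h)) // leq_add //.
    exact: (lP _ _ _ _ Yra Yfin tr).
  exact: (lP' _ _ _ _ Yra Yfin tr).
have QS s : S s -> Q s.
  move=> Ss; exists 1%N => Y n x co Yra Yfin tr; rewrite mul1n.
  exact: (leaving_gen Sfin Yfin tr).
pose Q' : set G := fun g => Q g /\ Q (g^-1)%g.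
have Q'T : Q' = setT.
  apply: Sgen.
  - by split; rewrite ?invg1.
  - by move=> a b [Qa Qa'] [Qb Qb']; split; rewrite ?invgM; exact: QM.
  - by move=> a [Qa Qa']; split; rewrite ?invgK.
  - by move=> s Ss; split; apply: QS => //; exact: Sinv.
by move=> g; have [] : Q' g by rewrite Q'T.
Qed.
End Folner.

Lemma gen_amenable_ext_folner (R : realType) (G H : groupType) :
  gen_amenable_ext R G H -> folner_extension R G H.
Proof.
move=> [S [iota [[Sfin Sinv Sgen _ _] [X [la [ra [X_]]]]]]].
move=> [[la1 laM lafree [ra1 raM rafree raC]] [Y0 _ _ Yra [Yfin lim]]].
exists {classic X}, la, ra; split=> // F eps eps0.
pose b k := ncard (orbits ra (boundary la S (X_ k))).
pose n k := ncard (orbits ra (X_ k)).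
have /choice[l lP] := leaving_linear la1 laM ra1 raM raC Sfin Sinv Sgen.
pose L := (\sum_(g <- F) l g)%N.
have e0 : 0 < eps / (L.+1)%:R by rewrite divr_gt0.
have [k kP] : exists k, (b k)%:R / (n k)%:R <= eps / (L.+1)%:R.
  have /cvgrPdist_lt/(_ _ e0)[k _ kP] := lim.
  exists k; have := kP k (leqnn k); rewrite /= sub0r normrN => /ltW.
  by apply: le_trans; rewrite ler_norm.
have Yrak y h : X_ k y -> X_ k (ra y h) by apply: Yra.
have [n0 [x [co tr]]] := transversal_exists ra1 raM rafree (Y0 k) Yrak (Yfin k).
exists (fun y => `[< X_ k y >]), (n k), x, co.
have [Yx coK xK] := tr; split=> //.
- split=> [y h|p]; last exact/asboolP.
  by apply/asboolP/asboolP => /(YraE ra1 raM Yrak).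
- by move=> y /asboolP /coK.
have -> : #|[pred q | ~~ stays_in (X := {classic X}) la (fun y => `[< X_ k y >]) x F q]| =
    #|\bigcup_(g <- F) leaving la (X_ k) x g|.
  apply: eq_card => q; rewrite !inE /stays_in -has_predC.
  elim: F {L e0 kP} => [|g F IH] /=; first by rewrite big_nil inE.
  by rewrite big_cons !inE IH.
have le1 : (#|\bigcup_(g <- F) leaving la (X_ k) x g| <= L * b k)%N.
  rewrite /L big_distrl /=; elim: F {L e0 kP} => [|g F IH].
    by rewrite !big_nil cards0.
  rewrite !big_cons (leq_trans (leq_card_setU _ _)) // leq_add //.
  exact: (lP g _ _ _ _ Yrak (Yfin k) tr).
rewrite (le_trans (y := (L * b k)%:R)) ?ler_nat // natrM.
have nk0 : 0 < (n k)%:R :> R by rewrite ltr0n.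
move: kP; rewrite ler_pdivrMr // mulrAC ler_pdivlMr ?ltr0n // => /(le_trans _); apply.
by rewrite mulrC ler_wpM2l ?ler0n // ler_nat.
Qed.

(** * Sums over arbitrary index sets *)

Section RealSums.
Context (R : realType) (T : choiceType).
Implicit Types (f g h : T -> R).

Definition rsummable f := summable setT (EFin \o f).

Lemma rsummable_le f g : (forall t, `|f t| <= `|g t|) -> rsummable g -> rsummable f.
Proof.
move=> fg; apply: le_lt_trans; apply: le_esum => t _ /=.
by rewrite lee_fin.
Qed.

Lemma rsummableD f g : rsummable f -> rsummable g -> rsummable (fun t => f t + g t).
Proof. exact: summableD. Qed.

Lemma esum_fin_num f : (forall t, 0 <= f t) -> rsummable f ->
  (\esum_(t in setT) (f t)%:E \is a fin_num)%E.
Proof.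
move=> u0; rewrite /rsummable summableE (eq_esum (b := fun t => (f t)%:E)) //.
by move=> t _ /=; rewrite ger0_norm.
Qed.

(** Unlike the positive and negative parts, this decomposition is stable under
    addition; the linearity of [rsum] is derived from it. *)
Lemma rsum_sub g h : (forall t, 0 <= g t) -> (forall t, 0 <= h t) ->
  rsummable g -> rsummable h ->
  rsum (fun t => g t - h t) =
  fine (\esum_(t in setT) (g t)%:E) - fine (\esum_(t in setT) (h t)%:E).
Proof.
move=> g0 h0 sg sh; rewrite /rsum.
have E : (EFin \o (fun t => g t - h t)) = ((EFin \o g) \- (EFin \o h))%E.
  by apply/funext => t.
rewrite E -!fineB ?esum_fin_num //.
- by congr fine; apply: esumB => // i _; rewrite lee_fin.
- move: (summable_funepos (summableB sg sh)); rewrite summableE.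
  by rewrite (eq_esum (b := ((EFin \o g) \- (EFin \o h))^\+%E)) // => t _; rewrite gee0_abs.
- move: (summable_funeneg (summableB sg sh)); rewrite summableE.
  by rewrite (eq_esum (b := ((EFin \o g) \- (EFin \o h))^\-%E)) // => t _; rewrite gee0_abs.
Qed.

Lemma rsum_nonneg f : (forall t, 0 <= f t) ->
  rsum f = fine (\esum_(t in setT) (f t)%:E).
Proof.
move=> f0; rewrite /rsum [X in _ - fine X]esum1 ?subr0.
  congr fine; apply: eq_esum => t _; rewrite funeposE /=.
  by apply/max_idPl; rewrite lee_fin.
move=> t _; rewrite funenegE /=; apply/max_idPr.
by rewrite lee_fin oppr_le0.
Qed.

Let fp f t := Num.max (f t) 0.
Let fn f t := Num.max (- f t) 0.
Let fp0 f t : 0 <= fp f t. Proof. by rewrite le_max lexx orbT. Qed.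
Let fn0 f t : 0 <= fn f t. Proof. by rewrite le_max lexx orbT. Qed.
Let fpn f t : f t = fp f t - fn f t.
Proof. by rewrite /fp /fn; case: (leP 0 (f t)) => h; case: (leP 0 (- f t)) => h'; lra. Qed.
Let fp_le f t : `|fp f t| <= `|f t|.
Proof. by rewrite /fp; case: (leP 0 (f t)) => h; rewrite ?normr0. Qed.
Let fn_le f t : `|fn f t| <= `|f t|.
Proof. by rewrite /fn -(normrN (f t)); case: (leP 0 (- f t)) => h; rewrite ?normr0. Qed.
Let sfp f : rsummable f -> rsummable (fp f). Proof. exact: rsummable_le. Qed.
Let sfn f : rsummable f -> rsummable (fn f). Proof. exact: rsummable_le. Qed.

Lemma eq_rsum f g : f =1 g -> rsum f = rsum g.
Proof. by move=> /funext ->. Qed.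

Lemma rsumD f g : rsummable f -> rsummable g ->
  rsum (fun t => f t + g t) = rsum f + rsum g.
Proof.
move=> sf sg.
have -> : rsum (fun t => f t + g t) =
    rsum (fun t => (fp f t + fp g t) - (fn f t + fn g t)).
  by apply: eq_rsum => t; rewrite {1}(fpn f) {1}(fpn g); lra.
have -> : rsum f = rsum (fun t => fp f t - fn f t) by apply: eq_rsum => t; exact: fpn.
have -> : rsum g = rsum (fun t => fp g t - fn g t) by apply: eq_rsum => t; exact: fpn.
have a0 (u v : T -> R) t : 0 <= u t -> 0 <= v t -> 0 <= u t + v t by exact: addr_ge0.
have split2 (u v : T -> R) : (forall t, 0 <= u t) -> (forall t, 0 <= v t) ->
    rsummable u -> rsummable v ->
    fine (\esum_(t in setT) (u t + v t)%:E) =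
    fine (\esum_(t in setT) (u t)%:E) + fine (\esum_(t in setT) (v t)%:E).
  move=> u0 v0 su sv; rewrite -fineD ?esum_fin_num // -esumD //.
  - by move=> i _; rewrite lee_fin.
  - by move=> i _; rewrite lee_fin.
rewrite (rsum_sub (fp0 f) (fn0 f) (sfp sf) (sfn sf)).
rewrite (rsum_sub (fp0 g) (fn0 g) (sfp sg) (sfn sg)).
rewrite (rsum_sub (g := fun t => fp f t + fp g t) (h := fun t => fn f t + fn g t)).
- rewrite (split2 _ _ (fp0 f) (fp0 g) (sfp sf) (sfp sg)).
  by rewrite (split2 _ _ (fn0 f) (fn0 g) (sfn sf) (sfn sg)) opprD addrACA.
- by move=> t; rewrite addr_ge0.
- by move=> t; rewrite addr_ge0.
- by apply: rsummableD; exact: sfp.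
- by apply: rsummableD; exact: sfn.
Qed.

Lemma rsumN f : rsummable f -> rsum (fun t => - f t) = - rsum f.
Proof.
move=> sf.
have -> : rsum f = rsum (fun t => fp f t - fn f t) by apply: eq_rsum => t; exact: fpn.
have -> : rsum (fun t => - f t) = rsum (fun t => fn f t - fp f t).
  by apply: eq_rsum => t; rewrite {1}(fpn f) opprB.
rewrite (rsum_sub (fp0 f) (fn0 f) (sfp sf) (sfn sf)).
by rewrite (rsum_sub (fn0 f) (fp0 f) (sfn sf) (sfp sf)) opprB.
Qed.

Lemma esumZ (c : R) f : 0 < c -> (forall t, 0 <= f t) ->
  (\esum_(t in setT) (c * f t)%:E = c%:E * \esum_(t in setT) (f t)%:E)%E.
Proof.
have le (c' : R) g : 0 < c' -> (forall t, 0 <= g t) ->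
  (\esum_(t in setT) (c' * g t)%:E <= c'%:E * \esum_(t in setT) (g t)%:E)%E.
  move=> c0 g0; rewrite ge_ereal_sup // => _ [A [finA _] <-].
  rewrite (_ : (\sum_(x \in A) _)%E = (c'%:E * \sum_(x \in A) (g x)%:E)%E); last first.
    rewrite !fsbig_finite //= ge0_sume_distrr // => i _; by rewrite lee_fin.
  apply: lee_wpmul2l; first by rewrite lee_fin ltW.
  by apply: ereal_sup_ubound; exists A.
move=> c0 f0; apply/eqP; rewrite eq_le le //=.
have ci : 0 < c^-1 by rewrite invr_gt0.
have := le c^-1 (fun t => c * f t) ci (fun t => mulr_ge0 (ltW c0) (f0 t)).
rewrite (eq_esum (b := fun t => (f t)%:E)); last first.
  by move=> t _; rewrite mulrA mulVf ?gt_eqF // mul1r.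
move=> H; rewrite (le_trans (lee_wpmul2l _ H)) ?lee_fin ?(ltW c0) //.
by rewrite muleA -EFinM mulfV ?gt_eqF // mul1e.
Qed.

Lemma rsummableZ (c : R) f : rsummable f -> rsummable (fun t => c * f t).
Proof.
have [->|c0] := eqVneq c 0.
  by move=> _; rewrite /rsummable /summable esum1 // => t _ /=; rewrite mul0r normr0.
have c0' : 0 < `|c| by rewrite normr_gt0.
rewrite /rsummable /summable => sf.
rewrite (eq_esum (b := fun t => (`|c| * `|f t|)%:E)); last by move=> t _ /=; rewrite normrM.
by rewrite esumZ // lte_mul_pinfty ?lee_fin.
Qed.

Lemma rsumZ (c : R) f : rsummable f -> rsum (fun t => c * f t) = c * rsum f.
Proof.
have pos (c' : R) : 0 < c' -> rsummable f -> rsum (fun t => c' * f t) = c' * rsum f.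
  move=> c0 sf.
  have -> : rsum f = rsum (fun t => fp f t - fn f t) by apply: eq_rsum => t; exact: fpn.
  have -> : rsum (fun t => c' * f t) = rsum (fun t => c' * fp f t - c' * fn f t).
    by apply: eq_rsum => t; rewrite {1}(fpn f) mulrBr.
  rewrite (rsum_sub (fp0 f) (fn0 f) (sfp sf) (sfn sf)).
  rewrite (rsum_sub (g := fun t => c' * fp f t) (h := fun t => c' * fn f t)).
  - rewrite (esumZ c0 (fp0 f)) (esumZ c0 (fn0 f)) !fineM //.
    + by rewrite mulrBr.
    + exact: esum_fin_num (fn0 f) (sfn sf).
    + exact: esum_fin_num (fp0 f) (sfp sf).
  - by move=> t; rewrite mulr_ge0 // ltW.
  - by move=> t; rewrite mulr_ge0 // ltW.
  - exact/rsummableZ/sfp.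
  - exact/rsummableZ/sfn.
move=> sf; case: (ltgtP c 0) => [c0|c0|->].
- have -> : rsum (fun t => c * f t) = rsum (fun t => - ((- c) * f t)).
    by apply: eq_rsum => t; rewrite mulNr opprK.
  rewrite rsumN ?pos ?oppr_gt0 //; last exact: rsummableZ.
  by rewrite mulNr opprK.
- exact: pos.
- rewrite mul0r (eq_rsum (g := fun=> 0)); last by move=> t; rewrite mul0r.
  by rewrite rsum_nonneg // esum1.
Qed.

Lemma rsum_ge0 f : (forall t, 0 <= f t) -> 0 <= rsum f.
Proof.
move=> f0; rewrite rsum_nonneg // fine_ge0 // esum_ge0 // => t _.
by rewrite lee_fin.
Qed.

Lemma rsum_le f g : rsummable f -> rsummable g -> (forall t, f t <= g t) ->
  rsum f <= rsum g.
Proof.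
move=> sf sg fg; rewrite -subr_ge0 -rsumN // -rsumD //.
  by apply: rsum_ge0 => t; rewrite subr_ge0.
by apply: rsummable_le sf => t; rewrite normrN.
Qed.

Lemma rsum_ge_term f t : rsummable f -> (forall t, 0 <= f t) -> f t <= rsum f.
Proof.
move=> sf f0; rewrite rsum_nonneg // -lee_fin fineK ?esum_fin_num //.
apply: esum_ge; exists [set t]; first by split.
by rewrite fsbig_set1.
Qed.

Lemma rsummable_bij (e e' : T -> T) f : cancel e e' -> cancel e' e ->
  rsummable f -> rsummable (fun t => f (e t)).
Proof.
move=> eK e'K; rewrite /rsummable /summable.
rewrite (@reindex_esum _ _ _ setT setT e) //.
split=> // [t t' _ _ /(can_inj eK)//|t _]; exists (e' t) => //.
Qed.

Lemma rsum_bij (e e' : T -> T) f : cancel e e' -> cancel e' e ->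
  rsum (fun t => f (e t)) = rsum f.
Proof.
move=> eK e'K; have bij : set_bij setT setT e.
  by split=> // [t t' _ _ /(can_inj eK)//|t _]; exists (e' t).
rewrite /rsum; congr (fine _ - fine _).
  rewrite [RHS](@reindex_esum R _ _ _ _ e _ bij).
  by apply: eq_esum => t _; rewrite !funeposE.
rewrite [RHS](@reindex_esum R _ _ _ _ e _ bij).
by apply: eq_esum => t _; rewrite !funenegE.
Qed.

Lemma rsummable_delta (a : R) (t0 : T) : rsummable (fun t => (t == t0)%:R * a).
Proof.
rewrite /rsummable /summable (esumID [set t0]) //.
rewrite setTI esum_set1 // [X in (_ + X)%E]esum1 ?adde0 ?ltry //.
by move=> t [_ /eqP/negbTE tt0] /=; rewrite tt0 mul0r normr0.
Qed.

Lemma rsum_delta (a : R) (t0 : T) : rsum (fun t : T => (t == t0)%:R * a) = a.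
Proof.
rewrite (eq_rsum (g := fun t : T => a * (t == t0)%:R)); last by move=> t; rewrite mulrC.
rewrite rsumZ; last first.
  by have := rsummable_delta 1 t0; congr rsummable; apply/funext => t; rewrite mulr1.
rewrite rsum_nonneg // (esumID [set t0]) // !setTI.
rewrite esum_set1 ?lee_fin // eqxx esum1 ?adde0 /= ?mulr1 //.
by move=> t /eqP/negbTE tt0 /=; rewrite tt0.
Qed.

End RealSums.

Section Modulus.
Context (R : rcfType).
Local Notation C := R[i].
Definition modsq (z : C) : R := (Normc.normc z) ^+ 2.

Lemma modsqE (z : C) : modsq z = complex.Re z ^+ 2 + complex.Im z ^+ 2.
Proof. by case: z => a b; rewrite /modsq /= sqr_sqrtr // addr_ge0 // sqr_ge0. Qed.
Lemma modsq_ge0 (z : C) : 0 <= modsq z. Proof. by rewrite sqr_ge0. Qed.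
Lemma modsqM (z w : C) : modsq (z * w) = modsq z * modsq w.
Proof. by rewrite /modsq Normc.normcM exprMn. Qed.
Lemma modsqD (z w : C) : modsq (z + w) <= 2 * modsq z + 2 * modsq w.
Proof.
rewrite !modsqE; case: z => a b; case: w => c e /=.
have := sqr_ge0 (a - c); have := sqr_ge0 (b - e); rewrite !expr2; lra.
Qed.
Lemma modsqN (z : C) : modsq (- z) = modsq z.
Proof. by rewrite !modsqE; case: z => a b /=; rewrite !sqrrN. Qed.
Lemma modsq_eq0 (z : C) : modsq z = 0 -> z = 0.
Proof. by move=> /eqP; rewrite sqrf_eq0 => /eqP/Normc.eq0_normc. Qed.
Lemma mul_conj_modsq (z : C) : z * (z^*)%C = (modsq z)%:C%C.
Proof. by rewrite modsqE; case: z => a b /=; simpc; rewrite !expr2; congr (_ +i* _)%C; lra. Qed.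
Lemma Re_conj_mul_le (z w : C) : `|complex.Re (z * (w^*)%C)| <= modsq z + modsq w.
Proof.
rewrite !modsqE; case: z => a b; case: w => c e /=; rewrite ler_norml.
have := sqr_ge0 (a - c); have := sqr_ge0 (b - e).
have := sqr_ge0 (a + c); have := sqr_ge0 (b + e); rewrite !expr2.
have := sqr_ge0 a; have := sqr_ge0 b; have := sqr_ge0 c; have := sqr_ge0 e.
by rewrite !expr2 => *; apply/andP; split; lra.
Qed.
Lemma Im_conj_mul_le (z w : C) : `|complex.Im (z * (w^*)%C)| <= modsq z + modsq w.
Proof.
rewrite !modsqE; case: z => a b; case: w => c e /=; rewrite ler_norml.
have := sqr_ge0 (a - e); have := sqr_ge0 (b - c).
have := sqr_ge0 (a + e); have := sqr_ge0 (b + c); rewrite !expr2.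
have := sqr_ge0 a; have := sqr_ge0 b; have := sqr_ge0 c; have := sqr_ge0 e.
by rewrite !expr2 => *; apply/andP; split; lra.
Qed.
End Modulus.

Section ComplexSums.
Context (R : realType) (T : choiceType).
Local Notation C := R[i].
Implicit Types (f g : T -> C).

Definition csummable f := rsummable (fun t => complex.Re (f t)) /\
  rsummable (fun t => complex.Im (f t)).

Lemma eq_csum f g : f =1 g -> csum f = csum g.
Proof. by move=> /funext ->. Qed.

Lemma csummableD f g : csummable f -> csummable g -> csummable (fun t => f t + g t).
Proof.
move=> [f1 f2] [g1 g2]; split.
  apply: rsummable_le (rsummableD f1 g1) => t; by case: (f t); case: (g t).
apply: rsummable_le (rsummableD f2 g2) => t; by case: (f t); case: (g t).
Qed.

Lemma csumD f g : csummable f -> csummable g ->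
  csum (fun t => f t + g t) = csum f + csum g.
Proof.
move=> [f1 f2] [g1 g2]; rewrite /csum -!/(rsum _).
rewrite (eq_rsum (g := fun t => complex.Re (f t) + complex.Re (g t))); last first.
  by move=> t; case: (f t); case: (g t).
rewrite [X in (_ +i* X)%C](eq_rsum (g := fun t => complex.Im (f t) + complex.Im (g t))); last first.
  by move=> t; case: (f t); case: (g t).
by rewrite !rsumD.
Qed.

Lemma csummableZ (c : C) f : csummable f -> csummable (fun t => c * f t).
Proof.
case: c => a b [f1 f2]; split.
  have := rsummableD (rsummableZ a f1) (rsummableZ (- b) f2).
  by apply: rsummable_le => t; case: (f t) => u v /=; rewrite mulNr.
have := rsummableD (rsummableZ a f2) (rsummableZ b f1).
by apply: rsummable_le => t; case: (f t) => u v /=.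
Qed.

Lemma csumZ (c : C) f : csummable f -> csum (fun t => c * f t) = c * csum f.
Proof.
case: c => a b [f1 f2]; rewrite /csum.
rewrite (eq_rsum (g := fun t => a * complex.Re (f t) + (- b) * complex.Im (f t))); last first.
  by move=> t; case: (f t) => u v /=; rewrite mulNr.
rewrite [X in (_ +i* X)%C](eq_rsum
  (g := fun t => a * complex.Im (f t) + b * complex.Re (f t))); last first.
  by move=> t; case: (f t) => u v /=.
rewrite !rsumD; do ?[exact: rsummableZ]; rewrite !rsumZ //.
by rewrite mulNr.
Qed.

Lemma csum_conj f : csummable f -> csum (fun t => (f t)^*%C) = (csum f)^*%C.
Proof.
move=> [f1 f2]; rewrite /csum /=; congr (_ +i* _)%C.
  by apply: eq_rsum => t; case: (f t).
by rewrite -rsumN //; apply: eq_rsum => t; case: (f t).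
Qed.

Lemma csummable_sum (I : Type) (r : seq I) (P : pred I) (F : I -> T -> C) :
  (forall i, csummable (F i)) -> csummable (fun t => \sum_(i <- r | P i) F i t).
Proof.
move=> sF; elim: r => [|i r IH].
  rewrite (_ : (fun t => _) = (fun=> 0)); last first.
    by apply/funext => t; rewrite big_nil.
  by split; rewrite /rsummable /summable esum1 // => t _ /=; rewrite normr0.
rewrite (_ : (fun t => _) = (fun t => (if P i then F i t else 0) + \sum_(i <- r | P i) F i t)).
  apply: csummableD => //; case: (P i) => //.
  by split; rewrite /rsummable /summable esum1 // => t _ /=; rewrite normr0.
by apply/funext => t; rewrite big_cons; case: (P i); rewrite ?add0r.
Qed.

Lemma csum0 : csum (fun _ : T => 0 : C) = 0.
Proof.
rewrite /csum /= (eq_rsum (g := fun=> 0)) //.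
by rewrite rsum_nonneg // esum1.
Qed.

Lemma csum_sum (I : Type) (r : seq I) (P : pred I) (F : I -> T -> C) :
  (forall i, csummable (F i)) ->
  csum (fun t => \sum_(i <- r | P i) F i t) = \sum_(i <- r | P i) csum (F i).
Proof.
move=> sF; elim: r => [|i r IH].
  rewrite big_nil; apply: etrans csum0.
  by apply: eq_csum => t; rewrite big_nil.
rewrite big_cons -IH; case: ifP => Pi.
  rewrite -csumD //; last exact: csummable_sum.
  by apply: eq_csum => t; rewrite big_cons Pi.
by apply: eq_csum => t; rewrite big_cons Pi.
Qed.

Lemma csum_bij (e e' : T -> T) f : cancel e e' -> cancel e' e ->
  csum (fun t => f (e t)) = csum f.
Proof.
move=> eK e'K; rewrite /csum.
by rewrite (rsum_bij (fun t => complex.Re (f t)) eK e'K)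
           (rsum_bij (fun t => complex.Im (f t)) eK e'K).
Qed.

Lemma csum_delta (a : C) (t0 : T) : csum (fun t : T => (t == t0)%:R * a) = a.
Proof.
rewrite /csum; case: a => a b.
rewrite (eq_rsum (g := fun t : T => (t == t0)%:R * a)); last first.
  by move=> t; case: eqP => _ /=; rewrite ?mul1r ?mul0r /= ?subr0 ?mul1r ?mul0r ?subrr.
rewrite [X in (_ +i* X)%C](eq_rsum (g := fun t : T => (t == t0)%:R * b)); last first.
  by move=> t; case: eqP => _ /=; rewrite ?mul1r ?mul0r /= ?addr0 ?mul1r ?mul0r ?addr0.
by rewrite !rsum_delta.
Qed.

Lemma csummable_prod f g : rsummable (fun t => modsq (f t)) ->
  rsummable (fun t => modsq (g t)) -> csummable (fun t => f t * (g t)^*%C).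
Proof.
move=> sf sg; have sfg := rsummableD sf sg; split.
  apply: rsummable_le sfg => t; rewrite (le_trans (Re_conj_mul_le _ _)) //.
  by rewrite ler_norm.
apply: rsummable_le sfg => t; rewrite (le_trans (Im_conj_mul_le _ _)) //.
by rewrite ler_norm.
Qed.
End ComplexSums.

(** * Matrices acting on square-summable vectors *)

Section Hilbert.
Context (R : realType) (G : groupType) (d : nat).
Local Notation C := R[i].
Local Notation V := ('I_d -> G -> C).
Implicit Types (x y z : V).

Definition normsq x : R := \sum_i rsum (fun g => modsq (x i g)).

Lemma norm_modsq (c : C) : `|modsq c| = modsq c.
Proof. by rewrite ger0_norm // modsq_ge0. Qed.

Lemma l2D x y : l2 x -> l2 y -> l2 (fun i g => x i g + y i g).
Proof.
move=> lx ly i.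
apply: rsummable_le (rsummableD (rsummableZ 2 (lx i)) (rsummableZ 2 (ly i))) => g.
by rewrite norm_modsq (le_trans (modsqD _ _)) // ler_norm.
Qed.

Lemma l2Z (c : C) x : l2 x -> l2 (fun i g => c * x i g).
Proof.
move=> lx i; apply: rsummable_le (rsummableZ (modsq c) (lx i)) => g.
by rewrite -/(modsq (c * x i g)) modsqM.
Qed.

Lemma l2B x y : l2 x -> l2 y -> l2 (fun i g => x i g - y i g).
Proof.
move=> lx ly; have := l2D lx (l2Z (-1) ly).
by congr l2; apply/funext => i; apply/funext => g; rewrite mulN1r.
Qed.

Lemma csummable_l2 x y i : l2 x -> l2 y ->
  csummable (fun g => x i g * (y i g)^*%C).
Proof. by move=> lx ly; apply: csummable_prod; [exact: lx|exact: ly]. Qed.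

Lemma innerDl x y z : l2 x -> l2 y -> l2 z ->
  inner (fun i g => x i g + y i g) z = inner x z + inner y z.
Proof.
move=> lx ly lz; rewrite /inner -big_split /=; apply: eq_bigr => i _.
rewrite -csumD; do ?exact: csummable_l2.
by apply: eq_csum => g; rewrite mulrDl.
Qed.

Lemma innerZl (c : C) x y : l2 x -> l2 y ->
  inner (fun i g => c * x i g) y = c * inner x y.
Proof.
move=> lx ly; rewrite /inner mulr_sumr; apply: eq_bigr => i _.
rewrite -csumZ; last exact: csummable_l2.
by apply: eq_csum => g; rewrite mulrA.
Qed.

Lemma inner_conj x y : l2 x -> l2 y -> inner y x = (inner x y)^*%C.
Proof.
move=> lx ly; rewrite /inner; apply: etrans (esym (rmorph_sum (@conjc R) _ _ _)).
apply: eq_bigr => i _; apply: etrans (csum_conj (csummable_l2 i lx ly)).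
by apply: eq_csum => g; rewrite rmorphM /= conjcK mulrC.
Qed.

Lemma innerBl x y z : l2 x -> l2 y -> l2 z ->
  inner (fun i g => x i g - y i g) z = inner x z - inner y z.
Proof.
move=> lx ly lz; rewrite -[- inner y z]mulN1r -innerZl // -innerDl //; last exact: l2Z.
by rewrite /inner; apply: eq_bigr => i _; apply: eq_csum => g; rewrite mulN1r.
Qed.

Lemma inner_self x : l2 x -> inner x x = (normsq x)%:C%C.
Proof.
move=> lx; rewrite /inner /normsq rmorph_sum; apply: eq_bigr => i _.
rewrite /csum -[RHS]/(_ +i* 0)%C; congr (_ +i* _)%C.
  by apply: eq_rsum => g; rewrite mul_conj_modsq.
rewrite (eq_rsum (g := fun=> 0)); first by rewrite rsum_nonneg // esum1.
by move=> g; rewrite mul_conj_modsq.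
Qed.

Lemma normsq_ge0 x : 0 <= normsq x.
Proof. by apply: sumr_ge0 => i _; apply: rsum_ge0 => g; exact: modsq_ge0. Qed.

Lemma modsq_le_normsq x i g : l2 x -> modsq (x i g) <= normsq x.
Proof.
move=> lx; apply: le_trans (rsum_ge_term g (lx i) (fun g => modsq_ge0 _)) _.
rewrite /normsq (bigD1 i) //= lerDl sumr_ge0 // => j _.
by apply: rsum_ge0 => h; exact: modsq_ge0.
Qed.

Lemma normsq_eq0 x : l2 x -> normsq x = 0 -> forall i g, x i g = 0.
Proof.
move=> lx n0 i g; apply: modsq_eq0; apply/eqP; rewrite eq_le modsq_ge0 andbT.
by rewrite -n0 modsq_le_normsq.
Qed.

Lemma normsqD_le x y : l2 x -> l2 y ->
  normsq (fun i g => x i g + y i g) <= 2 * normsq x + 2 * normsq y.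
Proof.
move=> lx ly; rewrite /normsq !mulr_sumr -big_split /=; apply: ler_sum => i _.
rewrite -(rsumZ 2 (lx i)) -(rsumZ 2 (ly i)).
rewrite -(rsumD (rsummableZ 2 (lx i)) (rsummableZ 2 (ly i))).
apply: rsum_le; first exact: (l2D lx ly).
  exact: rsummableD (rsummableZ 2 (lx i)) (rsummableZ 2 (ly i)).
by move=> g; exact: modsqD.
Qed.

Lemma normsqB x y : l2 x -> l2 y ->
  normsq (fun i g => x i g - y i g) = normsq x + normsq y - 2 * complex.Re (inner x y).
Proof.
move=> lx ly; apply: (@complexI R); rewrite -inner_self; last exact: l2B.
have lxy := l2B lx ly.
rewrite innerBl // (inner_conj lxy lx) (inner_conj lxy ly) !innerBl //.
rewrite (inner_conj lx ly) !inner_self // !rmorphB rmorphD rmorphM /=.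
case: (inner x y) => a b; simpc; congr (_ +i* _)%C; rewrite /=; lra.
Qed.

Lemma normsqZ (c : C) x : l2 x -> normsq (fun i g => c * x i g) = modsq c * normsq x.
Proof.
move=> lx; rewrite /normsq mulr_sumr; apply: eq_bigr => i _.
by rewrite -(rsumZ _ (lx i)); apply: eq_rsum => g; rewrite modsqM.
Qed.

(** A form of the Cauchy-Schwarz inequality without square roots: with [s]
    small and [x] tending to 0 it shows that the inner product tends to 0. *)
Lemma Re_inner_le x y (s : R) : 0 < s -> l2 x -> l2 y ->
  2 * `|complex.Re (inner x y)| <= s^-1 * normsq x + s * normsq y.
Proof.
move=> s0 lx ly.
have key (u : R) : u ^+ 2 = s ^+ 2 ->
    2 * u * complex.Re (inner x y) <= normsq x + s ^+ 2 * normsq y.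
  move=> us; have lu := l2Z (u%:C%C) ly.
  have := normsq_ge0 (fun i g => x i g - u%:C%C * y i g).
  rewrite normsqB // normsqZ // (inner_conj lu lx) innerZl // (inner_conj lx ly).
  rewrite (_ : modsq u%:C%C = s ^+ 2); last by rewrite modsqE /= us expr0n addr0.
  case: (inner x y) => a b /=; rewrite mulrN !mul0r oppr0 => ?; lra.
have si : 0 < s^-1 by rewrite invr_gt0.
have e : s^-1 * s = 1 by rewrite mulVf // gt_eqF.
rewrite -(ler_pM2l s0) mulrDr !mulrA mulfV ?gt_eqF // mul1r -expr2.
have := key s (erefl _); have := key (- s) (sqrrN s).
case: (ger0P (complex.Re (inner x y))) => _; lra.
Qed.

Section Operator.
Context (AA : seq C) (N : nat) (al k : R).
Hypotheses (al0 : 0 <= al) (AAal : {in AA, forall a, `|a| <= al%:C%C}).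
Hypotheses (k0 : 0 < k) (kN : (N%:R * al) ^+ 2 <= k).
Implicit Types A : seq (term R 'I_d G).
Local Notation mulG := (fun g h : G => (g * h)%g).

Lemma modsq_le (a : C) (b : R) : 0 <= b -> `|a| <= b%:C%C -> modsq a <= b ^+ 2.
Proof.
move=> b0 ab; have {ab} : Normc.normc a <= b by rewrite -lecR.
by move=> ab; rewrite /modsq lerXn2r // nnegrE; case: a ab => u v _; exact: sqrtr_ge0.
Qed.

Lemma modsq_sum_le (I : Type) (r : seq I) (P : pred I) (F : I -> C) (n : nat) :
  (count P r <= n)%N ->
  modsq (\sum_(i <- r | P i) F i) <= n%:R * \sum_(i <- r | P i) modsq (F i).
Proof.
move=> cn; apply: (le_trans (y := (count P r)%:R * \sum_(i <- r | P i) modsq (F i))); last first.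
  rewrite ler_wpM2r ?ler_nat // sumr_ge0 // => i _; exact: modsq_ge0.
elim: r {cn} => [|i r IH] /=.
  by rewrite !big_nil mul0r modsqE /= expr0n addr0.
rewrite !big_cons; case: (P i) => //=.
set S := \sum_(_ <- _ | _) _ in IH *; set Q := \sum_(_ <- _ | _) _ in IH *.
have Q0 : 0 <= Q by apply: sumr_ge0 => j _; exact: modsq_ge0.
have [c0|c0] := posnP (count P r).
  have -> : S = 0.
    by apply: modsq_eq0; apply/eqP; rewrite eq_le modsq_ge0 andbT (le_trans IH) // c0 mul0r.
  by rewrite c0 addr0 mul1r lerDl.
move: IH; move: (count P r) c0 => m m0; rewrite add1n -natr1.
have m0' : 0 < m%:R :> R by rewrite ltr0n.
move: (m%:R) m0' => {m0}m m0 IH.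
rewrite modsqE; move: IH; rewrite modsqE [in X in _ -> _ <= X](modsqE (F i)).
case: (F i) => a b; case: S => c e /= IH.
have h1 := sqr_ge0 (m * a - c); have h2 := sqr_ge0 (m * b - e).
rewrite -(ler_pM2l m0); move: h1 h2; rewrite !expr2 in IH * => h1 h2.
have : m * (c * c + e * e) + (c * c + e * e) <= m * (m * Q) + m * Q.
  by rewrite lerD // ler_pM2l.
lra.
Qed.

Definition bounded_rows A :=
  [/\ forall t, t \in A -> `|tcf t| <= al%:C%C,
      forall i, (count (fun t => trow t == i) A <= N)%N
    & forall i, (count (fun t => tcol t == i) A <= N)%N].

Lemma bounded_adm A : admissible AA N A -> bounded_rows A.
Proof. by case=> c r l; split=> // t /c; exact: AAal. Qed.

Lemma bounded_adj A : bounded_rows A -> bounded_rows (fadj A).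
Proof.
case=> c r l; split.
- by move=> t /mapP[u uA ->]; rewrite /tcf /= normcJ; exact: c.
- by move=> i; rewrite count_map; exact: l.
- by move=> i; rewrite count_map; exact: r.
Qed.

Lemma shiftK (g : G) : cancel (fun h => (g^-1 * h)%g) (fun h => (g * h)%g).
Proof. by move=> h; rewrite mulgA mulgV mul1g. Qed.
Lemma shiftVK (g : G) : cancel (fun h => (g * h)%g) (fun h => (g^-1 * h)%g).
Proof. by move=> h; rewrite mulgA mulVg mul1g. Qed.

Lemma rsum_sum (T : choiceType) (I : Type) (r : seq I) (P : pred I) (F : I -> T -> R) :
  (forall i, rsummable (F i)) ->
  rsummable (fun t => \sum_(i <- r | P i) F i t) /\
  rsum (fun t => \sum_(i <- r | P i) F i t) = \sum_(i <- r | P i) rsum (F i).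
Proof.
move=> sF; elim: r => [|i r [IH1 IH2]].
  have E : (fun t => \sum_(i <- [::] | P i) F i t) = (fun=> 0).
    by apply/funext => t; rewrite big_nil.
  rewrite E big_nil; split; last by rewrite rsum_nonneg // esum1.
  by rewrite /rsummable /summable esum1 // => t _ /=; rewrite normr0.
rewrite big_cons; case Pi: (P i).
  have E : (fun t => \sum_(j <- i :: r | P j) F j t) =
           (fun t => F i t + \sum_(j <- r | P j) F j t).
    by apply/funext => t; rewrite big_cons Pi.
  by rewrite E rsumD // IH2; split=> //; apply: rsummableD.
have -> : (fun t => \sum_(j <- i :: r | P j) F j t) =
         (fun t => \sum_(j <- r | P j) F j t).
  by apply/funext => t; rewrite big_cons Pi.
by [].
Qed.

(** Cauchy-Schwarz in each row, then exchange of sums: every entry of [x] is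
    used at most [N] times, because the columns have at most [N] terms. *)
Lemma act_bound A x : bounded_rows A -> l2 x ->
  l2 (act mulG A x) /\ normsq (act mulG A x) <= k * normsq x.
Proof.
move=> [cA rA lA] lx.
have pt i g : modsq (act mulG A x i g) <=
    N%:R * al ^+ 2 * \sum_(t <- A | trow t == i) modsq (x (tcol t) ((tlab t)^-1 * g)%g).
  rewrite /act (le_trans (modsq_sum_le _ (rA i))) // -mulrA ler_wpM2l // mulr_sumr.
  rewrite big_seq_cond [leRHS]big_seq_cond; apply: ler_sum => t /andP[tA _].
  by rewrite modsqM ler_wpM2r ?modsq_ge0 // modsq_le // cA.
have sh (t : term R 'I_d G) : rsummable (fun g => modsq (x (tcol t) ((tlab t)^-1 * g)%g)).
  exact: (rsummable_bij (shiftK (tlab t)) (shiftVK (tlab t)) (lx (tcol t))).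
have sumE i := rsum_sum A (fun t => trow t == i) sh.
have c0 : 0 <= N%:R * al ^+ 2 by rewrite mulr_ge0 // sqr_ge0.
have lA' : l2 (act mulG A x).
  move=> i; apply: rsummable_le (rsummableZ (N%:R * al ^+ 2) (sumE i).1) => g.
  by rewrite norm_modsq (le_trans (pt i g)) // ler_norm.
split=> //.
apply: (le_trans (y := N%:R * al ^+ 2 * (N%:R * normsq x))); last first.
  rewrite mulrA ler_wpM2r ?normsq_ge0 // (le_trans _ kN) // exprMn.
  by rewrite -mulrA [al ^+ 2 * _]mulrC mulrA -expr2.
apply: (le_trans (y := \sum_i N%:R * al ^+ 2 * rsum (fun g =>
   \sum_(t <- A | trow t == i) modsq (x (tcol t) ((tlab t)^-1 * g)%g)))).
  apply: ler_sum => i _; rewrite -rsumZ; last exact: (sumE i).1.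
  apply: rsum_le; [exact: lA' | exact: rsummableZ (sumE i).1 | exact: pt].
rewrite -mulr_sumr ler_wpM2l //.
under eq_bigr do rewrite (sumE _).2.
under eq_bigr => i _ do under eq_bigr => t _ do
  rewrite (rsum_bij (fun g => modsq (x (tcol t) g)) (shiftK (tlab t)) (shiftVK (tlab t))).
rewrite -(partition_big (fun t : term R 'I_d G => trow t) xpredT (P := xpredT)
   (F := fun t => rsum (fun g => modsq (x (tcol t) g)))) //=.
rewrite (partition_big (fun t : term R 'I_d G => tcol t) xpredT) //=.
rewrite /normsq mulr_sumr; apply: ler_sum => j _.
rewrite (eq_bigr (fun=> rsum (fun g => modsq (x j g)))); last by move=> t /eqP ->.
rewrite big_const_seq iter_addr_0 -[_ *+ _]mulr_natl ler_wpM2r ?ler_nat //.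
by apply: rsum_ge0 => g; exact: modsq_ge0.
Qed.

Lemma act_adjoint A x y : l2 x -> l2 y ->
  inner (act mulG A x) y = inner x (act mulG (fadj A) y).
Proof.
move=> lx ly; rewrite /inner.
have shx (t : term R 'I_d G) : rsummable (fun g => modsq (x (tcol t) ((tlab t)^-1 * g)%g)).
  exact: (rsummable_bij (shiftK (tlab t)) (shiftVK (tlab t)) (lx (tcol t))).
have shy (t : term R 'I_d G) : rsummable (fun g => modsq (y (trow t) (tlab t * g)%g)).
  exact: (rsummable_bij (shiftVK (tlab t)) (shiftK (tlab t)) (ly (trow t))).
transitivity (\sum_(t <- A) csum (fun g => tcf t *
   (x (tcol t) ((tlab t)^-1 * g)%g * (y (trow t) g)^*%C))).
  rewrite (partition_big (fun t : term R 'I_d G => trow t) xpredT) //=.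
  apply: eq_bigr => i _; rewrite -csum_sum; last first.
    by move=> t; apply: csummableZ; apply: csummable_prod (shx t) (ly _).
  apply: eq_csum => g; rewrite /act mulr_suml; apply: eq_bigr => t /eqP <-.
  by rewrite mulrA.
transitivity (\sum_(t <- A) csum (fun g => tcf t *
   (x (tcol t) g * (y (trow t) (tlab t * g)%g)^*%C))).
  apply: eq_bigr => t _.
  rewrite -(csum_bij (fun g => tcf t * (x (tcol t) g * (y (trow t) (tlab t * g)%g)^*%C))
    (shiftK (tlab t)) (shiftVK (tlab t))).
  by apply: eq_csum => g; rewrite shiftK.
rewrite (partition_big (fun t : term R 'I_d G => tcol t) xpredT) //=.
apply: eq_bigr => j _; rewrite -csum_sum; last first.
  by move=> t; apply: csummableZ; apply: csummable_prod (lx _) (shy t).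
apply: eq_csum => g; rewrite act_adj rmorph_sum mulr_sumr /=.
apply: eq_bigr => t /eqP <-.
by rewrite rmorphM /= conjcK mulrCA.
Qed.
End Operator.
End Hilbert.

(** * Completeness of l2(G)^d *)

Section FiniteSums.
Context (R : realType) (T : choiceType).
Implicit Types f : T -> R.

Lemma finite_sum_le_rsum f (r : seq T) : uniq r -> (forall t, 0 <= f t) ->
  rsummable f -> \sum_(t <- r) f t <= rsum f.
Proof.
move=> ur f0 sf; rewrite rsum_nonneg // -lee_fin fineK ?esum_fin_num //.
apply: esum_ge; exists [set` r]; first by split; first exact: finite_seq.
by rewrite -fsbig_seq //= sumEFin.
Qed.

Lemma rsum_le_of_finite f (b : R) : (forall t, 0 <= f t) ->
  (forall r : seq T, uniq r -> \sum_(t <- r) f t <= b) -> rsummable f /\ rsum f <= b.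
Proof.
move=> f0 fb.
have le : (\esum_(t in setT) (f t)%:E <= b%:E)%E.
  rewrite ge_ereal_sup // => _ [A [finA _] <-].
  by rewrite fsbig_finite //= sumEFin lee_fin fb // fset_uniq.
have sf : rsummable f.
  rewrite /rsummable /summable (eq_esum (b := fun t => (f t)%:E)).
    by rewrite (le_lt_trans le) // ltry.
  by move=> t _ /=; rewrite ger0_norm.
by split=> //; rewrite rsum_nonneg // -lee_fin fineK ?esum_fin_num.
Qed.
End FiniteSums.

Section Completeness.
Context (R : realType) (G : groupType) (d : nat).
Local Notation C := R[i].
Local Notation V := ('I_d -> G -> C).

Lemma real_cauchy_lim (v : nat -> R) :
  (forall eps, 0 < eps -> exists M, forall m n, (M <= m)%N -> (M <= n)%N ->
     `|v m - v n| <= eps) ->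
  exists l, forall eps, 0 < eps -> exists M, forall m, (M <= m)%N -> `|v m - l| <= eps.
Proof.
move=> cv; have : cvg (v @ \oo).
  apply/cauchy_cvgP/cauchy_exP => eps eps0.
  have e2 : 0 < eps / 2 by rewrite divr_gt0.
  have [M MP] := cv _ e2; exists (v M); exists M => // m /= Mm.
  rewrite /ball /= (le_lt_trans (MP _ _ (leqnn M) Mm)) //.
  by rewrite ltr_pdivrMr // mulr_natr mulr2n ltrDl.
move=> /cvgrPdist_le vl; exists (lim (v @ \oo)) => eps eps0.
have [M _ MP] := vl _ eps0; exists M => m Mm.
by rewrite distrC; apply: MP.
Qed.

Lemma complex_cauchy_lim (v : nat -> C) :
  (forall eps, 0 < eps -> exists M, forall m n, (M <= m)%N -> (M <= n)%N ->
     modsq (v m - v n) <= eps) ->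
  exists l, forall eps, 0 < eps -> exists M, forall m, (M <= m)%N -> modsq (v m - l) <= eps.
Proof.
move=> cv.
have sqle (a e : R) : 0 < e -> a ^+ 2 <= e ^+ 2 -> `|a| <= e.
  move=> e0; rewrite -(real_normK (num_real a)) => h.
  by rewrite -(@ler_pXn2r _ 2) // nnegrE // ltW.
have [|a aP] := @real_cauchy_lim (fun m => complex.Re (v m)).
  move=> eps e0; have [M MP] := cv _ (exprn_gt0 2 e0); exists M => m n Mm Mn.
  apply: sqle => //; apply: le_trans (MP _ _ Mm Mn); rewrite modsqE.
  by case: (v m) => ? ?; case: (v n) => ? ? /=; rewrite lerDl sqr_ge0.
have [|b bP] := @real_cauchy_lim (fun m => complex.Im (v m)).
  move=> eps e0; have [M MP] := cv _ (exprn_gt0 2 e0); exists M => m n Mm Mn.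
  apply: sqle => //; apply: le_trans (MP _ _ Mm Mn); rewrite modsqE.
  by case: (v m) => ? ?; case: (v n) => ? ? /=; rewrite lerDr sqr_ge0.
exists (a +i* b)%C => eps e0.
(* The bound by 1 gives [e1 ^ 2 <= e1], hence [2 * e1 ^ 2 <= eps]. *)
pose e1 := Num.min 1 (eps / 2); have e10 : 0 < e1 by rewrite lt_min ltr01 divr_gt0.
have e1e : 2 * e1 ^+ 2 <= eps.
  have e11 : e1 <= 1 by rewrite ge_min lexx.
  have e12 : e1 <= eps / 2 by rewrite ge_min lexx orbT.
  have := ler_wpM2r (ltW e10) e11; rewrite expr2; lra.
have [M MP] := aP _ e10; have [M' MP'] := bP _ e10.
exists (maxn M M') => m; rewrite geq_max => /andP[Mm Mm'].
have := MP _ Mm; have := MP' _ Mm'; rewrite modsqE.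
case: (v m) => u w /= h1 h2; apply: le_trans e1e.
have s1 : (u - a) ^+ 2 <= e1 ^+ 2.
  by rewrite -(real_normK (num_real _)) lerXn2r ?nnegrE // ltW.
have s2 : (w - b) ^+ 2 <= e1 ^+ 2.
  by rewrite -(real_normK (num_real _)) lerXn2r ?nnegrE // ltW.
lra.
Qed.

(** Finite partial sums of the limit are approximated by those of a late term
    of the sequence. The factor 4 is the sum of 2 from the parallelogram
    inequality and 2 for the error of the approximation. *)
Lemma fatou_modsq (T : choiceType) (u y : T -> C) (a : nat -> T -> C) (M : nat) (e : R) :
  0 < e ->
  (forall n, (M <= n)%N -> rsummable (fun t => modsq (u t - a n t)) /\
     rsum (fun t => modsq (u t - a n t)) <= e) ->
  (forall t eps, 0 < eps -> exists M, forall m, (M <= m)%N -> modsq (a m t - y t) <= eps) ->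
  rsummable (fun t => modsq (u t - y t)) /\ rsum (fun t => modsq (u t - y t)) <= 4 * e.
Proof.
move=> e0 ua ay; apply: rsum_le_of_finite => [t|r ur]; first exact: modsq_ge0.
pose eta := e / (size r).+1%:R.
have eta0 : 0 < eta by rewrite divr_gt0.
have [n [Mn nP]] : exists n, (M <= n)%N /\ forall t, t \in r -> modsq (a n t - y t) <= eta.
  have : exists n0, forall n, (n0 <= n)%N -> forall t, t \in r -> modsq (a n t - y t) <= eta.
    elim: r {ur} eta eta0 => [|t r IH] eta eta0; first by exists 0%N.
    have [n1 P1] := IH _ eta0; have [n2 P2] := ay t _ eta0.
    exists (maxn n1 n2) => n; rewrite geq_max => /andP[n1n n2n] s.
    by rewrite inE => /orP[/eqP ->|sr]; [exact: P2|exact: P1].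
  by move=> [n0 P0]; exists (maxn M n0); split=> [|t]; [exact: leq_maxl|apply: P0; exact: leq_maxr].
have [sn ln] := ua _ Mn.
have tri t : t \in r -> modsq (u t - y t) <= 2 * modsq (u t - a n t) + 2 * eta.
  move=> tr; rewrite (_ : u t - y t = (u t - a n t) + (a n t - y t)); last by rewrite addrA subrK.
  by rewrite (le_trans (modsqD _ _)) // lerD2l ler_pM2l // nP.
rewrite big_seq (le_trans (ler_sum _ tri)) // -big_seq big_split /= -mulr_sumr.
rewrite big_const_seq count_predT iter_addr_0.
have := finite_sum_le_rsum ur (fun t => modsq_ge0 _) sn => h1.
have h2 : 2 * eta *+ size r <= 2 * e.
  rewrite -mulrnAr ler_pM2l // /eta -mulr_natr mulrAC ler_pdivrMr ?ltr0n //.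
  by rewrite ler_pM2l // ler_nat.
lra.
Qed.

Lemma l2_complete (u : nat -> V) : (forall n, l2 (u n)) ->
  (forall eps, 0 < eps -> exists M, forall m n, (M <= m)%N -> (M <= n)%N ->
     normsq (fun i g => u m i g - u n i g) <= eps) ->
  exists2 y : V, l2 y & forall eps, 0 < eps -> exists M, forall m, (M <= m)%N ->
     normsq (fun i g => u m i g - y i g) <= eps.
Proof.
move=> lu cu.
have /choice[y0 y0P] : forall ig : 'I_d * G, exists l, forall eps, 0 < eps -> exists M,
    forall m, (M <= m)%N -> modsq (u m ig.1 ig.2 - l) <= eps.
  move=> [i g]; apply: complex_cauchy_lim => eps e0.
  have [M MP] := cu _ e0; exists M => m n Mm Mn; apply: le_trans (MP _ _ Mm Mn).
  exact: (modsq_le_normsq i g (l2B (lu m) (lu n))).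
pose y : V := fun i g => y0 (i, g).
have close eps : 0 < eps -> exists M, forall m, (M <= m)%N -> forall i,
    rsummable (fun g => modsq (u m i g - y i g)) /\
    rsum (fun g => modsq (u m i g - y i g)) <= 4 * eps.
  move=> e0; have [M MP] := cu _ e0; exists M => m Mm i.
  apply: (@fatou_modsq _ (u m i) (y i) (fun n => u n i) M) => // [n Mn|g]; last exact: (y0P (i, g)).
  split; first exact: (l2B (lu m) (lu n)).
  apply: le_trans (MP _ _ Mm Mn); rewrite /normsq (bigD1 i) //= lerDl sumr_ge0 // => j _.
  by apply: rsum_ge0 => g; exact: modsq_ge0.
have ly : l2 y.
  have [M MP] := close 1 ltr01 => //.
  have lb : l2 (fun i g => u M i g - y i g) by move=> i; exact: (MP M (leqnn M) i).1.
  have := l2B (lu M) lb; congr l2; apply/funext => i; apply/funext => g.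
  by rewrite subKr.
exists y => // eps e0.
have e1 : 0 < eps / d.+1%:R / 4 by rewrite !divr_gt0.
have [M MP] := close _ e1; exists M => m Mm.
apply: (le_trans (y := \sum_(i < d) 4 * (eps / d.+1%:R / 4))).
  by apply: ler_sum => i _; exact: (MP m Mm i).2.
rewrite sumr_const card_ord mulrC divfK // -[_ *+ d]mulr_natr mulrAC.
by rewrite ler_pdivrMr ?ltr0n // ler_pM2l // ler_nat.
Qed.
End Completeness.

(** * The kernel dimension as the infimum of the moments *)

Lemma leq_double_self n : (n <= n.*2)%N. Proof. by rewrite -addnn leq_addr. Qed.

Section Kernel.
Context (R : realType) (G : groupType) (d : nat).
Local Notation C := R[i].
Local Notation V := ('I_d -> G -> C).
Context (AA : seq C) (N : nat) (al k : R).
Hypotheses (al0 : 0 <= al) (AAal : {in AA, forall a, `|a| <= al%:C%C}).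
Hypotheses (k0 : 0 < k) (kN : (N%:R * al) ^+ 2 <= k).
Context (A : seq (term R 'I_d G)) (adm : admissible AA N A).
Local Notation mulG := (fun g h : G => (g * h)%g).
Local Notation opA := (act mulG A).
Local Notation opA' := (act mulG (fadj A)).
Local Notation T := (gap mulG k A).
Implicit Types x y v : V.

Let bA : bounded_rows N al A := bounded_adm AAal adm.
Let bA' : bounded_rows N al (fadj A) := bounded_adj bA.
Let lA x : l2 x -> l2 (opA x).
Proof. by move=> lx; have [] := act_bound al0 kN bA lx. Qed.
Let lA' x : l2 x -> l2 (opA' x).
Proof. by move=> lx; have [] := act_bound al0 kN bA' lx. Qed.

Lemma gap_l2 x : l2 x -> l2 (T x).
Proof. by move=> lx; apply: l2B => //; apply: l2Z; apply/lA'/lA. Qed.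

Lemma act_adj_inner x y : l2 x -> l2 y -> inner (opA' x) y = inner x (opA y).
Proof.
move=> lx ly; rewrite (inner_conj ly (lA' lx)) -act_adjoint //.
by rewrite -inner_conj //; exact: lA.
Qed.

Lemma gap_inner x y : l2 x -> l2 y ->
  inner (T x) y = inner x y - (k^-1)%:C%C * inner (opA x) (opA y).
Proof.
move=> lx ly; rewrite /gap innerBl //; last by apply: l2Z; apply/lA'/lA.
rewrite innerZl //; last by apply/lA'/lA.
by rewrite act_adj_inner //; exact: lA.
Qed.

Lemma gap_sym x y : l2 x -> l2 y -> inner (T x) y = inner x (T y).
Proof.
move=> lx ly; rewrite gap_inner //.
rewrite (inner_conj (gap_l2 ly) lx) gap_inner // rmorphB rmorphM /=.
by rewrite oppr0 -(inner_conj ly lx) -(inner_conj (lA ly) (lA lx)).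
Qed.

(** Expanding the square, the term of second order is bounded by [k^-1 *
    normsq (opA x)], because the adjoint is bounded by [k]; half of the term
    of first order remains. *)
Lemma gap_contract x : l2 x -> normsq (T x) <= normsq x - k^-1 * normsq (opA x).
Proof.
move=> lx; have lB := lA' (lA lx).
rewrite {1}/gap normsqB //; last exact: l2Z.
rewrite normsqZ // (inner_conj (l2Z _ lB) lx) innerZl // act_adj_inner //; last exact: lA.
rewrite inner_self; last exact: lA.
have [_ b] := act_bound al0 kN bA' (lA lx).
rewrite modsqE /= expr0n addr0 mul0r subr0.
have ki : 0 < k^-1 by rewrite invr_gt0.
have : k^-1 ^+ 2 * normsq (opA' (opA x)) <= k^-1 * normsq (opA x).
  rewrite expr2 -mulrA ler_wpM2l ?(ltW ki) //.
  by rewrite mulrC ler_pdivrMr // mulrC.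
lra.
Qed.

Lemma iter_l2 x n : l2 x -> l2 (iter n T x).
Proof. by move=> lx; elim: n => [|n IH] //; apply: gap_l2. Qed.

Lemma iter_sym x y n : l2 x -> l2 y ->
  inner (iter n T x) y = inner x (iter n T y).
Proof.
elim: n x y => [|n IH] x y lx ly //.
rewrite iterS (gap_sym (iter_l2 n lx) ly) (IH _ _ lx (gap_l2 ly)).
by rewrite -iterSr.
Qed.

Lemma gap_ker v : (forall i g, opA v i g = 0) -> T v = v.
Proof.
move=> kv; apply/funext => i; apply/funext => g; rewrite /gap.
rewrite (_ : opA' _ i g = 0) ?mulr0 ?subr0 //.
by rewrite act_adj big1 // => t _; rewrite kv mulr0.
Qed.

Lemma actB x y : opA (fun i g => x i g - y i g) = fun i g => opA x i g - opA y i g.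
Proof.
apply/funext => i; apply/funext => g; rewrite /act -sumrB.
by apply: eq_bigr => t _; rewrite mulrBr.
Qed.

Lemma normsqB_le x y : l2 x -> l2 y ->
  normsq (fun i g => x i g - y i g) <= 2 * normsq x + 2 * normsq y.
Proof.
move=> lx ly; have := normsqD_le lx (l2Z (-1) ly).
rewrite (_ : normsq (fun i g => -1 * y i g) = normsq y).
  by congr (normsq _ <= _); apply/funext => i; apply/funext => g; rewrite mulN1r.
by rewrite normsqZ // (modsqN 1) modsqE /= expr1n expr0n addr0 mul1r.
Qed.

Section Vector.
Context (e : V) (le : l2 e).
Let q m := normsq (iter m T e).
Let u m := iter m.*2 T e.

Let q_dec m : q m.+1 <= q m.
Proof.
rewrite /q iterS (le_trans (gap_contract (iter_l2 m le))) // lerBlDr lerDl.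
by rewrite mulr_ge0 ?invr_ge0 ?(ltW k0) // normsq_ge0.
Qed.

Let q_mono m n : (m <= n)%N -> q n <= q m.
Proof.
move=> /subnK <-; elim: (n - m)%N => [|j IH] //.
by rewrite addSn (le_trans (q_dec _)).
Qed.

Let inner_iter a b : inner (iter a T e) (iter b T e) = inner (iter (a + b) T e) e.
Proof. by rewrite addnC iterD (iter_sym _ (iter_l2 _ le) le). Qed.

(** Self-adjointness makes inner products of iterates depend only on the sum
    of the exponents; this is what turns convergence of the norms into
    convergence of the vectors. *)
Let inner_u m n : inner (u m) (u n) = (q (m + n))%:C%C.
Proof.
by rewrite /u inner_iter /q -(inner_self (iter_l2 (m + n) le)) inner_iter addnn doubleD.
Qed.

Let q_lim : exists l : R, (forall m, l <= q m) /\
  forall eps, 0 < eps -> exists M, forall m, (M <= m)%N -> q m <= l + eps.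
Proof.
have hi : has_inf (range q).
  split; first by exists (q 0%N); exists 0%N.
  by exists 0 => _ [m _ <-]; exact: normsq_ge0.
exists (inf (range q)); split=> [m|eps e0].
  by apply: ge_inf; [case: hi|exists m].
have [_ [M _ <-] qM] := inf_adherent e0 hi.
by exists M => m Mm; rewrite (le_trans (q_mono Mm)) // ltW.
Qed.

Let normsq_u m n : normsq (fun i g => u m i g - u n i g) = q m.*2 + q n.*2 - 2 * q (m + n).
Proof. by rewrite (normsqB (iter_l2 _ le) (iter_l2 _ le)) inner_u. Qed.

(** The norms of the iterates decrease, and the distance between two even
    iterates is a second difference of these norms, so that the even iterates
    form a Cauchy sequence. [gap_contract] puts the limit in the kernel.
    Vectors in the kernel are fixed by [T], so that [e] minus the limit is
    orthogonal to them. *)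
Lemma kernel_projection : exists y : V, [/\ l2 y, forall i g, opA y i g = 0,
  forall v, l2 v -> (forall i g, opA v i g = 0) ->
    inner (fun i g => e i g - y i g) v = 0,
  forall m, normsq y <= normsq (iter m T e) &
  forall eps, 0 < eps -> exists M, forall m, (M <= m)%N ->
     normsq (iter m T e) <= normsq y + eps].
Proof.
have [l [lq ql]] := q_lim.
have lu m : l2 (u m) by exact: iter_l2.
have [|y ly uy] := l2_complete lu.
  move=> eps e0; have [|M MP] := ql (eps / 2); first by rewrite divr_gt0.
  exists M => m n Mm Mn; rewrite normsq_u.
  have h1 := MP m.*2 (leq_trans Mm (leq_double_self m)).
  have h2 := MP n.*2 (leq_trans Mn (leq_double_self n)).
  have h3 := lq (m + n)%N; lra.
have Ay0 i g : opA y i g = 0.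
  apply: (normsq_eq0 (lA ly)); apply/eqP; rewrite eq_le normsq_ge0 andbT.
  apply/ler_addgt0Pr => eps e0; rewrite add0r.
  have e4 : 0 < eps / 4 by rewrite divr_gt0.
  have e4k : 0 < eps / 4 / k by rewrite divr_gt0.
  have [M MP] := uy _ e4k.
  have [|M' MP'] := ql (k^-1 * (eps / 4)); first by rewrite mulr_gt0 ?invr_gt0.
  pose m := maxn M M'.
  have uye := MP m (leq_maxl _ _).
  have Au : normsq (opA (u m)) <= eps / 4.
    have h1 := MP' m.*2 (leq_trans (leq_maxr _ _) (leq_double_self m)).
    have h2 := lq (m.*2).+1; have h3 := gap_contract (lu m).
    have ki : 0 < k^-1 by rewrite invr_gt0.
    rewrite -(ler_pM2l ki); move: h1 h2 h3; rewrite /q /u iterS; lra.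
  have Auy : normsq (opA (fun i g => u m i g - y i g)) <= eps / 4.
    have [_ b] := act_bound al0 kN bA (l2B (lu m) ly).
    rewrite (le_trans b) //.
    by rewrite (le_trans (ler_wpM2l (ltW k0) uye)) // mulrC divfK // gt_eqF.
  have -> : opA y = fun i g => opA (u m) i g - opA (fun i g => u m i g - y i g) i g.
    by rewrite actB; apply/funext => j; apply/funext => h; rewrite subKr.
  rewrite (le_trans (normsqB_le (lA (lu m)) (lA (l2B (lu m) ly)))) //; lra.
have iterv n v : l2 v -> (forall i g, opA v i g = 0) ->
    inner (iter n T e) v = inner e v.
  move=> lv kv; rewrite iter_sym //.
  by have -> : iter n T v = v by elim: n => // n IH; rewrite iterS IH gap_ker.
have perp v : l2 v -> (forall i g, opA v i g = 0) ->
    inner (fun i g => e i g - y i g) v = 0.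
  move=> lv kv; rewrite innerBl //.
  have E m : inner e v - inner y v = inner (fun i g => u m i g - y i g) v.
    by rewrite innerBl // iterv.
  have Re0 w : l2 w -> (forall i g, opA w i g = 0) ->
      complex.Re (inner e w - inner y w) = 0.
    move=> lw kw; apply/eqP; rewrite -normr_le0; apply/ler_addgt0Pr => eps e0.
    rewrite add0r; pose s := eps / (normsq w + 1).
    have n1 : 0 < normsq w + 1 by rewrite ltr_wpDl // normsq_ge0.
    have s0 : 0 < s by rewrite divr_gt0.
    have [M MP] := uy _ (mulr_gt0 s0 e0).
    have h := Re_inner_le s0 (l2B (lu M) ly) lw.
    have <- : inner (fun i g => u M i g - y i g) w = inner e w - inner y w.
      by rewrite innerBl // iterv.
    have h1 : s^-1 * normsq (fun i g => u M i g - y i g) <= eps.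
      by rewrite mulrC ler_pdivrMr // mulrC MP.
    have h2 : s * normsq w <= eps.
      by rewrite /s mulrAC ler_pdivrMr // ler_wpM2l ?(ltW e0) // lerDl.
    lra.
  have Im0 : complex.Im (inner e v - inner y v) = 0.
    have lw := l2Z ('i)%C lv.
    have kw i g : opA (fun i g => 'i%C * v i g) i g = 0.
      transitivity ('i%C * opA v i g); last by rewrite kv mulr0.
      by rewrite /act mulr_sumr; apply: eq_bigr => t _; rewrite mulrCA.
    have := Re0 _ lw kw.
    rewrite (inner_conj lw le) (inner_conj lw ly) !innerZl //.
    rewrite (inner_conj le lv) (inner_conj ly lv).
    by case: (inner e v) => a b; case: (inner y v) => c f /=; lra.
  have := Re0 v lv kv; move: Im0; case: (inner e v - inner y v) => a b /= -> ->.
  by [].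
have yy : inner e y = (normsq y)%:C%C.
  by apply/eqP; rewrite -inner_self // -subr_eq0 -innerBl // perp.
have split m : normsq (fun i g => iter m T e i g - y i g) = normsq (iter m T e) - normsq y.
  rewrite normsqB //; last exact: iter_l2.
  by rewrite iterv // yy /=; lra.
exists y; split=> // [m|eps e0].
  by rewrite -subr_ge0 -split normsq_ge0.
have [M MP] := uy _ e0; exists M.*2 => m Mm.
apply: le_trans (q_mono Mm) _.
by rewrite addrC -lerBlDr -(split M.*2) MP.
Qed.
End Vector.

Lemma orth_proj_eq (W : set V) (x y : V) :
  W y -> (forall v, W v -> l2 v) ->
  (forall v w, W v -> W w -> W (fun i g => v i g - w i g)) -> l2 x ->
  (forall v, W v -> inner (fun i g => x i g - y i g) v = 0) ->
  orth_proj (W : set (vec R G d)) x = y.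
Proof.
move=> Wy Wl WB lx py; rewrite /orth_proj; set P := (X in xget _ X).
have Py : P y by split.
have [Wz pz] : P (xget 0 P) := xgetPex 0 (ex_intro _ y Py).
set z := xget 0 P in Wz pz *.
have WD := WB _ _ Wz Wy.
have pz' : inner (fun i g => x i g - z i g) (fun i g => z i g - y i g) = 0 by exact: pz.
have ly := Wl _ Wy; have lz := Wl _ Wz; have lD := Wl _ WD.
have := inner_self lD; rewrite innerBl //.
have := py _ WD; rewrite innerBl //; move: pz'; rewrite innerBl //.
move=> /subr0_eq <- /subr0_eq <-; rewrite subrr => /esym/(congr1 (@complex.Re R)) /= n0.
have D0 := normsq_eq0 lD n0.
by apply/funext => i; apply/funext => g; apply/subr0_eq; exact: D0.
Qed.

Lemma inner_delta x (i : 'I_d) : inner x (delta R i 1%g) = x i 1%g.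
Proof.
rewrite /inner (bigD1 i) //= big1 ?addr0; last first.
  move=> j /negbTE ji; rewrite -[RHS](@csum0 R G); apply: eq_csum => g.
  by rewrite /delta ji conjc_nat mulr0.
rewrite -[RHS](@csum_delta R G (x i 1%g) 1%g); apply: eq_csum => g.
by rewrite /delta eqxx conjc_nat mulrC; case: eqP => [->|_]; rewrite ?mul0r.
Qed.

Lemma delta_l2 (i : 'I_d) : l2 (delta R i (1%g : G) : V).
Proof.
move=> j; rewrite /delta; case: eqP => _ /=.
  have := rsummable_delta (1 : R) (1%g : G); apply: rsummable_le => g.
  rewrite mulr1 norm_modsq modsqE; case: eqP => _ /=;
  by rewrite ?expr1n !expr0n ?addr0 ?normr1 ?normr0.
have := rsummable_delta (0 : R) (1%g : G); apply: rsummable_le => g.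
by rewrite -[X in `|X|]/(modsq (0 : C)) norm_modsq modsqE /= !expr0n addr0 normr_ge0.
Qed.

(** The diagonal entry of the projection at [e] is the squared norm of the
    projection of [e], which is the infimum of the squared norms of the
    iterates. *)
Theorem kernel_dim_moments (W : set V) :
  W = [set x | l2 x /\ forall i g, opA x i g = 0] ->
  exists b : R, [/\ trG (orth_proj (W : set (vec R G d))) = b%:C%C,
    forall m, b <= moment k A m &
    forall eps, 0 < eps -> exists m, moment k A m <= b + eps].
Proof.
move=> WE; pose e i : V := delta R i (1%g : G).
have le i : l2 (e i) := delta_l2 i.
have /choice[y yP] : forall i, exists y : V, [/\ l2 y, forall i g, opA y i g = 0,
  forall v, l2 v -> (forall i g, opA v i g = 0) ->
    inner (fun j g => e i j g - y j g) v = 0,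
  forall m, normsq y <= normsq (iter m T (e i)) &
  forall eps, 0 < eps -> exists M, forall m, (M <= m)%N ->
     normsq (iter m T (e i)) <= normsq y + eps].
  by move=> i; exact: kernel_projection.
have WB v w : W v -> W w -> W (fun i g => v i g - w i g).
  rewrite WE => -[lv kv] [lw kw]; split; first exact: l2B.
  by move=> i g; rewrite actB kv kw subrr.
have projE i : orth_proj (W : set (vec R G d)) (e i) = y i.
  have [ly ky py _ _] := yP i; apply: orth_proj_eq => //.
  - by rewrite WE.
  - by move=> v; rewrite WE => -[].
  - by move=> v; rewrite WE => -[lv kv]; exact: py.
have momE m : moment k A m = \sum_i normsq (iter m T (e i)).
  rewrite (moment_free (la := mulG) k A m (fun=> 1%g)).
  - rewrite Re_sum; apply: eq_bigr => i _; rewrite -inner_delta -/(e i).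
    rewrite -addnn iterD iter_sym //; last exact: iter_l2.
    by rewrite (inner_self (iter_l2 m (le i))).
  - exact: mul1g.
  - by move=> g h z; rewrite mulgA.
  - by move=> g z E; apply: (mulIg z); rewrite mul1g.
exists (\sum_i normsq (y i)); split.
- rewrite /trG rmorph_sum; apply: eq_bigr => i _.
  rewrite -[std_basis _ _]/(e i) projE; have [ly ky py _ _] := yP i.
  have /eqP := py _ ly ky; rewrite innerBl // subr_eq0 => /eqP E.
  by rewrite (inner_conj (le i) ly) E inner_self // conjc_real.
- by move=> m; rewrite momE; apply: ler_sum => i _; have [] := yP i.
move=> eps e0; pose eta := eps / d.+1%:R.
have eta0 : 0 < eta by rewrite divr_gt0.
have /choice[M MP] : forall i, exists M, forall m, (M <= m)%N ->
    normsq (iter m T (e i)) <= normsq (y i) + eta.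
  by move=> i; have [_ _ _ _ /(_ _ eta0)] := yP i.
exists (\max_i M i); rewrite momE.
rewrite (le_trans (ler_sum _ (fun i _ => MP i _ (leq_bigmax i)))) //.
rewrite big_split /= lerD2l sumr_const card_ord /eta -[_ *+ d]mulr_natr mulrAC.
by rewrite ler_pdivrMr ?ltr0n // ler_pM2l // ler_nat.
Qed.
End Kernel.

(** * Algebraic coefficients *)

Section Algebraic.
Context (R : rcfType).
Local Notation C := R[i].
Local Notation algebraic := (algebraicOver (ratr : rat -> C)).

(** An eigenvector of the companion matrix. *)
Lemma algebraic_companion (a : C) : algebraic a ->
  exists n (u : 'cV[C]_n) (M : 'M[rat]_n), u != 0 /\ map_mx ratr M *m u = a *: u.
Proof.
move=> [p p0 pa].
pose q := (lead_coef p)^-1 *: p.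
have lp0 : lead_coef p != 0 by rewrite lead_coef_eq0.
have qm : q \is monic by rewrite monicE lead_coefZ mulVf.
have qa : root (map_poly ratr q) a.
  by rewrite map_polyZ rootZ // fmorph_eq0 invr_eq0.
have : eigenvalue (map_mx ratr (companionmx q)) a.
  by rewrite eigenvalue_root_char -map_char_poly companionmxK.
move=> /eigenvalueP[w wM w0].
exists _, w^T, (companionmx q)^T; split; first by rewrite trmx_eq0.
by rewrite -map_trmx -trmx_mul wM linearZ.
Qed.

(** Tensor product of the eigenvectors: each factor of the tensor product
    carries one of the coefficients. *)
Lemma algebraic_common (l : seq C) : (forall a, a \in l -> algebraic a) ->
  exists r (v : 'cV[C]_r), v != 0 /\
  forall a, a \in l -> exists M : 'M[rat]_r, map_mx ratr M *m v = a *: v.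
Proof.
elim: l => [|a l IH] la.
  exists 1%N, (const_mx 1); split=> //.
  by apply/eqP => /matrixP/(_ 0 0); rewrite !mxE => /eqP; rewrite oner_eq0.
have [|r [v [v0 vP]]] := IH; first by move=> b bl; apply: la; rewrite inE bl orbT.
have [|n [u [M [u0 uM]]]] := @algebraic_companion a; first exact/la/mem_head.
exists (r * n)%N, (v *t u); split.
  have ex m (w : 'cV[C]_m) : w != 0 -> exists i, w i 0 != 0.
    move=> w0; apply: contrapT => H; move/eqP: w0; apply; apply/colP => i.
    by rewrite mxE; apply/eqP; apply: contrapT => /negP wi; apply: H; exists i.
  have [i vi] := ex _ _ v0; have [j uj] := ex _ _ u0.
  apply/eqP => vu0; have := tensmxE v u i j (0 : 'I_1) (0 : 'I_1).
  rewrite [X in fun_of_matrix X]vu0 mxE => /esym/eqP.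
  by rewrite mulf_eq0 (negbTE vi) (negbTE uj).
have scl (c : C) (x : 'cV[C]_r) (y : 'cV[C]_n) :
    (c *: x) *t y = c *: (x *t y) :> 'cV_(r * n).
  by apply/matrixP => i j; rewrite !mxE mulrA.
have scr (c : C) (x : 'cV[C]_r) (y : 'cV[C]_n) :
    x *t (c *: y) = c *: (x *t y) :> 'cV_(r * n).
  by apply/matrixP => i j; rewrite !mxE mulrCA.
move=> b; rewrite inE => /orP[/eqP ->|bl].
  exists (1%:M *t M); rewrite map_mxT map_mx1.
  by rewrite -scr -uM; rewrite -[LHS]/(_ *m (v *t u)) tensmx_mul mul1mx.
have [Mb vb] := vP _ bl; exists (Mb *t 1%:M); rewrite map_mxT map_mx1.
by rewrite -scl -vb; rewrite -[LHS]/(_ *m (v *t u)) tensmx_mul mul1mx.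
Qed.

Lemma common_denominator (s : seq rat) : exists2 D : nat, (0 < D)%N &
  forall x, x \in s -> exists z : int, D%:R * x = z%:~R.
Proof.
elim: s => [|x s [D D0 DP]]; first by exists 1%N.
exists (D * `|denq x|)%N; first by rewrite muln_gt0 D0 absz_gt0 denq_neq0.
have dE : `|denq x|%:R = (denq x)%:~R :> rat.
  by rewrite pmulrn abszE ger0_norm // ltW // denq_gt0.
move=> y; rewrite inE => /orP[/eqP ->|ys].
  exists (D%:Z * numq x); rewrite natrM dE -mulrA [_%:~R * x]mulrC.
  by rewrite -{1}[x]divq_num_den divfK ?intr_eq0 ?denq_neq0 // intrM.
have [z zP] := DP _ ys; exists (z * denq x).
by rewrite natrM dE mulrAC zP intrM.
Qed.

Lemma algebraic_conj (a : C) : algebraic a -> algebraic (a^*)%C.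
Proof.
move=> [p p0 pa]; exists p => //.
rewrite -complex_root_conj -map_poly_comp (eq_map_poly (g := ratr)) // => x.
exact: (fmorph_rat (@conjc R)).
Qed.

(** The kernel is unchanged when a matrix is multiplied by [D], so that
    algebraic coefficients may be replaced by such multiples. *)
Lemma algebraic_liftable (l : seq C) : (forall a, a \in l -> algebraic a) ->
  exists2 D : nat, (0 < D)%N & liftable [seq D%:R * a | a <- l].
Proof.
move=> la; pose l' := l ++ [seq (a^*)%C | a <- l].
have la' a : a \in l' -> algebraic a.
  by rewrite mem_cat => /orP[/la//|/mapP[b /la lb ->]]; exact: algebraic_conj.
have [r [v [v0 vP]]] := algebraic_common la'.
have /choice[M MP] : forall a, exists M : 'M[rat]_r, a \in l' ->
    map_mx ratr M *m v = a *: v.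
  move=> a; case: (boolP (a \in l')) => [/vP[M ?]|_]; [by exists M|by exists 0].
have [D D0 DP] := common_denominator
  [seq M a ij.1 ij.2 | a <- l', ij <- enum {: 'I_r * 'I_r}].
have lift a : a \in l' -> exists N : 'M[int]_r,
    map_mx intr N *m v = (D%:R * a) *: v.
  move=> al.
  have /choice[z zP] : forall ij : 'I_r * 'I_r, exists z : int,
      D%:R * M a ij.1 ij.2 = z%:~R.
    move=> ij; apply: DP; apply/allpairsP; exists (a, ij); split=> //=.
    by rewrite mem_enum.
  exists (\matrix_(i, j) z (i, j)).
  have -> : map_mx intr (\matrix_(i, j) z (i, j)) = D%:R *: map_mx ratr (M a) :> 'M[C]_r.
    apply/matrixP => i j; rewrite !mxE -[D%:R](ratr_nat C) -rmorphM.
    by rewrite (zP (i, j)) /= ratr_int.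
  by rewrite -scalemxAl MP // scalerA.
have /choice[Nf NP] : forall c : C, exists N : 'M[int]_r,
    (exists N' : 'M[int]_r, map_mx intr N' *m v = c *: v) ->
    map_mx intr N *m v = c *: v.
  move=> c; case: (pselect (exists N' : 'M[int]_r, map_mx intr N' *m v = c *: v)).
    by move=> [N' ?]; exists N'.
  by move=> nN; exists 0.
exists D => //; exists r, v, Nf; split=> // c /mapP[a al ->]; split; apply: NP.
  by apply: lift; rewrite mem_cat al.
rewrite rmorphM /= conjc_nat; apply: lift; rewrite mem_cat; apply/orP; right.
by apply/mapP; exists a.
Qed.
End Algebraic.

(** * Directed limits and local embeddings *)

Section Groups.
Implicit Types G H L : groupType.

Lemma multiplicative1 G H (f : {multiplicative G -> H}) : f 1%g = 1%g.
Proof. by apply: (mulgI (f 1%g)); rewrite -gmulfM !mulg1. Qed.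

Lemma multiplicativeV G H (f : {multiplicative G -> H}) g : f (g^-1)%g = ((f g)^-1)%g.
Proof. by apply: (mulgI (f g)); rewrite -gmulfM !mulgV multiplicative1. Qed.

Lemma multiplicative_build G H (f : G -> H) :
  {morph f : x y / (x * y)%g} -> exists F : {multiplicative G -> H}, F =1 f.
Proof.
move=> fM.
by exists (HB.pack_for (Multiplicative.type G H) f (isMultiplicative.Build G H f fM)).
Qed.

Lemma subgroup_build L (P : set L) : P 1%g ->
  (forall x y, P x -> P y -> P (x * y)%g) -> (forall x, P x -> P (x^-1)%g) ->
  exists (U : groupType) (f : {multiplicative U -> L}),
    injective f /\ range f = P.
Proof.
move=> P1 PM PV.
pose T := {x : L | `[< P x >]}.
pose mk x (Px : P x) : T := exist _ x (introT (asboolP _) Px).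
have vinj (s t : T) : sval s = sval t -> s = t by exact: val_inj.
have Tp (t : T) : P (sval t) by apply/asboolP; exact: (svalP t).
pose one := mk _ P1; pose mul (s t : T) := mk _ (PM _ _ (Tp s) (Tp t)).
pose inv (t : T) := mk _ (PV _ (Tp t)).
have mA : associative mul by move=> x y z; apply: vinj; rewrite /= mulgA.
have m1 : left_id one mul by move=> x; apply: vinj; rewrite /= mul1g.
have m1r : right_id one mul by move=> x; apply: vinj; rewrite /= mulg1.
have mV : left_inverse one inv mul by move=> x; apply: vinj; rewrite /= mulVg.
have mVr : right_inverse one inv mul by move=> x; apply: vinj; rewrite /= mulgV.
pose U := HB.pack_for groupType T (isGroup.Build T mA m1 m1r mV mVr).
have [f fE] : exists f : {multiplicative U -> L}, f =1 (fun t : T => sval t).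
  by apply: multiplicative_build.
exists U, f; split; first by move=> x y; rewrite !fE => /vinj.
apply/seteqP; split=> [_ [x _ <-]|x Px]; first by rewrite fE; exact: Tp.
by exists (mk x Px) => //; rewrite fE.
Qed.

(** Used for germs of families: two families are identified when they
    eventually agree. *)
Lemma product_quotient_build (I : Type) (G_ : I -> groupType)
    (E : (forall i, G_ i) -> (forall i, G_ i) -> Prop) :
  (forall u, E u u) -> (forall u v, E u v -> E v u) ->
  (forall u v w, E u v -> E v w -> E u w) ->
  (forall u u' v v', E u u' -> E v v' ->
     E (fun i => u i * v i)%g (fun i => u' i * v' i)%g) ->
  (forall u u', E u u' -> E (fun i => (u i)^-1)%g (fun i => (u' i)^-1)%g) ->
  exists (Q : groupType) (cl : (forall i, G_ i) -> Q),
    (forall u v, cl (fun i => u i * v i)%g = (cl u * cl v)%g) /\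
    forall u v, cl u = cl v <-> E u v.
Proof.
move=> Er Es Et EM EV.
pose cls u : set (forall i, G_ i) := [set v | E u v].
have clsE u v : cls u = cls v <-> E u v.
  split=> [uv|uv]; first by have : cls v v := Er v; rewrite -uv.
  by apply/seteqP; split=> w; [apply: Et; exact: Es|exact: Et].
pose T := {c : set (forall i, G_ i) | `[< exists u, c = cls u >]}.
have vinj (s t : T) : sval s = sval t -> s = t by exact: val_inj.
pose cl u : T := exist _ (cls u) (introT (asboolP _) (ex_intro _ u erefl)).
have clE u v : cl u = cl v <-> E u v.
  by rewrite -clsE; split=> [[]|uv] //; exact: vinj.
have /choice[rep repK] : forall t : T, exists u, cl u = t.
  move=> t; have /asboolP[u tu] := svalP t.
  by exists u; apply: vinj; rewrite /= tu.
have Erep u : E (rep (cl u)) u by apply/clE; rewrite repK.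
pose one := cl (fun i => 1%g).
pose mul (s t : T) := cl (fun i => rep s i * rep t i)%g.
pose inv (t : T) := cl (fun i => (rep t i)^-1)%g.
have mulE u v : mul (cl u) (cl v) = cl (fun i => u i * v i)%g.
  by apply/clE; apply: EM.
have invE u : inv (cl u) = cl (fun i => (u i)^-1)%g by apply/clE; apply: EV.
have ext u v : (forall i, u i = v i) -> cl u = cl v.
  by move=> uv; congr cl; apply: functional_extensionality_dep.
have mA : associative mul.
  move=> x y z; rewrite -[x]repK -[y]repK -[z]repK !mulE.
  by apply: ext => i; rewrite mulgA.
have m1 : left_id one mul.
  by move=> x; rewrite -[x]repK mulE; apply: ext => i; rewrite mul1g.
have m1r : right_id one mul.
  by move=> x; rewrite -[x]repK mulE; apply: ext => i; rewrite mulg1.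
have mV : left_inverse one inv mul.
  by move=> x; rewrite -[x]repK invE mulE; apply: ext => i; rewrite mulVg.
have mVr : right_inverse one inv mul.
  by move=> x; rewrite -[x]repK invE mulE; apply: ext => i; rewrite mulgV.
pose Q := HB.pack_for groupType T (isGroup.Build T mA m1 m1r mV mVr).
by exists Q, cl; split=> // u v; apply/esym/mulE.
Qed.
End Groups.

Section Directed.
Context (disp : Order.disp_t) (I : porderType disp).
Hypothesis dir : directed I.

Lemma directed_seq (s : seq I) (i0 : I) :
  exists k, (i0 < k)%O /\ forall i, i \in s -> (i < k)%O.
Proof.
elim: s => [|i s [k [i0k kP]]].
  by have [k [ik _]] := dir i0 i0; exists k.
have [k' [ik' kk']] := dir i k; exists k'; split; first exact: lt_trans kk'.
by move=> j; rewrite inE => /orP[/eqP ->//|/kP/lt_trans]; apply.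
Qed.

Section DirectLimit.
Context (G_ : I -> groupType) (L : groupType).
Context (f : forall i j : I, (i < j)%O -> {multiplicative G_ i -> G_ j}).
Hypothesis fC : forall i j k (ij : (i < j)%O) (jk : (j < k)%O) (ik : (i < k)%O) x,
  f jk (f ij x) = f ik x.
Context (phi : forall i, {multiplicative G_ i -> L}).
Hypothesis lim : is_direct_limit f phi.
Context (i0 : I).

(** The union of the images is a subgroup [U] of [L] and receives a compatible
    family of maps. The composition of the induced map from [L] to [U] with
    the inclusion is the identity, by uniqueness. *)
Lemma direct_limit_surj (l : L) : exists i x, phi i x = l.
Proof.
have [co univ] := lim.
pose P : set L := [set l | exists i x, phi i x = l].
have [|||U [h [hinj hrange]]] := @subgroup_build L P.
- by exists i0, 1%g; rewrite multiplicative1.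
- move=> _ _ [i [x <-]] [j [y <-]]; have [k [ik jk]] := dir i j.
  exists k, (f ik x * f jk y)%g; rewrite gmulfM; congr (_ * _)%g; exact: co.
- by move=> _ [i [x <-]]; exists i, (x^-1)%g; rewrite multiplicativeV.
have psH : forall i, exists ps : {multiplicative G_ i -> U},
    forall x, h (ps x) = phi i x.
  move=> i; have /choice[p pP] : forall x, exists u, h u = phi i x.
    move=> x; have : range h (phi i x) by rewrite hrange; exists i, x.
    by move=> [u _ <-]; exists u.
  have [|F FE] := @multiplicative_build _ _ p.
    by move=> x y; apply: hinj; rewrite gmulfM !pP gmulfM.
  by exists F => x; rewrite FE.
pose ps i := projT1 (cid (psH i)).
have psP i : forall x, h (ps i x) = phi i x := projT2 (cid (psH i)).
have [|u [uP _]] := univ U ps.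
  by move=> i j ij x; apply: hinj; rewrite !psP; exact: co.
have [w [wP wU]] := univ L phi co.
have [hu huE] : exists hu : {multiplicative L -> L}, hu =1 h \o u.
  by apply: multiplicative_build => x y; rewrite /= !gmulfM.
have [idL idE] : exists g : {multiplicative L -> L}, g =1 id by apply: multiplicative_build.
have : hu l = idL l.
  by rewrite (wU hu) ?(wU idL) // => i x; rewrite ?idE // huE /= uP psP.
rewrite huE idE /= => <-; have : P (h (u l)) by rewrite -hrange; exists (u l).
by [].
Qed.

(** The images of [x] in the later groups define an element of the group of
    germs of families. The maps to germs factor through [L], so if [x] is
    trivial in [L] its germ is trivial. *)
Lemma direct_limit_ker i x : phi i x = 1%g ->
  exists j, exists ij : (i < j)%O, f ij x = 1%g.
Proof.
move=> px; have [co univ] := lim.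
pose E (u v : forall j, G_ j) := exists k, forall l, (k < l)%O -> u l = v l.
have [|||||Q [cl [clM clE]]] := @product_quotient_build I G_ E.
- by move=> u; exists i0.
- by move=> u v [k kP]; exists k => l kl; rewrite kP.
- move=> u v w [k kP] [k' k'P]; have [m [km k'm]] := dir k k'; exists m => l ml.
  by rewrite kP ?k'P //; [exact: lt_trans ml|exact: lt_trans ml].
- move=> u u' v v' [k kP] [k' k'P]; have [m [km k'm]] := dir k k'; exists m => l ml.
  by rewrite kP ?k'P //; [exact: lt_trans ml|exact: lt_trans ml].
- by move=> u u' [k kP]; exists k => l kl; rewrite kP.
pose g (j : I) (y : G_ j) : forall l, G_ l := fun l =>
  match pselect (j < l)%O with left jl => f jl y | right _ => 1%g end.
have gE j l (jl : (j < l)%O) y : g j y l = f jl y.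
  by rewrite /g; case: pselect => // jl'; rewrite (Prop_irrelevance jl jl').
have psH : forall j, exists ps : {multiplicative G_ j -> Q},
    forall y, ps y = cl (g j y).
  move=> j; have [|F FE] := @multiplicative_build _ _ (fun y => cl (g j y)).
    move=> y z /=; rewrite -clM; apply/clE; exists j => l jl.
    by rewrite !(gE _ _ jl) gmulfM.
  by exists F.
pose ps j := projT1 (cid (psH j)).
have psP j : forall y, ps j y = cl (g j y) := projT2 (cid (psH j)).
have [|u [uP _]] := univ Q ps.
  move=> j k jk y; rewrite !psP; apply/clE; exists k => l kl.
  by rewrite (gE _ _ kl) (gE _ _ (lt_trans jk kl)); exact: fC.
have : ps i x = ps i 1%g by rewrite -(uP i x) -(uP i 1%g) px (multiplicative1 (phi i)).
rewrite !psP => /clE[k kP]; have [l [il kl]] := dir i k.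
exists l, il; have := kP l kl; rewrite !(gE _ _ il) => ->; exact: multiplicative1.
Qed.
End DirectLimit.
End Directed.

(** Subgroups, direct limits and inverse limits all give local embeddings, and
    this is the only property of them that the moments see. *)
Definition locally_embeds (I : Type) (G_ : I -> groupType) (L : groupType) :=
  forall F : seq L, exists i (th : L -> G_ i),
    {in F &, forall g h, th (g * h)%g = (th g * th h)%g} /\
    {in F, forall g, th g = 1%g -> g = 1%g}.

Lemma locally_embeds_sub (I : Type) (G_ : I -> groupType) (U L : groupType) :
  is_subgroup U L -> locally_embeds G_ L -> locally_embeds G_ U.
Proof.
move=> [f finj] loc F; have [i [th [thM th1]]] := loc [seq f x | x <- F].
exists i, (th \o f); split=> [g h gF hF|g gF] /=.
  by rewrite gmulfM thM ?map_f.
by move=> /th1 fg; apply: finj; rewrite multiplicative1 fg ?map_f.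
Qed.

Lemma locally_embeds_torsion_free (I : Type) (G_ : I -> groupType) (L : groupType) :
  (forall i, torsion_free (G_ i)) -> locally_embeds G_ L -> torsion_free L.
Proof.
move=> tf loc g n n0 gn.
pose F := [seq (g ^+ k)%g | k <- iota 0 n.+2].
have inF k : (k <= n.+1)%N -> (g ^+ k)%g \in F.
  by move=> kn; apply: map_f; rewrite mem_iota.
have [i [th [thM th1]]] := loc F.
have t1 : th 1%g = 1%g.
  by apply: (mulgI (th 1%g)); rewrite -thM ?mulg1 //; exact: (inF 0%N).
have tX k : (k <= n)%N -> th (g ^+ k)%g = (th g ^+ k)%g.
  elim: k => [|k IH] kn; first by rewrite !expg0.
  rewrite !expgS thM ?IH ?(ltnW kn) //; first by rewrite -[g]expg1; exact: inF.
  by apply: inF; rewrite ltnW // ltnS ltnW.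
apply: th1; first by rewrite -[X in X \in _]expg1; exact: inF.
by apply: (tf i _ _ n0); rewrite -tX // gn t1.
Qed.

Section Limits.
Context (disp : Order.disp_t) (I : porderType disp).

(** Over an empty system every endomorphism of [L] satisfies the uniqueness
    clause, so the identity equals the constant map. *)
Lemma directed_limit_empty (G_ : I -> groupType) (L : groupType) :
  (I -> False) -> directed_limit G_ L -> trivial_group L.
Proof.
move=> I0 [_ lim] x.
have [idL idE] : exists g : {multiplicative L -> L}, g =1 id by apply: multiplicative_build.
have [oL oE] : exists g : {multiplicative L -> L}, g =1 (fun=> 1%g).
  by apply: multiplicative_build => a b; rewrite mulg1.
have vac (P : I -> Prop) i : P i by case: (I0 i).
rewrite -[LHS]idE -[RHS](oE x).
by case: lim => -[f [_ [p [co univ]]]]; have [u [_ uU]] := univ L p co;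
  rewrite (uU idL) ?(uU oL) //; exact: vac.
Qed.

(** Finitely many elements lift to a common [G_k], and the finitely many
    relations between the lifts hold after moving further along the system. *)
Lemma direct_limit_locally_embeds (G_ : I -> groupType) (L : groupType) (i0 : I) :
  directed I -> direct_limit_of G_ L -> locally_embeds G_ L.
Proof.
move=> dir [f [fC [phi lim]]] F.
have co : forall i j (ij : (i < j)%O) x, phi j (f i j ij x) = phi i x := lim.1.
have liftH l : exists ix : {i : I & G_ i}, phi (tag ix) (tagged ix) = l.
  have [i [x E]] := direct_limit_surj dir lim i0 l.
  by exists (Tagged G_ x).
have /choice[lift liftP] := liftH.
pose E := F ++ [seq (g * h)%g | g <- F, h <- F].
have [k [_ kP]] := directed_seq dir [seq tag (lift l) | l <- E] i0.
pose t0 l : G_ k := match pselect (tag (lift l) < k)%O with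
  left lk => f _ _ lk (tagged (lift l)) | right _ => 1%g end.
have t0P l : l \in E -> phi k (t0 l) = l.
  move=> lE; rewrite /t0; case: pselect => [lk|]; first by rewrite co liftP.
  by case; apply: kP; exact: map_f.
have EF g : g \in F -> g \in E by move=> gF; rewrite mem_cat gF.
have EFF g h : g \in F -> h \in F -> (g * h)%g \in E.
  by move=> gF hF; rewrite mem_cat; apply/orP; right; apply: allpairs_f.
have relH (p : L * L) : exists j, p.1 \in F -> p.2 \in F -> exists kj : (k < j)%O,
    f k j kj ((t0 (p.1 * p.2))^-1 * (t0 p.1 * t0 p.2))%g = 1%g.
  case: (boolP ((p.1 \in F) && (p.2 \in F))) => [/andP[gF hF]|nF]; last first.
    by exists k => gF hF; rewrite gF hF in nF.
  have [|j [kj fj]] := direct_limit_ker dir fC lim i0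
    (i := k) (x := ((t0 (p.1 * p.2))^-1 * (t0 p.1 * t0 p.2))%g).
    by rewrite !gmulfM multiplicativeV (t0P _ (EFF _ _ gF hF)) (t0P _ (EF _ gF))
      (t0P _ (EF _ hF)) mulVg.
  by exists j => _ _; exists kj.
have /choice[j jP] := relH.
have [m [km mP]] := directed_seq dir [seq j (g, h) | g <- F, h <- F] k.
exists m, (fun l => f k m km (t0 l)); split=> [g h gF hF|g gF fg].
  have [kj fj] := jP (g, h) gF hF.
  have jm : (j (g, h) < m)%O by apply: mP; apply: allpairs_f.
  have := congr1 (f _ _ jm) fj; rewrite (fC _ _ _ kj jm km).
  rewrite multiplicative1 !gmulfM multiplicativeV /=.
  by move=> E1; apply: (mulgI ((f k m km (t0 (g * h)%g))^-1)%g); rewrite mulVg E1.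
by rewrite -(t0P _ (EF _ gF)) -(co _ _ km) fg multiplicative1.
Qed.

(** The projections separate the points of [L]: on their common kernel the
    inclusion and the trivial map both solve the universal problem. Finitely
    many non-trivial elements are detected by a single projection. *)
Lemma inverse_limit_locally_embeds (G_ : I -> groupType) (L : groupType) (i0 : I) :
  directed I -> inverse_limit_of G_ L -> locally_embeds G_ L.
Proof.
move=> dir [f [fC [p [co univ]]]] F.
have pinj x : (forall i, p i x = 1%g) -> x = 1%g.
  move=> px; pose K : set L := [set x | forall i, p i x = 1%g].
  have [|||U [h [hinj hrange]]] := @subgroup_build L K.
  - by move=> i; rewrite multiplicative1.
  - by move=> a b Ka Kb i; rewrite gmulfM Ka Kb mulg1.
  - by move=> a Ka i; rewrite multiplicativeV Ka invg1.
  have [tr trE] : exists tr : {multiplicative U -> L}, tr =1 (fun=> 1%g).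
    by apply: multiplicative_build => a b; rewrite mulg1.
  have qH i : exists q : {multiplicative U -> G_ i}, q =1 (fun=> 1%g).
    by apply: multiplicative_build => a b; rewrite mulg1.
  pose q i := projT1 (cid (qH i)).
  have qE i : q i =1 (fun=> 1%g) := projT2 (cid (qH i)).
  have [|u [_ uU]] := univ U q; first by move=> i j ij y; rewrite !qE multiplicative1.
  have : range h x by rewrite hrange.
  move=> [y _ <-]; rewrite (uU h); last first.
    by move=> i z; rewrite qE; have : K (h z) by rewrite -hrange; exists z.
  by rewrite -(uU tr) ?trE // => i z; rewrite trE qE multiplicative1.
have sepH x : exists i, x <> 1%g -> p i x <> 1%g.
  apply: contrapT => H; have nx : forall i, p i x = 1%g.
    by move=> i; apply: contrapT => pix; apply: H; exists i.
  by apply: H; exists i0 => /(_ (pinj _ nx)).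
have /choice[s sP] := sepH.
have [k [_ kP]] := directed_seq dir [seq s x | x <- F] i0.
exists k, (p k); split=> [g h _ _|g gF pg]; first exact: gmulfM.
apply: contrapT => /sP; apply.
have sk : (s g < k)%O by apply: kP; exact: map_f.
by rewrite -(co _ _ sk) pg multiplicative1.
Qed.

Lemma directed_limit_locally_embeds (G_ : I -> groupType) (L : groupType) (i0 : I) :
  directed_limit G_ L -> locally_embeds G_ L.
Proof.
move=> [dir [dl|il]]; [exact: direct_limit_locally_embeds|].
exact: inverse_limit_locally_embeds.
Qed.
End Limits.

(** * Decay for the class and approximation of the dimension *)

Section FinalDecay.
Context (R : realType) (AA : seq R[i]) (N : nat) (al k dl : R).
Hypotheses (al0 : 0 <= al) (AAal : {in AA, forall a, `|a| <= al%:C%C}).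
Hypotheses (k0 : 0 < k) (kN : (N%:R * al) ^+ 2 <= k).
Hypothesis triv : forall (G : groupType) (J : finType) (A : seq (term R J G)),
  (forall g : G, g = 1%g) -> admissible AA N A ->
  exists z : nat, forall M, z%:R <= moment k A M /\
    forall q, moment k A M <= z%:R + #|J|%:R * decay dl q M.

Lemma trivial_has_decay G : trivial_group G -> has_decay AA N k dl G.
Proof.
move=> G1 J A adm q M M'; have [z zP] := triv G1 adm.
by rewrite (le_trans ((zP M).2 q)) // lerD2r (zP M').1.
Qed.

Lemma classG_has_decay G : classG R G -> has_decay AA N k dl G.
Proof.
elim=> {G} [G|H G _ IH ext|H U _ IH sub|disp I G_ G _ IH lim].
- exact: trivial_has_decay.
- exact: has_decay_extension al0 AAal k0 kN _ _ (gen_amenable_ext_folner ext) IH.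
- have loc : locally_embeds (fun _ : unit => H) U.
    by apply: locally_embeds_sub sub _ => F; exists tt, id; split=> [g h _ _|g _ ->].
  apply: has_decay_local => F; have [i [th [thM th1]]] := loc F.
  by exists H, th.
have [[i0]|nI] := pselect (inhabited I); last first.
  by apply: trivial_has_decay; apply: directed_limit_empty lim => i; apply: nI.
apply: has_decay_local => F.
have [i [th [thM th1]]] := directed_limit_locally_embeds i0 lim F.
by exists (G_ i), th; split=> //; exact: IH.
Qed.
End FinalDecay.

Section Matrices.
Context (R : realType) (G : groupType) (d : nat).
Local Notation C := R[i].
Local Notation mulG := (fun g h : G => (g * h)%g).

Definition mx_terms (D : C) (A : 'M[{fsfun G -> C with 0}]_d) : seq (term R 'I_d G) :=
  [seq (ij.1, ij.2, h, D * A ij.1 ij.2 h)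
  | ij <- enum {: 'I_d * 'I_d}, h <- finsupp (A ij.1 ij.2)].

Lemma act_mx_terms D A x i g : act mulG (mx_terms D A) x i g = D * mxact A x i g.
Proof.
rewrite /act /mx_terms big_mkcond big_allpairs_dep big_enum /=.
rewrite -(pair_bigA _ (fun i' j => \sum_(h <- finsupp (A i' j))
  if i' == i then D * A i' j h * x j (h^-1 * g)%g else 0)) /=.
rewrite (bigD1 i) //= [X in _ + X]big1 ?addr0; last first.
  by move=> j /negbTE ji; apply: big1 => j' _; apply: big1 => h _; rewrite ji.
rewrite /mxact mulr_sumr; apply: eq_bigr => j _; rewrite /convol mulr_sumr.
by apply: eq_bigr => h _; rewrite eqxx mulrA.
Qed.

Lemma ker_mx_terms D A : D != 0 ->
  ker_mx A = [set x | l2 x /\ forall i g, act mulG (mx_terms D A) x i g = 0].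
Proof.
move=> D0; apply/seteqP; split=> x [lx kx]; split=> // i g.
  by rewrite act_mx_terms kx mulr0.
by have /eqP := kx i g; rewrite act_mx_terms mulf_eq0 (negbTE D0) => /eqP.
Qed.

Lemma terms_mx (W : seq (term R 'I_d G)) :
  exists A : 'M[{fsfun G -> C with 0}]_d,
    (forall i j g, A i j g =
       \sum_(t <- W | [&& trow t == i, tcol t == j & tlab t == g]) tcf t) /\
    forall x i g, mxact A x i g = act mulG W x i g.
Proof.
pose S := seq_fset tt (labs W).
pose c i j g := \sum_(t <- W | [&& trow t == i, tcol t == j & tlab t == g]) tcf t.
have cS i j g : g \notin S -> c i j g = 0.
  move=> gS; rewrite /c big_seq_cond big_pred0 // => t.
  apply/negP => /and4P[tW _ _ /eqP tg]; case/negP: gS.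
  by rewrite seq_fsetE; apply/mapP; exists t.
exists (\matrix_(i, j) [fsfun g in S => c i j g | 0]).
have AE i j g : (\matrix_(i, j) [fsfun g in S => c i j g | 0]) i j g = c i j g.
  rewrite mxE fsfunE; case: ifPn => // /cS ->.
  by [].
split=> // x i g.
rewrite /mxact /convol [RHS]/act.
rewrite [RHS](partition_big (fun t : term R 'I_d G => tcol t) xpredT) //=.
apply: eq_bigr => j _; set f := fun_of_matrix _ i j.
have fS : {subset finsupp f <= S}.
  by move=> h; rewrite mem_finsupp /f AE; apply: contraNT => /cS ->.
rewrite (big_fset_incl _ (introT (@fsubsetP _ _ _) fS)) /=; last first.
  by move=> h _; rewrite memNfinsupp => /eqP ->; rewrite mul0r.
under eq_bigr do rewrite /f AE /c mulr_suml.
rewrite (exchange_big_dep xpredT) //= [LHS]big_seq [RHS]big_seq_cond.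
rewrite [RHS]big_mkcondr /=; apply: eq_bigr => t tW.
case: (altP (trow t =P i)) => [ti|_] /=; last by rewrite big_pred0.
case: (altP (tcol t =P j)) => [<-|_] /=; last by rewrite big_pred0.
have tS : tlab t \in S by rewrite seq_fsetE; apply/mapP; exists t.
rewrite big_mkcond (bigD1_seq (tlab t) tS (fset_uniq S)) eqxx big1 /= ?addr0 //.
by move=> h /negbTE; rewrite eq_sym => ->.
Qed.
End Matrices.

(** Integers at distance at most 1/4 from [b] coincide. *)
Lemma near_integers_integer (R : realType) (b : R) :
  (forall eps, 0 < eps -> exists m : int, `|b - m%:~R| <= eps) ->
  exists m : int, b = m%:~R.
Proof.
move=> near; have [|m mP] := near (1 / 4); first by rewrite divr_gt0.
exists m; apply/eqP; rewrite -subr_eq0 -normr_le0; apply/ler_addgt0Pr => eps e0.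
rewrite add0r; pose e := Num.min eps (1 / 4).
have e1 : 0 < e by rewrite lt_min e0 divr_gt0.
have [m' m'P] := near _ e1.
have h1 : e <= eps by rewrite ge_min lexx.
have h2 : e <= 1 / 4 by rewrite ge_min lexx orbT.
suff -> : m = m' by rewrite (le_trans m'P).
apply/eqP; rewrite -subr_eq0 -normr_le0 -ltzD1 add0r -(ltr_int R) intr_norm rmorphB /=.
have -> : m%:~R - m'%:~R = (b - m'%:~R) - (b - m%:~R) :> R by lra.
rewrite (le_lt_trans (ler_normB _ _)) //; lra.
Qed.

Lemma decay_small (R : realType) (dl : R) (d : nat) (eps : R) :
  0 < dl -> dl < 1 -> 0 < eps -> exists q M, d%:R * decay dl q M <= eps.
Proof.
move=> dl0 dl1 e0; pose e1 := eps / 2 / d.+1%:R.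
have e10 : 0 < e1 by rewrite !divr_gt0.
pose q := Num.truncn e1^-1.
have qe : q.+1%:R^-1 <= e1.
  rewrite -[leRHS]invrK lef_pV2 ?posrE ?invr_gt0 ?ltr0n //.
  by rewrite ltW // truncnS_gt.
pose z := 1 - dl ^+ q.+1.
have z01 : 0 <= z < 1.
  by rewrite subr_ge0 exprn_ile1 ?(ltW dl0) ?(ltW dl1) //= ltrBlDr ltrDl exprn_gt0.
have [z0 z1] := andP z01.
have nz : `|z| < 1 by rewrite ger0_norm.
have /cvgrPdist_le/(_ _ e10)[M _ MP] := cvg_expr nz.
have zM : z ^+ M.*2 <= e1.
  have := MP M.*2; rewrite /= -addnn leq_addr => /(_ isT).
  by rewrite sub0r normrN ger0_norm ?exprn_ge0.
exists q, M; rewrite /decay -/z.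
apply: (le_trans (y := d%:R * (e1 + e1))).
  by rewrite ler_wpM2l // lerD.
have E : d.+1%:R * e1 = eps / 2 by rewrite mulrC divfK // pnatr_eq0.
have h : d%:R * e1 <= d.+1%:R * e1 by rewrite ler_wpM2r ?(ltW e10) // ler_nat.
by rewrite mulrDr; lra.
Qed.

Lemma algebraic_sum (R : realType) (T : eqType) (r : seq T) (P : pred T) (F : T -> R[i]) :
  (forall t, t \in r -> algebraicOver (ratr : rat -> R[i]) (F t)) ->
  algebraicOver (ratr : rat -> R[i]) (\sum_(t <- r | P t) F t).
Proof.
move=> aF; rewrite big_seq_cond; elim/big_rec: _ => [|t z /andP[tr _] az].
  exact: algebraic0.
by apply: algebraic_add => //; exact: aF.
Qed.

Theorem proposition1p9 (R : realType) (disp : Order.disp_t)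
    (I : porderType disp) (G_ : I -> groupType) (L G : groupType)
    (hL : directed_limit G_ L) (hG : is_subgroup G L)
    (hclass : forall i : I, classG R (G_ i))
    (htf : forall i : I, torsion_free (G_ i))
    (hAtiyah : forall i : I,
       strong_Atiyah (@algebraic_numbers R) (G_ i)) :
  strong_Atiyah (@algebraic_numbers R) G.
Proof.
(* Over an empty index set the limit is trivial. *)
have alternative : trivial_group G \/ locally_embeds G_ G.
  have [[i0]|nI] := pselect (inhabited I); [right|left].
    exact: locally_embeds_sub hG (directed_limit_locally_embeds i0 hL).
  have L1 : trivial_group L by apply: directed_limit_empty hL => i; apply: nI.
  by have [f finj] := hG => g; apply: finj; rewrite multiplicative1; exact: L1.
split.
  case: alternative => [G1 g n _ _|loc]; first exact: G1.
  exact: locally_embeds_torsion_free htf loc.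
move=> d A algA.
pose l := [seq A ij.1 ij.2 h | ij <- enum {: 'I_d * 'I_d}, h <- finsupp (A ij.1 ij.2)].
have [|D D0 lift] := @algebraic_liftable R l.
  by move=> a /allpairsPdep[ij [h [_ _ ->]]]; exact: algA.
pose AA := [seq D%:R * a | a <- l].
pose At := mx_terms D%:R A; pose N := size At.
have adm : admissible AA N At.
  split=> [t|i|j]; try exact: count_size.
  move=> /allpairsPdep[ij [h [ijE hE ->]]]; apply: map_f; apply/allpairsPdep.
  by exists ij, h.
have algAA a : a \in AA -> algebraicOver (ratr : rat -> R[i]) a.
  move=> /mapP[b /allpairsPdep[ij [h [_ _ ->]]] ->]; apply: algebraic_mul.
    by rewrite -(ratr_nat R[i]); exact: algebraic_id.
  exact: algA.
pose al : R := \sum_(a <- AA) Normc.normc a.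
have n0 (a : R[i]) : 0 <= Normc.normc a.
  by case: a => x y; exact: sqrtr_ge0.
have al0 : 0 <= al by apply: sumr_ge0.
have AAal : {in AA, forall a, `|a| <= al%:C%C}.
  move=> a aA; rewrite lecR /al (big_rem a) //= lerDl; exact: sumr_ge0.
pose k := (N%:R * al) ^+ 2 + 1.
have k1 : 1 <= k by rewrite lerDr sqr_ge0.
have k0 : 0 < k by rewrite (lt_le_trans ltr01).
have kN : (N%:R * al) ^+ 2 <= k by rewrite lerDl.
have [dl [dl0 dl1 triv]] := trivial_group_decay lift al0 AAal k1 kN.
have Dn0 : (D%:R : R[i]) != 0 by rewrite pnatr_eq0 -lt0n.
have [b [dimb bmom momb]] :=
  kernel_dim_moments al0 AAal k0 kN adm (ker_mx_terms A Dn0).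
suff [m bm] : exists m : int, b = m%:~R.
  by exists m; rewrite /dim_ker dimb bm rmorph_int.
apply: near_integers_integer => eps e0.
have e2 : 0 < eps / 2 by rewrite divr_gt0.
have [q [M small]] := decay_small d dl0 dl1 e2.
have [M2 bM2] := momb _ e0.
case: alternative => [G1|loc].
  have [z zP] := triv G _ At G1 adm; exists z%:Z.
  have h1 := (zP M2).1; have := (zP M).2 q; have := bmom M; rewrite card_ord.
  by rewrite -pmulrn ler_norml => h2 h3; apply/andP; split; lra.
(* The dimension for [G_i] is at most the [M2]-th moment, which is at most [b
   + eps]; conversely [b] is at most the [M]-th moment, which exceeds the
   dimension for [G_i] by at most the decay. *)
have [F HF] := moment_relabel k At (maxn M M2).
have [i [th [thM th1]]] := loc F.
have E := HF _ th thM th1.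
pose Ai := relabel th At.
have admi : admissible AA N Ai by exact: admissible_relabel.
have [B [BE Bact]] := terms_mx Ai.
have kerB : ker_mx B = [set x | l2 x /\ forall j g, act (fun g h : G_ i => (g * h)%g) Ai x j g = 0].
  by apply/seteqP; split=> x [lx kx]; split=> // j g; [rewrite -Bact|rewrite Bact].
have [bi [dimbi bimom mombi]] := kernel_dim_moments al0 AAal k0 kN admi kerB.
have [|m dimm] := (hAtiyah i).2 d B.
  move=> j j' g; rewrite BE; apply: algebraic_sum => t tA.
  exact/algAA/(adm_cf admi).
have bim : bi = m%:~R.
  by apply: (@complexI R); rewrite rmorph_int -dimm /dim_ker dimbi.
exists m; rewrite -bim ler_norml.
have [M' bM'] := mombi _ e2.
have decay_i : has_decay AA N k dl (G_ i).
  exact: classG_has_decay al0 AAal k0 kN triv _ (hclass i).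
have := decay_i _ _ admi q M M'; rewrite card_ord.
rewrite E ?leq_maxl // => h1.
have := bimom M2; rewrite E ?leq_maxr // => h2.
by have h3 := bmom M; apply/andP; split; lra.
Qed.
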